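(* Let $P\subset\mathbb{R}^2$ be the convex centrally symmetric polygon (zonotope) $$P=\Big\{\alpha_1e_1+\cdots+\alpha_me_m:\ \alpha_j\in[-\tfrac12,\tfrac12]\Big\}$$ generated by pairwise non-collinear vectors $e_1,\dots,e_m\in\mathbb{R}^2$ of increasing arguments, and suppose $P$ is not a parallelogram (so $m\ge 3$). Let $\tau_j$ ($1\le j\le m$) be the vector translating the edge of $P$ given by a translate of $e_j$ to its parallel edge, i.e. $\tau_j=\sum_{i>j}e_i-\sum_{i<j}e_i$. Put $$\Lambda_\tau:=\mathrm{span}_{\mathbb{Z}}\{\tau_1,\dots,\tau_m\},\qquad \Lambda_j:=\mathrm{span}_{\mathbb{Z}}\{\tau_i:\ 1\le i\le m,\ i\ne j\}\quad(1\le j\le m).$$ Then $P$ admits a multiple translational tiling if and only if one of the following holds: (1) $m$ is odd and $\Lambda_\tau$ is a lattice; or (2) $m$ is even and there exists $1\le j_0\le m$ such that (a) $\Lambda_{j_0}$ is a lattice, and (b) $\det(e_{j_0},\tau_{j_0})$ is a rational multiple of $\det(\Lambda_{j_0})$. Moreover, if $P$ multi-tiles by translations, then $$L_P:=\begin{cases}\Lambda_\tau, & m\text{ odd},\\[2pt] \displaystyle\bigcap_{j:\ \Lambda_j\text{ is a lattice}}\Lambda_j, & m\text{ even},\end{cases}$$ is a lattice, and $L_P\cap L$ is a lattice for every lattice $L\subset\mathbb{R}^2$ such that $P+L$ multi-tiles.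
   Context: A lattice of $\mathbb{R}^2$ is a discrete subgroup of $\mathbb{R}^2$ isomorphic to $\mathbb{Z}^2$ (full rank); $\det(L)$ denotes the area of a fundamental domain of a lattice $L$, and $\det(u,v)$ is the determinant of the $2\times2$ matrix with columns $u,v$. ''Increasing arguments'' means that the arguments satisfy $\arg e_1<\arg e_2<\cdots<\arg e_m<\arg e_1+\pi$, so that, going counterclockwise around $P$, the edges are translates of $e_1,e_2,\dots,e_m,-e_1,\dots,-e_m$. A discrete multi-set $\Lambda$ in $\mathbb{R}^2$ is a discrete set each of whose points has a finite multiplicity in $\{1,2,\dots\}$. $P+\Lambda$ multi-tiles if there is a positive integer $k$ with $\sum_{\lambda\in\Lambda}\chi_P(x-\lambda)=k$ for almost every $x\in\mathbb{R}^2$ (sum counted with multiplicity). $P$ admits a multiple translational tiling (multi-tiles by translations) if $P+\Lambda$ multi-tiles for some discrete multi-set $\Lambda$. *)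

(* Defs.v *)
From HB Require Import structures.
From mathcomp Require Import all_boot all_order all_algebra.
From mathcomp Require Import all_classical all_reals all_analysis.

Set Implicit Arguments.
Unset Strict Implicit.
Unset Printing Implicit Defensive.

Import Order.TTheory GRing.Theory Num.Theory.
Import numFieldNormedType.Exports.

Local Open Scope classical_set_scope.
Local Open Scope ring_scope.

Section Plane.
Variable R : realType.
Implicit Types (u v : R * R) (A D L P : set (R * R)).

(* [R] is an [lmodType] over itself only through the alias [R^o]; scaling is
   written out so as to keep the measurable structure of [R * R]. *)
Definition scale2 (a : R) u : R * R := (a * u.1, a * u.2).

Definition det2 u v : R := u.1 * v.2 - u.2 * v.1.

Definition area :
    {measure set (measurableTypeR R * measurableTypeR R)%type -> \bar R} :=
  (@lebesgue_measure R \x @lebesgue_measure R)%E.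

Definition discrete_set A : Prop := A `<=` isolated A.

Definition lattice L : Prop :=
  [/\ zmod_closed [in L], discrete_set L &
      exists f : {additive (int * int)%type -> (R * R)%type},
        injective f /\ range f = L].

Definition fundamental_domain L D : Prop :=
  @measurable _ (measurableTypeR R * measurableTypeR R)%type D /\
  forall x : R * R, exists! l, L l /\ D (x - l).

(* All fundamental domains of a lattice have the same, finite, area, so the
   choice made by [xget] is immaterial; the value is junk when [L] is not a
   lattice. *)
Definition lattice_det L : R := fine (area (xget set0 (fundamental_domain L))).

Definition zspan (m : nat) (I : pred 'I_m) (t : 'I_m -> R * R) : set (R * R) :=
  [set x | exists c : 'I_m -> int, x = \sum_(i | I i) t i *~ c i].

(* A multi-set is its multiplicity function, [M x = 0] meaning that [x] is not
   a point of the multi-set. *)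
Definition msupport (M : R * R -> nat) : set (R * R) := [set x | (0 < M x)%N].

Definition set_mult A : R * R -> nat := fun x => x \in A.

Definition multi_tiles_with P (M : R * R -> nat) : Prop :=
  exists2 k : nat, (0 < k)%N &
    {ae area, forall x : R * R,
      \esum_(l in msupport M) ((M l)%:R * \1_P (x - l))%:E = k%:R%:E :> \bar R}.

Definition multi_tiles P : Prop :=
  exists M : R * R -> nat,
    discrete_set (msupport M) /\ multi_tiles_with P M.

Definition parallelogram P : Prop :=
  exists c u v : R * R, det2 u v != 0 /\
    P = [set x | exists s t : R, [/\ 0 <= s <= 1, 0 <= t <= 1 &
                                     x = c + scale2 s u + scale2 t v]].

End Plane.

Section Zonotope.
Variables (R : realType) (m : nat) (e : 'I_m -> R * R).

Definition pairwise_non_collinear : Prop :=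
  forall i j, i != j -> det2 (e i) (e j) != 0.

(* [theta] is a choice of real-valued arguments, not forced into a fixed
   interval of length [2 * pi]. *)
Definition increasing_arguments : Prop :=
  exists r theta : 'I_m -> R,
    [/\ forall j, 0 < r j,
        forall j, e j = scale2 (r j) (cos (theta j), sin (theta j)),
        forall i j : 'I_m, (i < j)%N -> theta i < theta j &
        forall i j : 'I_m, theta j < theta i + pi].

Definition zonotope : set (R * R) :=
  [set x | exists a : 'I_m -> R,
     (forall j, - (1 / 2) <= a j <= 1 / 2) /\ x = \sum_j scale2 (a j) (e j)].

Definition tau (j : 'I_m) : R * R :=
  \sum_(i : 'I_m | (j < i)%N) e i - \sum_(i : 'I_m | (i < j)%N) e i.

Definition Lambda_tau : set (R * R) := zspan xpredT tau.

Definition Lambda_ (j : 'I_m) : set (R * R) := zspan (fun i => i != j) tau.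

Definition L_P : set (R * R) :=
  if odd m then Lambda_tau
  else \bigcap_(j in [set j | lattice (Lambda_ j)]) Lambda_ j.

End Zonotope.

(* Main.v *)
(* Let [W j x] be the number of translation vectors, with multiplicity, on the half-open
   segment [x + [-1/2, 1/2) e_j].  Perturbing [x] in a sector of directions that
   contains no [e_j] replaces the zonotope [P] by a half-open copy of it, and the
   copies belonging to adjacent sectors differ by two half-open edges.  Hence, if
   [P] multi-tiles, every [W j] is [tau j]-periodic; for lattices the converse
   holds as well.

   Let [f] be the multiplicity function of a multi-tiling.  Looking at the jumps of
   [W j] along [e j], one finds that [x |-> f (x + tau j) - f x] is [e j]-periodic.
   So if the average of [f] over the translations by [e j] (a Banach limit) is zero,
   then [f] is [tau j]-periodic; otherwise replace [f] by this average.  Doing this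
   for all [j] gives [g >= 0], not zero and with bounded local sums, which for each
   [j] is periodic under [e j] or [tau j].  By the pigeonhole principle all these
   periods lie in the rational span [V] of two of them; and if [e j] is a period,
   the [tau j]-periodicity of the averaged [W j] puts [tau j] in [V + R e_j].
   Summing the [e_j] modulo [V] then gives the two cases, according to the parity
   of [m].

   Conversely, a lattice multi-tiles as soon as for each [j] it contains [tau j], or
   contains [e j] and meets [tau j + R e_j]. *)

Require Import Defs.
From HB Require Import structures.
From mathcomp Require Import all_boot all_order all_algebra.
From mathcomp Require Import all_classical all_reals all_analysis.
From mathcomp Require Import measurable_realfun ring lra.

Set Implicit Arguments.
Unset Strict Implicit.
Unset Printing Implicit Defensive.

Import Order.TTheory GRing.Theory Num.Theory.
Import numFieldNormedType.Exports.

Local Open Scope classical_set_scope.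
Local Open Scope ring_scope.

(** * Plane geometry of zonotopes *)

Section PlaneAlgebra.
Variable R : realType.
Implicit Types (u v w x y z : R * R) (t : R).

(** The averaging is forced by the generality of the multi-set, whose multiplicity function is not
    assumed to have any period. A Banach limit destroys integrality and discreteness of the support,
    and after it [W j] need no longer be a sum of [f] over a segment. Hence only linear relations,
    and inequalities uniform under translation, are carried along, and [f <= W j] is the surviving
    link between the two. Bounded local sums replace discreteness: a period outside the rational
    span of two independent ones would put infinitely many points of equal positive mass into one
    box. As [P] is not a parallelogram there are three edge directions, so two are of the same kind
    and give two independent periods, both of type [e] or both of type [tau]. For even [m],
    [Lambda_ e j0] contains [e j0] but need not meet the line [tau j0 + R e_j0]. Condition (b)
    provides a rational point on that line, and a refinement of the lattice by some factor [1/n]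
    contains it. If the multi-set is itself a lattice, the same relations hold over its own basis
    without averaging, so the parity argument makes [L_P] commensurable with it. *)

Lemma pairP x y : x.1 = y.1 -> x.2 = y.2 -> x = y.
Proof. by case: x y => [? ?] [? ?] /= -> ->. Qed.

Lemma det2Dr u x y : det2 u (x + y) = det2 u x + det2 u y.
Proof. by rewrite /det2 /=; ring. Qed.

Lemma det2Dl u x y : det2 (x + y) u = det2 x u + det2 y u.
Proof. by rewrite /det2 /=; ring. Qed.

Lemma det2Nr u x : det2 u (- x) = - det2 u x.
Proof. by rewrite /det2 /=; ring. Qed.

Lemma det2Nl u x : det2 (- x) u = - det2 x u.
Proof. by rewrite /det2 /=; ring. Qed.

Lemma det2Br u x y : det2 u (x - y) = det2 u x - det2 u y.
Proof. by rewrite det2Dr det2Nr. Qed.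

Lemma det2Zr t u x : det2 u (scale2 t x) = t * det2 u x.
Proof. by rewrite /det2 /scale2 /=; ring. Qed.

Lemma det2Zl t u x : det2 (scale2 t x) u = t * det2 x u.
Proof. by rewrite /det2 /scale2 /=; ring. Qed.

Lemma det2xx u : det2 u u = 0.
Proof. by rewrite /det2 mulrC subrr. Qed.

Lemma det2C u v : det2 u v = - det2 v u.
Proof. by rewrite /det2; ring. Qed.

Lemma det20r u : det2 u 0 = 0.
Proof. by rewrite /det2 /= !mulr0 subrr. Qed.

Lemma det2_sumr u I (r : seq I) (P : pred I) (F : I -> R * R) :
  det2 u (\sum_(i <- r | P i) F i) = \sum_(i <- r | P i) det2 u (F i).
Proof. exact: (big_morph (det2 u) (det2Dr u) (det20r u)). Qed.

Lemma cramer u v x : det2 u v != 0 ->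
  x = scale2 (det2 x v / det2 u v) u + scale2 (det2 u x / det2 u v) v.
Proof. by rewrite /det2 => ?; apply: pairP => /=; field. Qed.

Lemma scale2D (a b : R) u : scale2 (a + b) u = scale2 a u + scale2 b u.
Proof. by apply: pairP => /=; ring. Qed.

Lemma scale2_1 u : scale2 1 u = u.
Proof. by apply: pairP => /=; ring. Qed.

Lemma scale2_0 u : scale2 0 u = 0.
Proof. by apply: pairP => /=; ring. Qed.

Lemma scale2N (a : R) u : scale2 (- a) u = - scale2 a u.
Proof. by apply: pairP => /=; ring. Qed.

Lemma scale2A (a b : R) u : scale2 a (scale2 b u) = scale2 (a * b) u.
Proof. by apply: pairP => /=; ring. Qed.

Lemma scale2Dr (a : R) u v : scale2 a (u + v) = scale2 a u + scale2 a v.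
Proof. by apply: pairP => /=; ring. Qed.

Lemma det2_eq0 u x : u != 0 -> det2 u x = 0 -> exists t, x = scale2 t u.
Proof.
case: u x => [u1 u2] [x1 x2]; rewrite /det2 /= => u0 E.
have [u10|u10] := eqVneq u1 0.
  have u20 : u2 != 0 by apply: contra u0 => /eqP ->; rewrite u10.
  exists (x2 / u2); apply: pairP => /=; last by field.
  have /eqP : u2 * x1 = 0 by rewrite -[RHS]oppr0 -E u10; ring.
  by rewrite mulf_eq0 (negbTE u20) => /eqP ->; rewrite u10 mulr0.
exists (x1 / u1); apply: pairP => /=; first by field.
apply: (mulfI u10); transitivity (u2 * x1); last by field.
by apply/eqP; rewrite -subr_eq0 E.
Qed.

Lemma helly_intervals (s : seq (R * R)) :
  {in s &, forall p q, p.1 <= q.2} -> exists t, {in s, forall p, p.1 <= t <= p.2}.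
Proof.
elim: s => [|p s IH] H; first by exists 0.
have [t Ht] : exists t, {in s, forall p, p.1 <= t <= p.2}.
  by apply: IH => x y xs ys; apply: H; rewrite inE ?xs ?ys orbT.
(* [t], common to the other intervals, is clamped into [p]; an interval that meets [p] and contains
   [t] also contains the clamped point. *)
exists (Num.max p.1 (Num.min p.2 t)) => q; rewrite inE.
have Hp : p.1 <= p.2 by apply: H; rewrite inE eqxx.
case/predU1P=> [->|qs].
  by rewrite le_max lexx /= ge_max Hp ge_min lexx.
have q1 : p.1 <= q.2 by apply: H; rewrite inE ?eqxx ?qs ?orbT.
have q2 : q.1 <= p.2 by apply: H; rewrite inE ?eqxx ?qs ?orbT.
have /andP[q3 q4] := Ht _ qs.
by rewrite le_max le_min q2 q3 orbT /= ge_max q1 ge_min q4 orbT.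
Qed.

(** The zonotope of [s] with its generators peeled off one at a time, the form suited to an
    induction on their number. *)
Fixpoint in_zonotope (s : seq (R * R)) x : Prop :=
  if s is u :: s' then
    exists2 t, `|t| <= 1 / 2 & in_zonotope s' (x - scale2 t u)
  else x = 0.

(** The length of the range of [det2 u] on the zonotope of [s]. *)
Definition width (s : seq (R * R)) u : R := \sum_(v <- s) `|det2 u v|.

(* The generator [e] is added by intersecting the intervals
   [{t | |det2 b (x - t e)| <= width s b / 2}]; they meet pairwise by the
   Pluecker relation, hence they have a common point. *)
Lemma in_zonotope_facets (s : seq (R * R)) x :
  (1 < size s)%N -> pairwise (fun u v => det2 u v != 0) s ->
  {in s, forall u, `|det2 u x| <= width s u / 2} -> in_zonotope s x.
Proof.
elim: s x => [//|e s IH] x; rewrite /= ltnS => s0 /andP[/allP es ps] H.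
(* With two generators in all, Cramer's rule gives both coefficients. *)
have [s1|s1] := leqP (size s) 1.
  move: s s0 s1 es H {ps IH} => [//|u [|//]] _ _ es H.
  have D : det2 e u != 0 by apply: es; rewrite inE.
  have /= := H e; have /= := H u.
  rewrite /width !big_cons !big_nil !det2xx !normr0 !addr0 add0r.
  rewrite !inE !eqxx orbT => /(_ isT) H1 /(_ isT) H2.
  rewrite [det2 u e]det2C normrN in H1.
  exists (det2 x u / det2 e u).
    rewrite normrM normfV ler_pdivrMr ?normr_gt0 // [det2 x u]det2C normrN.
    by apply: le_trans H1 _; rewrite mulrC mul1r.
  exists (det2 e x / det2 e u).
    rewrite normrM normfV ler_pdivrMr ?normr_gt0 //.
    by apply: le_trans H2 _; rewrite mulrC mul1r.
  by rewrite {1}(cramer x D); apply: pairP => /=; ring.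
pose c b := det2 b x / det2 b e; pose r b := width s b / 2 / `|det2 b e|.
have De b : b \in s -> 0 < `|det2 b e|.
  by move=> /es; rewrite normr_gt0 det2C oppr_eq0.
have wE b : width (e :: s) b = `|det2 b e| + width s b.
  by rewrite /width big_cons.
have pluecker b b' : b \in s -> b' \in s -> c b - r b <= c b' + r b'.
  move=> bs b's; have D := De _ bs; have D' := De _ b's.
  have D0 : det2 b e != 0 by rewrite -normr_gt0.
  have D0' : det2 b' e != 0 by rewrite -normr_gt0.
  (* The inequality for [e] makes the intervals of two old generators meet; the one for an old
     generator [b] makes its interval meet [[-1/2, 1/2]]. *)
  have He : `|det2 e x| <= width s e / 2.
    have := H e; rewrite inE eqxx => /(_ isT).
    by rewrite wE det2xx normr0 add0r.
  have key : `|det2 b b'| * width s e <=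
      width s b * `|det2 b' e| + width s b' * `|det2 b e|.
    rewrite /width mulr_sumr !mulr_suml -big_split /=.
    apply: ler_sum => a _; rewrite -!normrM.
    apply: le_trans (ler_normB _ _).
    rewrite -[X in _ <= X]normrN; rewrite le_eqVlt; apply/orP; left; apply/eqP; congr (`|_|).
    by rewrite /det2; ring.
  have E : c b - c b' = - (det2 b b' * det2 e x) / (det2 b e * det2 b' e).
    by rewrite /c; move: D0 D0'; rewrite /det2 => ? ?; field; apply/andP.
  suff : `|c b - c b'| <= r b + r b'.
    by rewrite ler_norml => /andP[_]; lra.
  rewrite E normrM normrN normfV !normrM /r.
  rewrite ler_pdivrMr ?mulr_gt0 //.
  have -> : (width s b / 2 / `|det2 b e| + width s b' / 2 / `|det2 b' e|) *
            (`|det2 b e| * `|det2 b' e|) =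
     (width s b * `|det2 b' e| + width s b' * `|det2 b e|) / 2.
    by field; rewrite !gt_eqF.
  apply: le_trans (ler_wpM2l (normr_ge0 _) He) _.
  by rewrite mulrA ler_pM2r.
have [t Ht] : exists t,
    {in (- (1 / 2), 1 / 2) :: [seq (c b - r b, c b + r b) | b <- s],
       forall p, p.1 <= t <= p.2}.
  apply: helly_intervals => p q; rewrite !inE.
  have cb b : b \in s -> c b - r b <= 1 / 2 /\ - (1 / 2) <= c b + r b.
    move=> bs; have D := De _ bs.
    have := H b; rewrite inE bs orbT => /(_ isT); rewrite wE => Hb.
    have : `|c b| <= 1 / 2 + r b.
      rewrite /c normrM normfV ler_pdivrMr // mulrDl /r -[X in _ + X]mulrA.
      by rewrite mulVf ?gt_eqF // mulr1; move: Hb; lra.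
    by rewrite ler_norml => /andP[]; lra.
  case/predU1P=> [->|/mapP[b bs ->]]; case/predU1P=> [->|/mapP[b' bs' ->]] /=.
  - lra.
  - by have [] := cb _ bs'.
  - by have [] := cb _ bs.
  - exact: pluecker.
exists t; first by have := Ht _ (mem_head _ _); rewrite ler_norml.
apply: IH => // b bs; have D := De _ bs.
have /= := Ht (c b - r b, c b + r b); rewrite inE.
rewrite (map_f (fun b => (c b - r b, c b + r b)) bs) orbT => /(_ isT) Hc.
have {Hc} : `|c b - t| <= r b by rewrite ler_norml; lra.
have -> : c b - t = det2 b (x - scale2 t e) / det2 b e.
  have D0 : det2 b e != 0 by rewrite -normr_gt0.
  by rewrite /c det2Br det2Zr; field.
by rewrite normrM normfV /r ler_pM2r // invr_gt0.
Qed.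

End PlaneAlgebra.

Lemma uniform_eps_set (R : realType) (T : eqType) (A : set T) (P : T -> R -> Prop) :
  finite_set A ->
  (forall i, A i -> exists2 r, 0 < r & forall t, 0 < t -> t < r -> P i t) ->
  exists2 r, 0 < r & forall i, A i -> forall t, 0 < t -> t < r -> P i t.
Proof.
move=> /finite_seqP[s ->]; elim: s => [|i s IH] H.
  by exists 1 => // i; rewrite /= in_nil.
have [r r0 rP] : exists2 r, 0 < r &
    forall i, i \in s -> forall t, 0 < t -> t < r -> P i t.
  by apply: IH => j /= js; apply: H; rewrite /= inE js orbT.
have [r' r'0 r'P] := H i (mem_head _ _).
exists (Num.min r r'); first by rewrite lt_min r0.
move=> j /=; rewrite inE => /predU1P[->|js] t t0; rewrite lt_min => /andP[tr tr'].
  exact: r'P.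
exact: (rP j).
Qed.

Lemma uniform_eps (R : realType) (I : finType) (P : I -> R -> Prop) :
  (forall i, exists2 r, 0 < r & forall t, 0 < t -> t < r -> P i t) ->
  exists2 r, 0 < r & forall i t, 0 < t -> t < r -> P i t.
Proof.
move=> H; have [r r0 rP] := uniform_eps_set (@finite_finset I setT) (fun i _ => H i).
by exists r => // i t; apply: rP.
Qed.

(** * Facets, edges and half-open copies of the zonotope *)

Section Zonotope.
Variables (R : realType) (m : nat) (e : 'I_m -> R * R).
Hypothesis e_pos : forall i j : 'I_m, (i < j)%N -> 0 < det2 (e i) (e j).
Hypothesis m2 : (2 <= m)%N.
Implicit Types (x y z : R * R) (i j l : 'I_m) (t : R).

Let d i z := det2 (e i) z.

(** The maximum of [det2 (e i)] on the zonotope: the two edges parallel to [e i] lie on the lines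
    where [det2 (e i)] is [h i] and [- h i]. *)
Definition halfwidth i : R := (\sum_l `|det2 (e i) (e l)|) / 2.
Local Notation h := halfwidth.

Lemma e_neg i j : (j < i)%N -> det2 (e i) (e j) < 0.
Proof. by move=> /e_pos; rewrite det2C oppr_gt0. Qed.

Lemma e_noncol i j : i != j -> det2 (e i) (e j) != 0.
Proof.
rewrite neq_ltn => /orP[/e_pos|/e_neg]; first exact: lt0r_neq0.
exact: ltr0_neq0.
Qed.

Lemma exists_neq i : exists j, i != j.
Proof.
have [i0|i0] := eqVneq (nat_of_ord i) 0%N.
  by exists (Ordinal m2); rewrite -val_eqE /= i0.
by exists (Ordinal (ltnW m2)); rewrite -val_eqE /=.
Qed.

Lemma e_neq0 i : e i != 0.
Proof.
have [j /e_noncol] := exists_neq i.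
by apply: contra => /eqP ->; rewrite det2C det20r oppr0.
Qed.

Lemma halfwidth_gt0 i : 0 < h i.
Proof.
have [j ij] := exists_neq i; rewrite /h divr_gt0 // (bigD1 j) //=.
by apply: ltr_wpDr; [apply: sumr_ge0|rewrite normr_gt0 e_noncol].
Qed.

Lemma det2_tau u j : det2 u (tau e j) =
  \sum_(l < m) (if (j < l)%N then det2 u (e l)
          else if (l < j)%N then - det2 u (e l) else 0).
Proof.
rewrite /tau det2Br !det2_sumr -sumrN big_mkcond [X in _ + X]big_mkcond.
rewrite -big_split /=; apply: eq_bigr => l _.
by case: (ltngtP j l); rewrite ?addr0 ?add0r.
Qed.

Lemma halfwidthD i : h i *+ 2 = \sum_l `|det2 (e i) (e l)|.
Proof. by rewrite /h; field. Qed.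

(** The signs in [tau] are those that make each [det2 (e j) (e l)] count with its absolute value. *)
Lemma det2_e_tau j : det2 (e j) (tau e j) = h j *+ 2.
Proof.
rewrite det2_tau halfwidthD; apply: eq_bigr => l _.
case: (ltngtP j l) => [/e_pos/gtr0_norm ->//|/e_neg/ltr0_norm ->//|/val_inj ->].
by rewrite det2xx normr0.
Qed.

(** Equivalently, the ends [tau j / 2 + e j / 2] and [tau j / 2 - e j / 2] of an edge satisfy every
    facet inequality. *)
Lemma det2_tau_le i j : `|det2 (e i) (tau e j)| <= h i *+ 2 - `|det2 (e i) (e j)|.
Proof.
rewrite det2_tau halfwidthD.
rewrite [X in _ <= X - _](bigD1 j) //= addrAC subrr add0r.
apply: le_trans (ler_norm_sum _ _ _) _.
rewrite (bigD1 j) //= ltnn normr0 add0r; apply: ler_sum => l lj.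
by case: (ltngtP j l) => //; rewrite ?normrN ?normr0.
Qed.

(** Group the generators into those before [i], between [i] and [j], and after [j]. On expanding,
    the two terms in [det2 A C] cancel; all others are determinants of earlier against later
    generators, hence nonnegative, and [det2 (e i) (e j)] is positive. *)
Lemma det2_tau_gt0 i j : (i < j)%N -> 0 < det2 (tau e i) (tau e j).
Proof.
move=> ij.
pose A := \sum_(l : 'I_m | (l < i)%N) e l.
pose B := \sum_(l : 'I_m | (i < l < j)%N) e l.
pose C := \sum_(l : 'I_m | (j < l)%N) e l.
have ne : i != j by rewrite neq_ltn ij.
have Ei : tau e i = - A + B + e j + C.
  have S : \sum_(l : 'I_m | (i < l)%N) e l = e j + (B + C).
    rewrite (bigD1 j) //= (bigID (fun l : 'I_m => (l < j)%N)) /=.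
    congr (_ + (_ + _)); apply: eq_bigl => l; rewrite -val_eqE /=.
      by case: (ltngtP l j); rewrite ?andbF ?andbT.
    case: (ltngtP l j); rewrite ?andbF ?andbT //.
    by move=> /(ltn_trans ij) ->.
  by rewrite /tau S -/A; apply: pairP => /=; ring.
have Ej : tau e j = - A - e i - B + C.
  have S : \sum_(l : 'I_m | (l < j)%N) e l = e i + (B + A).
    rewrite (bigD1 i) //= (bigID (fun l : 'I_m => (i < l)%N)) /=.
    congr (_ + (_ + _)); apply: eq_bigl => l; rewrite -val_eqE /=.
      by case: (ltngtP l i); rewrite ?andbF ?andbT.
    case: (ltngtP l i); rewrite ?andbF ?andbT //.
    by move=> li; rewrite (ltn_trans li ij).
  by rewrite /tau S -/C; apply: pairP => /=; ring.
have sum_ge0 (P Q : pred 'I_m) : (forall k l, P k -> Q l -> (k <= l)%N) ->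
    0 <= det2 (\sum_(k | P k) e k) (\sum_(l | Q l) e l).
  move=> PQ; rewrite det2_sumr; apply: sumr_ge0 => l Ql.
  rewrite det2C det2_sumr -sumrN; apply: sumr_ge0 => k Pk.
  rewrite -det2C; have := PQ _ _ Pk Ql; rewrite leq_eqVlt => /predU1P[/val_inj ->|/e_pos/ltW//].
  by rewrite det2xx.
have e1 k : e k = \sum_(l | l == k) e l by rewrite big_pred1_eq.
have hBj : 0 <= det2 B (e j).
  by rewrite (e1 j); apply: sum_ge0 => k l /andP[_ /ltnW +] /eqP ->.
have hiB : 0 <= det2 (e i) B.
  by rewrite (e1 i); apply: sum_ge0 => k l /eqP -> /andP[/ltnW +].
have hBC : 0 <= det2 B C.
  by apply: sum_ge0 => k l /andP[_ kj] jl; apply/ltnW/(ltn_trans kj).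
have hiC : 0 <= det2 (e i) C.
  by rewrite (e1 i); apply: sum_ge0 => k l /eqP -> jl; apply/ltnW/(ltn_trans ij).
have hjC : 0 <= det2 (e j) C.
  by rewrite (e1 j); apply: sum_ge0 => k l /eqP -> jl; apply/ltnW.
have hAB : 0 <= det2 A B.
  by apply: sum_ge0 => k l ki /andP[il _]; apply/ltnW/(ltn_trans ki).
have hAi : 0 <= det2 A (e i).
  by rewrite (e1 i); apply: sum_ge0 => k l ki /eqP ->; apply/ltnW.
have hAj : 0 <= det2 A (e j).
  by rewrite (e1 j); apply: sum_ge0 => k l ki /eqP ->; apply/ltnW/(ltn_trans ki).
have := e_pos ij; rewrite Ei Ej.
rewrite !(det2Dl, det2Dr, det2Br, det2Nl, det2Nr) !det2xx.
rewrite [det2 C A]det2C [det2 C (e i)]det2C [det2 C B]det2C [det2 B A]det2C.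
rewrite [det2 (e j) A]det2C [det2 (e j) (e i)]det2C [det2 (e j) B]det2C.
rewrite [det2 B (e i)]det2C; lra.
Qed.

Lemma tau_noncol i j : i != j -> det2 (tau e i) (tau e j) != 0.
Proof.
rewrite neq_ltn => /orP[/det2_tau_gt0/lt0r_neq0//|/det2_tau_gt0].
by rewrite det2C oppr_gt0 => /ltr0_neq0.
Qed.

Lemma in_zonotope_coef (s : seq 'I_m) x : uniq s -> in_zonotope (map e s) x ->
  exists a : 'I_m -> R, (forall i, - (1 / 2) <= a i <= 1 / 2) /\
     x = \sum_(i <- s) scale2 (a i) (e i).
Proof.
elim: s x => [|k s IH] x /=.
  move=> _ ->; exists (fun=> 0); split; last by rewrite big_nil.
  by move=> _; lra.
move=> /andP[ks us] [t ht] /(IH _ us)[a [ha E]].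
exists (fun i => if i == k then t else a i); split.
  by move=> i; case: eqP => // _; rewrite -ler_norml.
rewrite big_cons eqxx -[LHS](subrK (scale2 t (e k))) E addrC; congr (_ + _).
by apply: eq_big_seq => i is_; case: eqP => // ik; rewrite -ik is_ in ks.
Qed.

Lemma zonotope_le z i : zonotope e z -> `|d i z| <= h i.
Proof.
move=> [a [ha ->]]; rewrite /d det2_sumr /h mulr_suml.
apply: le_trans (ler_norm_sum _ _ _) _; apply: ler_sum => l _.
rewrite det2Zr normrM mulrC ler_wpM2l // ler_norml; have := ha l; lra.
Qed.

Lemma zonotopeP z : zonotope e z <-> forall i, `|d i z| <= h i.
Proof.
split=> [? i|H]; first exact: zonotope_le.
have := @in_zonotope_facets _ (map e (enum 'I_m)) z.
rewrite size_map size_enum_ord => /(_ m2) HH.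
have [| |a [ha E]] := @in_zonotope_coef (enum 'I_m) z.
- exact: enum_uniq.
- apply: HH.
    rewrite pairwise_map; have := enum_uniq 'I_m; rewrite uniq_pairwise.
    by apply: sub_pairwise => i j; exact: e_noncol.
  move=> _ /mapP[i _ ->]; rewrite /width big_map big_enum /=.
  by rewrite -[X in _ <= X]/(h i); exact: H.
- by exists a; split => //; rewrite E big_enum.
Qed.

(** At the maximum of [det2 (e j)] every summand is maximal. This fixes each coefficient at [1/2] or
    [-1/2], according to the side of [j], except that of [e j]. *)
Lemma zonotope_edge z j : zonotope e z -> d j z = h j ->
  exists2 t, - (1 / 2) <= t <= 1 / 2 & z = scale2 (1 / 2) (tau e j) + scale2 t (e j).
Proof.
move=> [a [ha zE]] zj; exists (a j) => //.
have aE l : l != j -> a l * d j (e l) = `|d j (e l)| / 2.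
  move: l; have le_l l : a l * d j (e l) <= `|d j (e l)| / 2.
    apply: le_trans (ler_norm _) _; rewrite normrM mulrC ler_wpM2l // ler_norml.
    by have := ha l; lra.
  suff : \sum_l (`|d j (e l)| / 2 - a l * d j (e l)) = 0.
    move=> S l _; apply/esym/eqP; rewrite -subr_eq0; apply/eqP.
    have /psumr_eq0P := S; apply => // k _.
    by rewrite subr_ge0.
  rewrite big_split /= -mulr_suml sumrN -[X in X - _]/(h j) -zj zE /d det2_sumr.
  by apply/eqP; rewrite subr_eq0; apply/eqP; apply: eq_bigr => l _; rewrite det2Zr.
rewrite zE (bigD1 j) //= addrC; congr (_ + _).
rewrite /tau; set S1 := \sum_(i < m | (j < i)%N) _; set S2 := \sum_(i < m | (i < j)%N) _.
rewrite (bigID (fun l : 'I_m => (j < l)%N)) /= scale2Dr; congr (_ + _).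
  rewrite /S1 (eq_bigl (fun l : 'I_m => (j < l)%N)); last first.
    by move=> l; rewrite -val_eqE /=; case: (ltngtP l j).
  apply: (big_ind2 (fun x y => x = scale2 (1 / 2) y)) => [|? ? ? ? -> ->|l jl].
  - by rewrite /scale2 /= !mulr0.
  - by rewrite scale2Dr.
  congr scale2; have D := e_pos jl.
  have /aE : l != j by rewrite neq_ltn jl orbT.
  rewrite /d gtr0_norm // mulrC => H; apply: (mulfI (lt0r_neq0 D)).
  by rewrite H mul1r.
have -> : scale2 (1 / 2) (- S2) = scale2 (- (1 / 2)) S2.
  by apply: pairP => /=; ring.
rewrite /S2 (eq_bigl (fun l : 'I_m => (l < j)%N)); last first.
  by move=> l; rewrite -val_eqE /=; case: (ltngtP l j).
apply: (big_ind2 (fun x y => x = scale2 (- (1 / 2)) y)) => [|? ? ? ? -> ->|l jl].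
- by rewrite /scale2 /= !mulr0.
- by rewrite scale2Dr.
congr scale2; have D := e_neg jl.
have /aE : l != j by rewrite neq_ltn jl.
rewrite /d ltr0_norm // mulrC => H; apply: (mulfI (ltr0_neq0 D)).
by rewrite H mulrN mul1r mulNr.
Qed.

(* The half-open copy of the zonotope made of the [z] such that [z + w] is in the
   zonotope for all small [w] in the [n]-th sector of directions, the one between
   [e (n - 1)] and [e n]; it goes over to the opposite sector as [n] goes from [0]
   to [m]. *)
Definition window (n : nat) : set (R * R) :=
  [set z | forall i, if (i < n)%N then - h i <= d i z < h i
                     else - h i < d i z <= h i].

Definition edge j : set (R * R) :=
  [set z | exists2 t, - (1 / 2) <= t < 1 / 2 & z = scale2 t (e j)].

Lemma zonotopeN z : zonotope e z -> zonotope e (- z).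
Proof. by move=> /zonotopeP H; apply/zonotopeP => i; rewrite /d det2Nr normrN; apply: H. Qed.

Lemma scale2_inj (u : R * R) : u != 0 -> injective (fun s => scale2 s u).
Proof.
case: u => [u1 u2] /eqP u0 s t [] E1 E2; apply/eqP; rewrite -subr_eq0.
apply: contra_notT u0 => st; congr (_, _); apply: (mulfI st).
  by rewrite mulr0 mulrBl E1 subrr.
by rewrite mulr0 mulrBl E2 subrr.
Qed.

Lemma edgeP (s : R) j z : s = 1 \/ s = - 1 ->
  edge j (z - scale2 (s / 2) (tau e j)) <->
  d j z = s * h j /\ forall i, i != j ->
     if (i < j)%N then - h i <= d i z < h i else - h i < d i z <= h i.
Proof.
move=> hs; set c := scale2 _ _.
have dc i : `|d i c| <= h i - `|d i (e j)| / 2.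
  rewrite /d det2Zr normrM.
  have -> : `|s / 2| = 1 / 2.
    by case: hs => ->; rewrite ?mulN1r ?normrN gtr0_norm // mul1r.
  by have := det2_tau_le i j; rewrite -mulr_natr; lra.
have djc : d j c = s * h j.
  by rewrite /d det2Zr det2_e_tau -mulr_natr; field.
split=> [[t ht /eqP]|[zj zi]].
  rewrite subr_eq => /eqP ->; rewrite /d det2Dr det2Zr det2xx mulr0 add0r.
  split=> // i ij; rewrite det2Dr det2Zr.
  have := dc i; rewrite ler_norml /d => /andP[c1 c2].
  have := ij; rewrite neq_ltn => /orP[ij'|ij'].
    rewrite ij'; have D := e_pos ij'; rewrite (gtr0_norm D) in c1 c2.
    move: ht => /andP[t1 t2].
    have := ler_wpM2r (ltW D) t1; have : t * det2 (e i) (e j) < 1 / 2 * det2 (e i) (e j).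
      by rewrite ltr_pM2r.
    by lra.
  rewrite ltnNge (ltnW ij') /=; have D := e_neg ij'; rewrite (ltr0_norm D) in c1 c2.
  move: ht => /andP[t1 t2].
  have := ler_wnM2r (ltW D) t1; have : 1 / 2 * det2 (e i) (e j) < t * det2 (e i) (e j).
    by rewrite ltr_nM2r.
  by lra.
have [t zc] : exists t, z - c = scale2 t (e j).
  apply: det2_eq0; first exact: e_neq0.
  by rewrite -/(d j _) /d det2Br -!/(d j _) zj djc subrr.
have zE : z = c + scale2 t (e j) by rewrite -zc addrC subrK.
have bound t' : zonotope e (c + scale2 t' (e j)) -> - (1 / 2) <= t' <= 1 / 2.
  have djt : d j (c + scale2 t' (e j)) = s * h j.
    by rewrite /d det2Dr det2Zr det2xx mulr0 addr0.
  move=> zz; case: hs => hs; rewrite hs in djt *.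
    have [|t'' ht''] := zonotope_edge (j := j) zz; first by rewrite djt mul1r.
    rewrite /c hs => /addrI /(scale2_inj (e_neq0 j)) -> //.
  have [|t'' ht''] := zonotope_edge (j := j) (zonotopeN zz).
    by rewrite /d det2Nr -/(d _ _) djt mulN1r opprK.
  rewrite /c hs mulNr scale2N opprD opprK => /addrI; rewrite -scale2N.
  by move/(scale2_inj (e_neq0 j)); lra.
(* The inequalities at [i != j] are strict on the side towards which [+ e j] moves, so a short move
   along [e j] stays in the zonotope; this improves [t <= 1/2] to [t < 1/2]. *)
have [r r0 rP] : exists2 r, 0 < r & forall i t', 0 < t' -> t' < r ->
    `|d i (z + scale2 t' (e j))| <= h i.
  apply: uniform_eps => i; have [->|ij] := eqVneq i j.
    exists 1 => // t' _ _; rewrite /d det2Dr det2Zr det2xx mulr0 addr0 -/(d j z) zj.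
    have := halfwidth_gt0 j; case: hs => -> ?; rewrite ?mul1r ?mulN1r ?normrN gtr0_norm //.
  have := zi i ij; have := ij; rewrite neq_ltn => /orP[ij'|ij'].
    rewrite ij' => /andP[z1 z2]; have D := e_pos ij'.
    exists ((h i - d i z) / d i (e j)); first by apply: divr_gt0; [rewrite subr_gt0|exact: D].
    move=> t' t0; rewrite ltr_pdivlMr // /d det2Dr det2Zr -/(d i z) -/(d i _) => H.
    have := mulr_gt0 t0 D; rewrite -/(d i _) ler_norml; lra.
  rewrite ltnNge (ltnW ij') /= => /andP[z1 z2]; have D := e_neg ij'.
  have D' : 0 < - d i (e j) by rewrite oppr_gt0; exact: D.
  exists ((h i + d i z) / - d i (e j)).
    by apply: divr_gt0; [rewrite -ltrBlDl sub0r|rewrite oppr_gt0; exact: D].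
  move=> t' t0; rewrite ltr_pdivlMr ?oppr_gt0 // /d det2Dr det2Zr -/(d i z) -/(d i _) => H.
  have := mulr_gt0 t0 D'; rewrite ler_norml; lra.
have hr : - (1 / 2) <= t + r / 2 <= 1 / 2.
  apply: bound; rewrite scale2D addrA -zE; apply/zonotopeP => i; apply: rP; lra.
have h0 : - (1 / 2) <= t <= 1 / 2.
  apply: bound; rewrite -zE; apply/zonotopeP => i; rewrite ler_norml.
  have [->|ij] := eqVneq i j.
    by have := halfwidth_gt0 j; rewrite zj; case: hs => -> ?; lra.
  by have := zi i ij; case: ifP => _; lra.
by exists t => //; lra.
Qed.

(** The two windows differ only in which end of the [j]-th strip they contain. Both sides are sums,
    so that the identity can be added up over translates in the extended reals. *)
Lemma window_step j z :
  \1_(window j.+1) z + \1_(edge j) (z - scale2 (1 / 2) (tau e j)) =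
  \1_(window j) z + \1_(edge j) (z + scale2 (1 / 2) (tau e j)) :> R.
Proof.
have -> : z + scale2 (1 / 2) (tau e j) = z - scale2 (- 1 / 2) (tau e j).
  by congr (_ + _); rewrite -scale2N mulNr opprK.
have ep := edgeP (s := 1) j z (or_introl erefl).
have em := edgeP (s := - 1) j z (or_intror erefl).
have h0 := halfwidth_gt0 j.
pose Q := forall i, i != j ->
     if (i < j)%N then - h i <= d i z < h i else - h i < d i z <= h i.
have wS : window j.+1 z <-> Q /\ - h j <= d j z < h j.
  split=> [H|[HQ Hj] i].
    split; last by have := H j; rewrite ltnSn.
    by move=> i ij; have := H i; rewrite ltnS [(i <= j)%N]leq_eqVlt (negbTE (ij : (i : nat) != j)).
  have [->|ij] := eqVneq i j; first by rewrite ltnSn.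
  by have := HQ i ij; rewrite ltnS [(i <= j)%N]leq_eqVlt (negbTE (ij : (i : nat) != j)).
have w0 : window j z <-> Q /\ - h j < d j z <= h j.
  split=> [H|[HQ Hj] i].
    split; last by have := H j; rewrite ltnn.
    by move=> i ij; have := H i.
  by have [->|ij] := eqVneq i j; [rewrite ltnn|exact: HQ].
rewrite !indicE.
have -> : (z \in window j.+1) = `[< Q >] && (- h j <= d j z < h j).
  apply/idP/andP => [/set_mem/wS[? ?]|[/asboolP ? ?]]; last exact/mem_set/wS.
  by split=> //; apply/asboolP.
have -> : (z \in window j) = `[< Q >] && (- h j < d j z <= h j).
  apply/idP/andP => [/set_mem/w0[? ?]|[/asboolP ? ?]]; last exact/mem_set/w0.
  by split=> //; apply/asboolP.
have -> : (z - scale2 (1 / 2) (tau e j) \in edge j) = `[< Q >] && (d j z == h j).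
  apply/idP/andP => [/set_mem/ep[? ?]|[/asboolP ? /eqP zj]].
    by rewrite -[h j]mul1r; split; [apply/asboolP|apply/eqP].
  by apply/mem_set/ep; rewrite mul1r.
have -> : (z - scale2 (- 1 / 2) (tau e j) \in edge j) = `[< Q >] && (d j z == - h j).
  apply/idP/andP => [/set_mem/em[? ?]|[/asboolP ? /eqP zj]].
    by rewrite -[- h j]mulN1r; split; [apply/asboolP|apply/eqP].
  by apply/mem_set/em; rewrite mulN1r.
case: asboolP => //= _.
case: (ltrgtP (d j z) (h j)) => [zh|zh|zh]; case: (ltrgtP (d j z) (- h j)) => zh' //=;
  rewrite ?addr0 ?add0r //; lra.
Qed.

End Zonotope.

(** * Counting translates *)

Section TileCount.
Variable R : realType.
Implicit Types (M : R * R -> nat) (A B : set (R * R)) (x y z c : R * R).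

Definition tile_count M A x : \bar R :=
  \esum_(l in msupport M) ((M l)%:R * \1_A (x - l))%:E.

Definition box (K : R) : set (R * R) := [set z | `|z.1| <= K /\ `|z.2| <= K].

Lemma weight_ge0 M A x l : (0 <= ((M l)%:R * \1_A (x - l) : R)%:E)%E.
Proof. by rewrite lee_fin mulr_ge0. Qed.

Lemma indic_le A B x y : (A x -> B y) -> \1_A x <= \1_B y :> R.
Proof.
move=> AB; rewrite !indicE ler_nat.
by case: (boolP (x \in A)) => // /set_mem /AB /mem_set ->.
Qed.

Lemma le_tile_count M A B x y :
  (forall l, (0 < M l)%N -> A (x - l) -> B (y - l)) ->
  (tile_count M A x <= tile_count M B y)%E.
Proof.
move=> AB; apply: le_esum => l Ml; rewrite lee_fin ler_wpM2l //.
by apply: indic_le; exact: AB.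
Qed.

Lemma eq_tile_count M A B x y :
  (forall l, (0 < M l)%N -> (A (x - l) <-> B (y - l))) ->
  tile_count M A x = tile_count M B y.
Proof.
move=> AB; apply/eqP; rewrite eq_le.
by apply/andP; split; apply: le_tile_count => l /AB[].
Qed.

Lemma tile_count_ge_sum M A x (s : seq (R * R)) : uniq s ->
  (forall l, l \in s -> A (x - l)) ->
  ((\sum_(l <- s) (M l)%:R)%:E <= tile_count M A x)%E.
Proof.
move=> us sA; pose X : set (R * R) := [set l | l \in s /\ (0 < M l)%N].
apply: esum_ge; exists X.
  split; last by move=> l [].
  by apply: sub_finite_set (finite_seq s) => l [].
have finX : finite_set X by apply: sub_finite_set (finite_seq s) => l [].
rewrite fsbig_finite //=.
rewrite -sumEFin (bigID (fun l => (0 < M l)%N)) /= [X in (_ + X)%E]big1 ?adde0; last first.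
  by move=> l; rewrite -eqn0Ngt => /eqP ->.
rewrite -big_filter (perm_big (finmap.enum_fset (fset_set X))) /=; last first.
  apply: uniq_perm; rewrite ?filter_uniq // => l.
  rewrite mem_filter in_fset_set //; apply/andP/idP => [[? ?]|/set_mem[]//].
  by apply/mem_set.
rewrite le_eqVlt; apply/orP; left; apply/eqP; apply: eq_big_seq => l.
rewrite in_fset_set // => /set_mem[ls _]; congr (_%:E).
by rewrite indicE mem_set ?mulr1 //; apply: sA.
Qed.

(** Multiplicities on the support are at least one, so more than [C] points would exceed the
    bound. *)
Lemma tile_count_finite M A x (C : nat) : (tile_count M A x <= C%:R%:E)%E ->
  finite_set [set l | (0 < M l)%N /\ A (x - l)].
Proof.
move=> HC; apply: contrapT => /(@infinite_set_fset _ _ C.+1)[X XA].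
apply/negP; rewrite -ltnNge ltnS.
rewrite -(ler_nat R) -lee_fin; apply: le_trans HC.
pose s : seq (R * R) := finmap.enum_fset X.
have sA : forall l, l \in s -> A (x - l) by move=> l /XA[].
apply: le_trans (tile_count_ge_sum M (finmap.fset_uniq X : uniq s) sA).
rewrite lee_fin -sum1_size natr_sum [leLHS]big_seq [leRHS]big_seq.
by apply: ler_sum => l /XA[Ml _]; rewrite ler_nat.
Qed.

Lemma grid1 (K r : R) : 0 < r ->
  exists s : seq R, forall y : R, `|y| <= K -> exists2 c : R, c \in s & `|y - c| <= r.
Proof.
move=> r0; have [K0|K0] := ltP K 0.
  by exists [::] => y /(le_trans (normr_ge0 _)); rewrite leNgt K0.
pose N := Num.trunc (2 * K / r).
exists [seq - K + r *+ i | i <- iota 0 N.+1] => y; rewrite ler_norml => /andP[y1 y2].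
have yK : 0 <= (y + K) / r by apply: divr_ge0; lra.
have /andP[t1 t2] := truncn_itv yK.
exists (- K + r *+ Num.trunc ((y + K) / r)).
  apply/mapP; exists (Num.trunc ((y + K) / r)) => //.
  rewrite mem_iota add0n ltnS /N; apply: le_truncn.
  by rewrite ler_pM2r ?invr_gt0 //; lra.
rewrite ler_pdivlMr // in t1; rewrite ltr_pdivrMr // in t2.
rewrite -[r *+ _]mulr_natl.
set T := Num.trunc _ in t1 t2 *.
have T1 : T.+1%:R * r = T%:R * r + r by rewrite -natr1 mulrDl mul1r.
rewrite T1 in t2.
by rewrite ler_norml; apply/andP; split; lra.
Qed.

Lemma grid2 (K r : R) : 0 < r ->
  exists s : seq (R * R), forall y, box K y -> exists2 c, c \in s & box r (y - c).
Proof.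
move=> r0; have [s Hs] := grid1 K r0.
exists [seq (a, b) | a <- s, b <- s] => y [/Hs[a as_ ya] /Hs[b bs yb]].
by exists (a, b) => //; apply/allpairsP; exists (a, b).
Qed.

(** A large box is covered by finitely many translates of a small one. *)
Lemma tile_count_box M (r : R) (k : nat) : 0 < r ->
  (forall x, (tile_count M (box r) x <= k%:R%:E)%E) ->
  forall K, exists C : nat, forall x, (tile_count M (box K) x <= C%:R%:E)%E.
Proof.
move=> r0 Hk K; have [s Hs] := grid2 K r0.
exists (size s * k)%N => x.
apply: (@le_trans _ _ (\sum_(c <- s) tile_count M (box r) (x - c)%R)%E); last first.
  apply: (@le_trans _ _ (\sum_(c <- s) k%:R%:E)%E); first by apply: lee_sum.
  by rewrite sumEFin lee_fin big_const_seq count_predT iter_addr_0 natrM mulr_natl.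
rewrite -esum_sum; last by move=> *; apply: weight_ge0.
apply: le_esum => l Ml; rewrite sumEFin lee_fin.
have [xl|xl] := pselect (box K (x - l)); last first.
  by rewrite indicE memNset // mulr0; apply: sumr_ge0 => c _; rewrite mulr_ge0.
have [c cs xlc] := Hs _ xl.
rewrite (big_rem c) //= addrAC indicE mem_set // indicE mem_set //.
rewrite lerDl; apply: sumr_ge0 => c' _; exact: mulr_ge0.
Qed.

End TileCount.

(** * Sectors of directions *)

Section Sectors.
Variables (R : realType) (m : nat) (e : 'I_m -> R * R).
Hypothesis e_pos : forall i j : 'I_m, (i < j)%N -> 0 < det2 (e i) (e j).
Hypothesis m2 : (2 <= m)%N.
Implicit Types (M : R * R -> nat) (x y z w : R * R) (i j l : 'I_m).

Local Notation d i z := (det2 (e i) z).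
Local Notation h := (halfwidth e).
Local Notation P := (zonotope e).

(** The sign of [det2 (e i)] on the [n]-th sector, whose directions lie between [e (n - 1)] and
    [e n]. *)
Definition sector_sign (n : nat) (i : 'I_m) : R := if (i < n)%N then 1 else - 1.

Definition in_sector (n : nat) (r : R) : set (R * R) :=
  [set w | forall i, 0 < sector_sign n i * d i w < r].

Definition i_first : 'I_m := Ordinal (ltnW m2).
Definition i_last : 'I_m := Ordinal (ltac:(by rewrite prednK // ltnW) : (m.-1 < m)%N).

Lemma det2_last i : i != i_last -> 0 < d i (e i_last).
Proof.
move=> il; apply: e_pos; rewrite /= ltn_neqAle -ltnS prednK ?ltn_ord 1?ltnW // andbT.
by move: il; rewrite -val_eqE.
Qed.

Lemma det2_first i : i != i_first -> d i (e i_first) < 0.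
Proof. by move=> i0; apply: e_neg => //; rewrite lt0n -val_eqE in i0 *. Qed.

(** These vectors lie in the sector [m], between the last generator and the opposite of the first;
    their opposites lie in the sector [0]. *)
Lemma det2_wrap (s t : R) i : 0 < s -> 0 < t ->
  0 < d i (scale2 s (e i_last) - scale2 t (e i_first)).
Proof.
move=> s0 t0; rewrite det2Br !det2Zr.
have [->|il] := eqVneq i i_last.
  have : i_last != i_first by rewrite -val_eqE /= -lt0n -ltnS prednK // ltnW.
  move=> /det2_first H; rewrite det2xx mulr0 sub0r -mulrN mulr_gt0 // oppr_gt0.
  exact: H.
have [->|i0] := eqVneq i i_first.
  rewrite det2xx mulr0 subr0 mulr_gt0 // det2_last // -val_eqE /= eq_sym -lt0n.
  by rewrite -ltnS prednK // ltnW.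
rewrite subr_gt0; apply: (@lt_trans _ _ 0).
  by rewrite pmulr_rlt0 // det2_first.
by rewrite mulr_gt0 // det2_last.
Qed.

(** An inner sector contains [e (n - 1) + e n]; the two extreme sectors wrap around and are served
    by [det2_wrap]. *)
Lemma sector_direction n : (n <= m)%N ->
  exists u, forall i, 0 < sector_sign n i * d i u.
Proof.
move=> nm; pose w := scale2 1 (e i_last) - scale2 1 (e i_first).
have [n0|n0] := posnP n.
  exists (- w) => i; rewrite n0 /sector_sign ltn0 det2Nr mulrNN mul1r.
  exact: det2_wrap.
have [nm'|nm'] := ltnP n m; last first.
  exists w => i; rewrite /sector_sign (leq_trans (ltn_ord i) nm') mul1r.
  exact: det2_wrap.
have n1 : (n.-1 < m)%N by apply: leq_ltn_trans nm'; apply: leq_pred.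
pose a := Ordinal n1; pose b := Ordinal nm'.
exists (e a + e b) => i; rewrite /sector_sign det2Dr; case: ltnP => ni.
  rewrite mul1r; apply: ltr_wpDl; last exact: e_pos.
  have : (i <= a)%N by rewrite /= -ltnS prednK.
  by rewrite leq_eqVlt => /predU1P[/val_inj ->|/e_pos/ltW//]; rewrite det2xx.
rewrite mulN1r oppr_gt0; apply: ltr_wnDr; last first.
  by apply: e_neg => //; rewrite /= prednK.
move: ni; rewrite leq_eqVlt => /predU1P[ni|bi]; last exact/ltW/e_neg.
by rewrite (_ : i = b) ?det2xx //; apply: val_inj.
Qed.

Lemma sector_sign_sq n i : sector_sign n i * sector_sign n i = 1.
Proof. by rewrite /sector_sign; case: ifP; rewrite ?mulrNN mulr1. Qed.

Lemma window_zonotope n z : window e n z -> P z.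
Proof.
move=> H; apply/zonotopeP => // i; rewrite ler_norml.
by have := H i; case: ifP => _; lra.
Qed.

Lemma zonotope_window n z : (forall i, `|d i z| < h i) -> window e n z.
Proof. by move=> H i; have := H i; rewrite ltr_norml; case: ifP => _; lra. Qed.

(** The first equivalence turns counts for the zonotope into counts for a window. The second,
    stability of the window itself, makes the window count of a lattice locally constant in the
    directions of the sector. *)
Lemma in_sector_point n z : exists2 r : R, 0 < r & forall w, in_sector n r w ->
  (P (z + w) <-> window e n z) /\ (window e n (z + w) <-> window e n z).
Proof.
pose hw i v := if (i < n)%N then - h i <= v < h i else - h i < v <= h i.
have [r r0 rP] : exists2 r, 0 < r & forall i t, 0 < t -> t < r ->
    (`|d i z + sector_sign n i * t| <= h i) = hw i (d i z) /\
    hw i (d i z + sector_sign n i * t) = hw i (d i z).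
  apply: uniform_eps => i; rewrite /hw /sector_sign; have h0 := halfwidth_gt0 e_pos m2 i.
  set v := d i z; set a := h i in h0 *.
  case: ifP => _.
    have [va|va] := ltP v (- a).
      exists (- a - v); first lra.
      move=> t t0 tr; split; apply/idP/idP; rewrite ?ler_norml; lra.
    have [va'|va'] := ltP v a.
      exists (a - v); first lra.
      move=> t t0 tr; split; apply/idP/idP; rewrite ?ler_norml; lra.
    exists 1 => // t t0 tr; split; apply/idP/idP; rewrite ?ler_norml; lra.
  have [va|va] := ltP a v.
    exists (v - a); first lra.
    move=> t t0 tr; split; apply/idP/idP; rewrite ?ler_norml; lra.
  have [va'|va'] := ltP (- a) v.
    exists (a + v); first lra.
    move=> t t0 tr; split; apply/idP/idP; rewrite ?ler_norml; lra.
  exists 1 => // t t0 tr; split; apply/idP/idP; rewrite ?ler_norml; lra.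
exists r => // w Hw.
have Hr i := rP i _ (proj1 (andP (Hw i))) (proj2 (andP (Hw i))).
have E i : d i (z + w) = d i z + sector_sign n i * (sector_sign n i * d i w).
  by rewrite mulrA sector_sign_sq mul1r det2Dr.
split.
  apply: (iff_trans (zonotopeP e_pos m2 _)).
  split=> H i; have [H1 _] := Hr i.
    by have := H i; rewrite E H1.
  by rewrite E H1; exact: H.
by split=> H i; have [_ H2] := Hr i; have := H i; rewrite E -/(hw i _) -/(hw i _) H2.
Qed.

(** The margin [1] absorbs a perturbation [w] with [|d i w| < 1]: for [l] in the support but outside
    this set, neither [x] nor [x + w] lies in the translate by [l]. *)
Definition nearby M x : set (R * R) :=
  [set l | (0 < M l)%N /\ forall i, `|d i (x - l)| <= h i + 1].

End Sectors.

Lemma areaX (R : realType) (A B : set (measurableTypeR R)) :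
  measurable A -> measurable B ->
  area R (A `*` B) = (@lebesgue_measure R A * @lebesgue_measure R B)%E.
Proof. by move=> mA mB; exact: product_measure1E. Qed.

(** * Pointwise consequences of a multi-tiling *)

Section Tiling.
Variables (R : realType) (m : nat) (e : 'I_m -> R * R).
Hypothesis e_pos : forall i j : 'I_m, (i < j)%N -> 0 < det2 (e i) (e j).
Hypothesis m2 : (2 <= m)%N.
Implicit Types (M : R * R -> nat) (x y z w l : R * R) (i j : 'I_m).

Local Notation d i z := (det2 (e i) z).
Local Notation h := (halfwidth e).
Local Notation P := (zonotope e).

Lemma in_sector_le n (r r' : R) w : r <= r' -> in_sector e n r w -> in_sector e n r' w.
Proof. by move=> rr H i; have /andP[-> /lt_le_trans->] := H i. Qed.

Lemma sector_sign_abs n i : `|sector_sign R n i| = 1.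
Proof. by rewrite /sector_sign; case: ifP; rewrite ?normrN normr1. Qed.

Lemma in_sector_abs n r w i : in_sector e n r w -> `|d i w| < r.
Proof.
move=> /(_ i)/andP[s0 sr].
by rewrite -[`|_|]mul1r -(sector_sign_abs n i) -normrM gtr0_norm.
Qed.

Lemma in_sector_count M x n : finite_set (nearby e M x) ->
  exists2 r, 0 < r & forall w, in_sector e n r w ->
    tile_count M P (x + w) = tile_count M (window e n) x /\
    tile_count M (window e n) (x + w) = tile_count M (window e n) x.
Proof.
move=> fin.
have [r r0 rP] : exists2 r, 0 < r & forall l, nearby e M x l ->
    forall t, 0 < t -> t < r -> forall w, in_sector e n t w ->
      (P (x - l + w) <-> window e n (x - l)) /\
      (window e n (x - l + w) <-> window e n (x - l)).
  apply: uniform_eps_set => // l _.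
  have [r r0 rP] := in_sector_point e_pos m2 n (x - l).
  by exists r => // t t0 tr w Hw; apply: rP; apply: in_sector_le Hw; apply: ltW.
exists (Num.min 1 (r / 2)); first by rewrite lt_min ltr01 divr_gt0.
move=> w Hw.
have far l : (0 < M l)%N -> ~ nearby e M x l -> exists i,
    h i < `|d i (x - l)| /\ h i < `|d i (x - l + w)|.
  move=> Ml /not_andP[//|/existsNP[i /negP]]; rewrite -ltNge => H.
  exists i; split; first lra.
  have : `|d i w| < 1.
    by apply: (@in_sector_abs n); apply: in_sector_le Hw; rewrite ge_min lexx.
  have := ler_normB (d i (x - l + w)) (d i w).
  by rewrite det2Dr addrK; lra.
have near l : (0 < M l)%N -> nearby e M x l ->
    (P (x - l + w) <-> window e n (x - l)) /\
    (window e n (x - l + w) <-> window e n (x - l)).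
  move=> Ml /rP H; apply: (H (r / 2)); rewrite ?divr_gt0 //; first lra.
  by apply: in_sector_le Hw; rewrite ge_min lexx orbT.
have out A z i : A `<=` P -> h i < `|d i z| -> ~ A z.
  by move=> AP hz /AP/(zonotope_le i); rewrite leNgt hz.
have wP : window e n `<=` P by move=> z; apply: window_zonotope.
split; apply: eq_tile_count => l Ml; rewrite addrAC.
  have [/(near _ Ml)[]//|/(far _ Ml)[i [H1 H2]]] := pselect (nearby e M x l).
  by split=> [/(out _ _ i)|/(out _ _ i)]; move=> /(_ _); [case|case].
have [/(near _ Ml)[]//|/(far _ Ml)[i [H1 H2]]] := pselect (nearby e M x l).
by split=> [/(out _ _ i wP)|/(out _ _ i wP)]; case.
Qed.

Lemma det2_box (u : R * R) (K : R) z : box K z -> `|det2 u z| <= (`|u.1| + `|u.2|) * K.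
Proof.
move=> [z1 z2]; apply: le_trans (ler_normB _ _) _; rewrite !normrM mulrDl.
by apply: lerD; rewrite ler_wpM2l.
Qed.

Definition open_box (c : R * R) (r : R) : set (R * R) :=
  `]c.1 - r, c.1 + r[ `*` `]c.2 - r, c.2 + r[.

Lemma open_box_pos (c : R * R) (r : R) : 0 < r -> (0 < area R (open_box c r))%E.
Proof.
move=> r0; rewrite /open_box areaX; try exact: measurable_itv.
rewrite !lebesgue_measure_itv /= !lte_fin !ifT; [|lra|lra].
by rewrite -!EFinB -EFinM lte_fin mulr_gt0 //; lra.
Qed.

(** Every truncated sector contains an open box, which has positive area and so cannot lie in a null
    set. *)
Lemma ae_sector (Q : R * R -> Prop) x n r : (n <= m)%N -> 0 < r ->
  {ae area R, forall y, Q y} -> exists2 w, in_sector e n r w & Q (x + w).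
Proof.
move=> nm r0 [N [mN N0 NQ]].
have [u Hu] := sector_direction e_pos m2 nm.
have [s s0 sP] : exists2 s, 0 < s & forall i t, 0 < t -> t < s ->
    t * (sector_sign R n i * d i u) < r.
  apply: uniform_eps => i; exists (r / (sector_sign R n i * d i u)).
    by rewrite divr_gt0.
  by move=> t t0; rewrite ltr_pdivlMr.
pose w0 := scale2 (s / 2) u.
have Hw0 : in_sector e n r w0.
  move=> i; rewrite /w0 det2Zr mulrCA mulr_gt0 ?divr_gt0 //=.
  by apply: sP; rewrite ?divr_gt0 //; lra.
have [q q0 qP] : exists2 q, 0 < q & forall i t, 0 < t -> t < q ->
    forall v, box t v -> 0 < sector_sign R n i * d i (w0 + v) < r.
  apply: uniform_eps => i; have /andP[H1 H2] := Hw0 i.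
  set a := sector_sign R n i * _ in H1 H2.
  pose K := `|(e i).1| + `|(e i).2| + 1.
  have K0 : 0 < K by rewrite ltr_wpDl // addr_ge0.
  exists (Num.min (a / K) ((r - a) / K)).
    by rewrite lt_min !divr_gt0 ?subr_gt0.
  move=> t t0; rewrite lt_min !ltr_pdivlMr // => /andP[ta tr] v /(det2_box (e i)) Hv.
  have : `|sector_sign R n i * d i v| < t * K.
    rewrite normrM sector_sign_abs mul1r; apply: le_lt_trans Hv _.
    by rewrite mulrC ltr_pM2l // /K ltrDl.
  by rewrite ltr_norml => H; rewrite det2Dr mulrDr -/a; lra.
have q2 : 0 < q / 2 by rewrite divr_gt0.
have qq : q / 2 < q by lra.
have := open_box_pos (x + w0) q2.
set B := open_box _ _ => B0.
apply: contrapT => /forall2NP HN.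
suff BN : B `<=` N.
  suff : (area R B <= area R N)%E by rewrite N0 leNgt B0.
  by apply: le_measure => //; rewrite inE //; apply: measurableX; exact: measurable_itv.
move=> y [/=]; rewrite !in_itv /= => /andP[y1 y2] /andP[y3 y4].
apply: NQ => /= Qy; have [] := HN (y - x).
  have -> : y - x = w0 + (y - x - w0) by rewrite [RHS]addrC subrK.
  apply; move=> i; apply: (qP i (q / 2)) => //.
  by split; rewrite /= ler_norml; move: y1 y2 y3 y4; rewrite /= -/w0; lra.
by rewrite addrC subrK.
Qed.

Lemma box_of_widths (K : 'I_m -> R) :
  exists C, forall z, (forall i, `|d i z| <= K i) -> box C z.
Proof.
pose u := e (i_first m2); pose v := e (i_last m2).
have D : 0 < det2 u v.
  by apply: det2_last => //; rewrite -val_eqE /= eq_sym -lt0n -ltnS prednK // ltnW.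
pose a := K (i_first m2) / det2 u v; pose b := K (i_last m2) / det2 u v.
exists (b * (`|u.1| + `|u.2|) + a * (`|v.1| + `|v.2|)) => z Hz.
have D0 : det2 u v != 0 by exact: lt0r_neq0.
have Hb : `|det2 z v / det2 u v| <= b.
  by rewrite normrM normfV (gtr0_norm D) ler_pM2r ?invr_gt0 // det2C normrN; exact: Hz.
have Ha : `|det2 u z / det2 u v| <= a.
  by rewrite normrM normfV (gtr0_norm D) ler_pM2r ?invr_gt0 //; exact: Hz.
have b0 : 0 <= b by apply: le_trans Hb.
have a0 : 0 <= a by apply: le_trans Ha.
move: (cramer z D0) Hb Ha; set p := _ / _; set q := _ / _ => -> Hb Ha.
split => /=; apply: le_trans (ler_normD _ _) _; rewrite (normrM p) (normrM q).
  by apply: lerD; apply: ler_pM => //; rewrite ?lerDl ?normr_ge0.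
by apply: lerD; apply: ler_pM => //; rewrite ?lerDr ?normr_ge0.
Qed.

(** The translates by points close to [c] all cover a common neighbourhood of [c]. It contains a
    point where the count is [k], so the mass of a small box around [c] is at most [k]. *)
Lemma tiling_box M : multi_tiles_with P M ->
  forall K, exists C : nat, forall x, (tile_count M (box K) x <= C%:R%:E)%E.
Proof.
move=> [k k0 Hk].
have [r r0 rP] : exists2 r, 0 < r & forall i t, 0 < t -> t < r -> t <= h i / 2.
  apply: uniform_eps => i; exists (h i / 2) => [|t _ /ltW//].
  by rewrite divr_gt0 // halfwidth_gt0.
have [q q0 qP] : exists2 q, 0 < q & forall i t, 0 < t -> t < q ->
    forall v, box t v -> `|d i v| <= h i / 2.
  apply: uniform_eps => i; pose K := `|(e i).1| + `|(e i).2| + 1.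
  have K0 : 0 < K by rewrite ltr_wpDl // addr_ge0.
  exists (h i / 2 / K); first by apply: divr_gt0 => //; apply: divr_gt0 => //; apply: halfwidth_gt0.
  move=> t t0; rewrite ltr_pdivlMr // => tK v /(det2_box (e i)) Hv.
  apply: le_trans Hv _; apply: le_trans (ltW tK).
  by rewrite mulrC ler_pM2l // /K lerDl.
have q2 : 0 < q / 2 by rewrite divr_gt0.
have qq : q / 2 < q by lra.
have r2 : 0 < r / 2 by rewrite divr_gt0.
have rr : r / 2 < r by lra.
apply: (@tile_count_box _ _ (q / 2) k) => //.
move=> c; have [w Hw <-] := ae_sector c (leq0n m) r2 Hk.
apply: le_tile_count => l Ml Hl; apply/zonotopeP => // i; rewrite addrAC det2Dr.
apply: le_trans (ler_normD _ _) _.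
have := qP i _ q2 qq _ Hl; have := rP i _ r2 rr.
have := in_sector_abs i Hw; lra.
Qed.

Lemma finite_nearby M : 
  (forall K, exists C : nat, forall x, (tile_count M (box K) x <= C%:R%:E)%E) ->
  forall x, finite_set (nearby e M x).
Proof.
move=> H x; have [C HC] := box_of_widths (fun i => h i + 1).
have [N /(_ x)/tile_count_finite] := H C.
by apply: sub_finite_set => l [Ml Hl]; split=> //; apply: HC.
Qed.

(** For the half-open copies the equality almost everywhere becomes an equality at every point,
    since their count at [x] is the count of [P] at all nearby points of a sector. *)
Lemma tiling_window M : multi_tiles_with P M ->
  exists2 k : nat, (0 < k)%N & forall n x, (n <= m)%N -> tile_count M (window e n) x = k%:R%:E.
Proof.
move=> HM; have fin := finite_nearby (tiling_box HM).
have [k k0 Hk] := HM; exists k => // n x nm.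
have [r r0 rP] := in_sector_count n (fin x).
by have [w /rP[<- _] Hw] := ae_sector x nm r0 Hk; exact: Hw.
Qed.

Lemma tile_count_edge M x j :
  (forall K, exists C : nat, forall x, (tile_count M (box K) x <= C%:R%:E)%E) ->
  tile_count M (edge e j) x \is a fin_num.
Proof.
move=> H; have [N /(_ x) HN] := H (`|(e j).1| + `|(e j).2|).

rewrite ge0_fin_numE; last by apply: esum_ge0 => l _; apply: weight_ge0.
apply: le_lt_trans (ltry N%:R); apply: le_trans HN.
apply: le_tile_count => l _ [t ht ->].
have t1 : `|t| <= 1 by rewrite ler_norml; lra.
split; rewrite /= normrM; apply: le_trans (ler_wpM2r (normr_ge0 _) t1) _.
  by rewrite mul1r lerDl normr_ge0.
by rewrite mul1r lerDr normr_ge0.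
Qed.

Lemma tile_count_step M x j :
  (tile_count M (window e j.+1) x + tile_count M (edge e j) (x - scale2 (1 / 2) (tau e j))%R =
   tile_count M (window e j) x + tile_count M (edge e j) (x + scale2 (1 / 2) (tau e j))%R)%E.
Proof.
rewrite /tile_count -!esumD; try by move=> *; apply: weight_ge0.
apply: eq_esum => l _; rewrite -!EFinD -!mulrDr; congr (_ * _)%:E.
by rewrite ![x + _ - l]addrAC; apply: window_step.
Qed.

Lemma tiling_edge_periodic M : multi_tiles_with P M ->
  forall j x, tile_count M (edge e j) (x + tau e j) = tile_count M (edge e j) x.
Proof.
move=> HM j x; have [k _ Hk] := tiling_window HM.
have := tile_count_step M (x + scale2 (1 / 2) (tau e j)) j.
rewrite addrK !Hk ?ltn_ord 1?ltnW ?ltn_ord //.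
move=> /(congr1 (fun a => a - k%:R%:E)%E); rewrite ![(k%:R%:E + _)%E]addeC !addeK // => ->.
by rewrite -addrA -scale2D -splitr scale2_1.
Qed.

End Tiling.

(** * Averaging the multiplicity function *)

Section EdgeSystem.
Variables (R : realType) (m : nat) (e : 'I_m -> R * R).
Implicit Types (M : R * R -> nat) (x y z w l : R * R) (i j : 'I_m).

Local Notation d i z := (det2 (e i) z).
Local Notation P := (zonotope e).

(* [W j x] stands for the mass of [f] on the half-open segment of direction
   [e j] centred at [x]; [W j] is needed only up to averaging. *)
Record edge_system (f : R * R -> R) (W : 'I_m -> R * R -> R) : Prop := EdgeSystem {
  es_neq0 : exists x, 0 < f x;
  es_ge0 : forall x, 0 <= f x;
  es_bound : forall K, exists C, forall a (s : seq (R * R)), uniq s ->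
    {in s, forall y, box K (y - a)} -> \sum_(y <- s) f y <= C;
  es_le : forall j x, f x <= W j x;
  es_tau : forall j x, W j (x + tau e j) = W j x;
  es_line : forall K, exists C, forall j a (s : seq (R * R)), uniq [seq d j y | y <- s] ->
    {in s, forall y, box K (y - a)} -> \sum_(y <- s) W j y <= C;
  es_diff : forall j x,
    f (x + tau e j + e j) - f (x + tau e j) = f (x + e j) - f x }.

Hypothesis e_pos : forall i j : 'I_m, (i < j)%N -> 0 < det2 (e i) (e j).
Hypothesis m2 : (2 <= m)%N.

Definition short_edge j (t : R) : set (R * R) :=
  [set z | exists2 s, 0 <= s < t & z = scale2 s (e j)].

(** Only finitely many points of the support are near [x], so a short enough segment reaches none of
    them but [x] itself. *)
Lemma tile_count_short M x j : finite_set (nearby e M x) ->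
  exists2 r, 0 < r & forall t, 0 < t -> t < r ->
    tile_count M (short_edge j t) x = (M x)%:R%:E.
Proof.
move=> fin.
have [r r0 rP] : exists2 r, 0 < r & forall l, nearby e M x l ->
    forall t, 0 < t -> t < r -> short_edge j t (x - l) -> x = l.
  apply: uniform_eps_set => // l _.
  have [[s s0 xl]|] := pselect (exists2 s, 0 < s & x - l = scale2 s (e j)).
    exists s => // t t0 ts [s' /andP[_ s'1]]; rewrite xl.
    by move/(scale2_inj (e_neq0 e_pos m2 j)) => ss'; move: s'1; rewrite -ss' ltNge ltW.
  move=> H; exists 1 => // t t0 t1 [s /andP[+ _] E].
  rewrite le_eqVlt => /predU1P[s0|s0]; last by case: H; exists s.
  by apply/eqP; rewrite -subr_eq0 E -s0 scale2_0.
exists (Num.min r (1 / 2)); first by rewrite lt_min r0 /=; lra.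
move=> t t0; rewrite lt_min => /andP[tr t2].
have Hl l : (0 < M l)%N -> short_edge j t (x - l) -> x = l.
  move=> Ml sl; apply: (rP l _ t) => //; split => // i; case: sl => s /andP[s0 st] ->.
  rewrite det2Zr normrM (ger0_norm s0).
  have : `|d i (e j)| <= halfwidth e i *+ 2.
    by rewrite halfwidthD (bigD1 j) //= lerDl; apply: sumr_ge0.
  have s1 : s <= 1 / 2 by lra.
  have := ler_wpM2r (normr_ge0 (d i (e j))) s1.
  by have := normr_ge0 (d i (e j)); rewrite -mulr_natr; lra.
have s0 : short_edge j t (x - x).
  by exists 0; rewrite ?lexx ?t0 // subrr scale2_0.
have [M0|M0] := posnP (M x).
  rewrite M0; apply: esum1 => l Ml; rewrite indicE memNset ?mulr0 //.
  by move=> /(Hl l Ml) xl; move: Ml; rewrite /msupport /= -xl M0.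
rewrite /tile_count (esumID [set x]); last by move=> *; apply: weight_ge0.
rewrite (_ : msupport M `&` [set x] = [set x]); last first.
  by apply/seteqP; split=> [y []//|y /= ->]; split.
rewrite esum_set1 ?weight_ge0 // indicE mem_set // mulr1.
rewrite esum1 ?adde0 // => l [Ml xl]; rewrite indicE memNset ?mulr0 //.
by move=> /(Hl l Ml) /esym.
Qed.

(** In the coordinate along [e j], both sides are the indicator of [[-1/2, 1/2 + t)]. *)
Lemma edge_short j (t : R) z : 0 < t -> t < 1 ->
  \1_(edge e j) z + \1_(short_edge j t) (z - scale2 (1 / 2) (e j)) =
  \1_(edge e j) (z - scale2 t (e j)) + \1_(short_edge j t) (z + scale2 (1 / 2) (e j)) :> R.
Proof.
move=> t0 t1; have [[s ->]|H] := pselect (exists s, z = scale2 s (e j)); last first.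
  have N a (A : set (R * R)) b : A `<=` [set y | exists s, y = scale2 s (e j)] ->
      b = z + scale2 a (e j) -> \1_A b = 0 :> R.
    move=> A1 ->; rewrite indicE memNset // => /A1[s E]; apply: H; exists (s - a).
    by rewrite scale2D -E scale2N addrK.
  have E1 : edge e j `<=` [set y | exists s, y = scale2 s (e j)].
    by move=> y [s _ ->]; exists s.
  have E2 : short_edge j t `<=` [set y | exists s, y = scale2 s (e j)].
    by move=> y [s _ ->]; exists s.
  rewrite (N 0 _ _ E1) ?scale2_0 ?addr0 // (N (- (1 / 2)) _ _ E2) ?scale2N //.
  by rewrite (N (- t) _ _ E1) ?scale2N // (N (1 / 2) _ _ E2).
rewrite -!scale2N -!scale2D !indicE.
have Ee s' : (scale2 s' (e j) \in edge e j) = (- (1 / 2) <= s' < 1 / 2).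
  apply/idP/idP => [/set_mem[s'' ?]|?]; last by apply/mem_set; exists s'.
  by move/(scale2_inj (e_neq0 e_pos m2 j)) => ->.
have Es s' : (scale2 s' (e j) \in short_edge j t) = (0 <= s' < t).
  apply/idP/idP => [/set_mem[s'' ?]|?]; last by apply/mem_set; exists s'.
  by move/(scale2_inj (e_neq0 e_pos m2 j)) => ->.
rewrite !Ee !Es.
have [s1|s1] := ltP s (- (1 / 2)).
  by do !(case: (boolP (_ && _)) => ? //=); lra.
have [s2|s2] := ltP s (1 / 2).
  by do !(case: (boolP (_ && _)) => ? //=); lra.
by do !(case: (boolP (_ && _)) => ? //=); lra.
Qed.

Lemma tiling_edge_system M : multi_tiles_with P M ->
  edge_system (fun x => (M x)%:R) (fun j x => fine (tile_count M (edge e j) x)).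
Proof.
move=> HM; have HB := tiling_box e_pos m2 HM.
have fin x := finite_nearby e_pos m2 HB x.
have finW j x := @tile_count_edge _ _ e M x j HB.
have WE j x : tile_count M (edge e j) x = (fine (tile_count M (edge e j) x))%:E.
  by rewrite fineK.
split.
- have [k k0 /(_ 0%N 0 isT) Hk] := tiling_window e_pos m2 HM.
  apply: contrapT => /forallNP M0; move: Hk; rewrite /tile_count esum1.
    by move=> /eqP; rewrite eq_sym eqe pnatr_eq0 eqn0Ngt k0.
  by move=> l Ml; have := M0 l; rewrite ltr0n.
- by [].
- move=> K; have [C HC] := HB K; exists C%:R => a s us sB; rewrite -lee_fin.
  apply: le_trans (HC a); apply: tile_count_ge_sum => // l /sB[H1 H2].
  by split; rewrite /= distrC.
- move=> j x; rewrite -lee_fin -WE.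
  have := @tile_count_ge_sum _ M (edge e j) x [:: x] isT.
  rewrite big_seq1; apply=> l; rewrite inE => /eqP ->; rewrite subrr.
  by exists 0; rewrite ?scale2_0 //; lra.
- by move=> j x; rewrite tiling_edge_periodic.
- move=> K.
  pose L := \sum_j (`|(e j).1| + `|(e j).2|).
  have [C HC] := HB (K + L); exists C%:R => j a s us sB.
  rewrite -lee_fin -sumEFin; under eq_bigr do rewrite -WE.
  rewrite -esum_sum; last by move=> *; apply: weight_ge0.
  apply: le_trans (HC a); apply: le_esum => l Ml.
  rewrite sumEFin lee_fin -mulr_sumr ler_wpM2l //.
  have [[y ys yl]|H] := pselect (exists2 y, y \in s & edge e j (y - l)); last first.
    rewrite big_seq big1 // => y ys; rewrite indicE memNset // => yl.
    by apply: H; exists y.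
  rewrite [leRHS]indicE mem_set; last first.
    have [y1 y2] := sB _ ys; case: yl => t ht yl.
    have t1 : `|t| <= 1 by rewrite ler_norml; lra.
    have Le : `|(e j).1| + `|(e j).2| <= L.
      by rewrite /L (bigD1 j) //= lerDl; apply: sumr_ge0 => k _; apply: addr_ge0.
    have lE : a - l = - (y - a) + scale2 t (e j) by rewrite -yl; apply: pairP => /=; ring.
    rewrite lE; split; rewrite /=; apply: le_trans (ler_normD _ _) _; rewrite normrN normrM;
      apply: lerD => //; apply: le_trans (ler_wpM2r (normr_ge0 _) t1) _; rewrite mul1r;
      apply: le_trans Le.
      by rewrite lerDl normr_ge0.
    by rewrite lerDr normr_ge0.
  under eq_bigr do rewrite indicE.
  rewrite -natr_sum ler_nat.
  (* A segment of direction [e j] through [l] lies on the line of [l], and the points of [s] lie on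
     distinct lines of that direction, so [l] is counted at most once. *)
  apply: (@leq_trans (count_mem (d j l) [seq d j y | y <- s])); last first.
    by rewrite count_uniq_mem // leq_b1.
  rewrite count_map -sum1_count [X in (_ <= X)%N]big_mkcond /=; apply: leq_sum => z _.
  case: (boolP (_ \in edge e j)) => // /set_mem[t _ zl].
  have -> : z = l + scale2 t (e j) by rewrite -zl addrC subrK.
  by rewrite det2Dr det2Zr det2xx mulr0 addr0 eqxx.
move=> j x.
(* The segment centred at [x0] has ends [x] and [x + e j], so the jump of [W j] at [x0] is
   [M (x + e j) - M x]. By periodicity of [W j] the jump at [x0 + tau e j] is the same. *)
pose x0 := x + scale2 (1 / 2) (e j).
have jump y : exists2 r, 0 < r & forall t, 0 < t -> t < r ->
    fine (tile_count M (edge e j) y) + (M (y - scale2 (1 / 2) (e j)))%:R =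
    fine (tile_count M (edge e j) (y - scale2 t (e j))) +
      (M (y + scale2 (1 / 2) (e j)))%:R.
  have [r1 r10 H1] := tile_count_short j (fin (y - scale2 (1 / 2) (e j))).
  have [r2 r20 H2] := tile_count_short j (fin (y + scale2 (1 / 2) (e j))).
  exists (Num.min 1 (Num.min r1 r2)); first by rewrite !lt_min ltr01 r10.
  move=> t t0; rewrite !lt_min => /and3P[t1 tr1 tr2].
  apply: EFin_inj; rewrite !EFinD -!WE -(H1 t) // -(H2 t) //.
  rewrite /tile_count -!esumD; try by move=> *; apply: weight_ge0.
  apply: eq_esum => l _; rewrite -!EFinD -!mulrDr; congr (_ * _)%:E.
  by rewrite ![y + _ - l]addrAC edge_short.
have [r1 r10 H1] := jump x0; have [r2 r20 H2] := jump (x0 + tau e j).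
pose t := Num.min r1 r2 / 2.
have t0 : 0 < t by rewrite divr_gt0 // lt_min r10.
have tm : t < Num.min r1 r2 by rewrite /t ltr_pdivrMr // ltr_pMr ?lt_min ?r10 // ltr1n.
move: (tm); rewrite lt_min => /andP[t1 t2].
have {H1} := H1 _ t0 t1; have {H2} := H2 _ t0 t2.
rewrite [x0 + _ - scale2 t _]addrAC !tiling_edge_periodic //.
have -> : x0 - scale2 (1 / 2) (e j) = x by rewrite /x0 addrK.
have -> : x0 + scale2 (1 / 2) (e j) = x + e j.
  by rewrite /x0 -addrA -scale2D -splitr scale2_1.
have -> : x0 + tau e j - scale2 (1 / 2) (e j) = x + tau e j.
  by rewrite addrAC /x0 addrK.
have -> : x0 + tau e j + scale2 (1 / 2) (e j) = x + tau e j + e j.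
  by rewrite addrAC /x0 -[x + _ + scale2 _ _]addrA -scale2D -splitr scale2_1 addrAC.
lra.
Qed.

End EdgeSystem.

(** * Banach limits *)

Definition seq_bounded (R : realType) (u : nat -> R) : Prop := exists C, forall n, `|u n| <= C.

(** The limit along an ultrafilter finer than the neighbourhoods of infinity, which exists for
    bounded sequences by compactness of segments. *)
Lemma ultra_limit (R : realType) : exists L : (nat -> R) -> R,
  [/\ forall u v, seq_bounded u -> seq_bounded v -> L (fun n => u n + v n) = L u + L v,
      forall u v, seq_bounded u -> seq_bounded v -> (forall n, u n <= v n) -> L u <= L v,
      forall c, L (fun=> c) = c &
      forall u, u @ \oo --> 0 -> L u = 0].
Proof.
have [U [UU oU]] := @ultraFilterLemma nat \oo _.
have UF : ProperFilter U by case: UU.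
have cv (u : nat -> R) : seq_bounded u -> u @ U --> lim (u @ U).
  move=> [C HC].
  have : compact `[- C, C]%classic by exact: segment_compact.
  move=> /(_ (u @ U) _)[].
    by apply: nearW => n; rewrite /= in_itv /= -ler_norml.
  move=> l [_ ul]; apply/cvg_ex; exists l => A lA.
  have [//|nA] := in_ultra_setVsetC (u @^-1` A) UU.
  by have [y []] := ul (~` A) A nA lA.
exists (fun u => lim (u @ U)); split.
- by move=> u v /cv cu /cv cv'; apply: cvg_lim => //; apply: cvgD.
- move=> u v /cv cu /cv cv' uv; apply: ler_lim.
  + by apply/cvg_ex; eexists; exact: cu.
  + by apply/cvg_ex; eexists; exact: cv'.
  + exact: nearW.
- by move=> c; apply: cvg_lim => //; apply: cvg_cst.
move=> u u0; apply: cvg_lim => //; apply: cvg_trans u0.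
by move=> A; apply: oU.
Qed.

(** Passing to Cesaro means before the ultrafilter limit makes it shift-invariant: the means of a
    sequence and of its shift differ by [O(1/n)]. *)
Lemma banach_limit (R : realType) : exists L : (nat -> R) -> R,
  [/\ forall u v, seq_bounded u -> seq_bounded v -> L (fun n => u n + v n) = L u + L v,
      forall u v, seq_bounded u -> seq_bounded v -> (forall n, u n <= v n) -> L u <= L v,
      forall c, L (fun=> c) = c &
      forall u, seq_bounded u -> L (fun n => u n.+1) = L u].
Proof.
have [L [LD Lle Lc L0]] := ultra_limit R.
pose mean (u : nat -> R) n := (\sum_(i < n.+1) u i) / n.+1%:R.
have bm u : seq_bounded u -> seq_bounded (mean u).
  move=> [C HC]; exists C => n; rewrite /mean normrM normfV normr_nat.
  rewrite ler_pdivrMr ?ltr0n //; apply: le_trans (ler_norm_sum _ _ _) _.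
  apply: (@le_trans _ _ (\sum_(i < n.+1) C)); first by apply: ler_sum => i _; exact: HC.
  by rewrite sumr_const card_ord mulr_natr.
exists (fun u => L (mean u)); split.
- move=> u v bu bv; rewrite -(LD _ _ (bm _ bu) (bm _ bv)); congr L; apply: funext => n.
  by rewrite /mean big_split mulrDl.
- move=> u v bu bv uv; apply: (Lle _ _ (bm _ bu) (bm _ bv)) => n.
  by rewrite ler_pM2r ?invr_gt0 ?ltr0n //; apply: ler_sum.
- move=> c; rewrite -[RHS]Lc; congr L; apply: funext => n.
  by rewrite /mean sumr_const card_ord -[c *+ _]mulr_natr mulfK ?pnatr_eq0.
move=> u bu; have [C HC] := bu.
have bS : seq_bounded (fun n => u n.+1) by exists C.
pose v n := (u n.+1 - u 0%N) / n.+1%:R.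
have vE n : mean (fun n => u n.+1) n = mean u n + v n.
  rewrite /mean /v -mulrDl; congr (_ / _).
  by rewrite big_ord_recr /= [in RHS]big_ord_recl /= [RHS]addrAC addrCA subrr addr0 addrC.
have bv : forall n, `|v n| <= (C + C) * n.+1%:R^-1.
  move=> n; rewrite normrM normfV normr_nat ler_wpM2r ?invr_ge0 //.
  by apply: le_trans (ler_normB _ _) _; apply: lerD.
have v0 : v @ \oo --> 0.
  apply/norm_cvg0P.
  apply: (@squeeze_cvgr _ _ _ _ (fun=> 0) (fun n => (C + C) * n.+1%:R^-1)).
  - by apply: nearW => n; rewrite normr_ge0 bv.
  - exact: cvg_cst.
  rewrite -[X in _ --> X](mulr0 (C + C)); apply: cvgMl_tmp; exact: cvg_harmonic.
have bv' : seq_bounded v.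
  exists (C + C) => n; apply: le_trans (bv n) _.
  have C0 : 0 <= C + C by apply: addr_ge0; apply: le_trans (HC 0%N).
  by rewrite ler_piMr // invf_le1 ?ltr0n // ler1n.
rewrite -[RHS]addr0 -(L0 v v0) -(LD _ _ (bm _ bu) bv'); congr L; exact: funext.
Qed.

(** * Averages of edge systems *)

Section Averaging.
Variables (R : realType) (m : nat) (e : 'I_m -> R * R) (L : (nat -> R) -> R).
Hypothesis LD : forall u v, seq_bounded u -> seq_bounded v ->
  L (fun n => u n + v n) = L u + L v.
Hypothesis Lle : forall u v, seq_bounded u -> seq_bounded v ->
  (forall n, u n <= v n) -> L u <= L v.
Hypothesis Lcst : forall c, L (fun=> c) = c.
Hypothesis LS : forall u, seq_bounded u -> L (fun n => u n.+1) = L u.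
Implicit Types (x y z a c : R * R) (i j : 'I_m) (f g : R * R -> R).

Definition average f a x : R := L (fun n => f (x + a *+ n)).

Definition bounded_fun_on_plane f := exists C : R, forall x, `|f x| <= C.

Lemma seq_bounded_orbit f a x : bounded_fun_on_plane f ->
  seq_bounded (fun n => f (x + a *+ n)).
Proof. by move=> [C HC]; exists C. Qed.

Lemma seq_bounded_sum f a (s : seq (R * R)) : bounded_fun_on_plane f ->
  seq_bounded (fun n => \sum_(y <- s) f (y + a *+ n)).
Proof.
move=> [C HC]; exists (\sum_(y <- s) C) => n.
by apply: le_trans (ler_norm_sum _ _ _) _; apply: ler_sum.
Qed.

Lemma sum_average f a (s : seq (R * R)) : bounded_fun_on_plane f ->
  \sum_(y <- s) average f a y = L (fun n => \sum_(y <- s) f (y + a *+ n)).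
Proof.
move=> bf; elim: s => [|y s IH].
  by rewrite big_nil -[LHS](Lcst 0); congr L; apply: funext => n; rewrite big_nil.
rewrite big_cons IH -(LD (seq_bounded_orbit _ _ bf) (seq_bounded_sum _ _ bf)).
by congr L; apply: funext => n; rewrite big_cons.
Qed.

Lemma seq_bounded_cst (r : R) : seq_bounded (fun=> r).
Proof. by exists `|r|. Qed.

Lemma average_periodic f a x : bounded_fun_on_plane f ->
  average f a (x + a) = average f a x.
Proof.
move=> bf; rewrite /average -(LS (@seq_bounded_orbit f a x bf)); congr L.
by apply: funext => n; rewrite mulrS addrA.
Qed.

Lemma average_periodicW f a p : (forall x, f (x + p) = f x) ->
  forall x, average f a (x + p) = average f a x.
Proof. by move=> fp x; congr L; apply: funext => n; rewrite addrAC fp. Qed.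

(** A bound uniform over translates passes to the average. [S] stands for the families to which the
    bound applies; it serves both local sums and sums across parallel lines. *)
Lemma average_sum_le f a C (S : (seq (R * R)) -> Prop) (s : seq (R * R)) :
  bounded_fun_on_plane f ->
  (forall b, S [seq y + b | y <- s]) -> (forall s, S s -> \sum_(y <- s) f y <= C) ->
  \sum_(y <- s) average f a y <= C.
Proof.
move=> bf Ss HS; rewrite sum_average // -[leRHS]Lcst.
apply: Lle; [exact: seq_bounded_sum|exact: seq_bounded_cst|move=> n].
by have := HS _ (Ss (a *+ n)); rewrite big_map.
Qed.

Lemma edge_system_bounded f W : edge_system e f W ->
  bounded_fun_on_plane f /\ forall j, bounded_fun_on_plane (W j).
Proof.
move=> H; have H0 := es_ge0 H.
have B0 x : {in [:: x], forall y, box 0 (y - x)}.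
  by move=> y; rewrite inE => /eqP ->; rewrite subrr; split; rewrite normr0.
split=> [|j].
  have [C HC] := es_bound H 0; exists C => x; rewrite ger0_norm //.
  by have := HC x [:: x] isT (B0 x); rewrite big_seq1.
have [C HC] := es_line H 0; exists C => x.
rewrite ger0_norm ?(le_trans (H0 x)) ?(es_le H) //.
by have := HC j x [:: x] isT (B0 x); rewrite big_seq1.
Qed.

(** Each clause is a linear relation or an inequality uniform under translation, which the Banach
    limit preserves. Only positivity somewhere can be lost, whence the extra hypothesis. *)
Lemma edge_system_average f W a : edge_system e f W ->
  (exists x, average f a x != 0) ->
  edge_system e (average f a) (fun j => average (W j) a).
Proof.
move=> H [x0 Hx0]; have [bf bW] := edge_system_bounded H.
have orb g x := @seq_bounded_orbit g a x.
have ge0 x : 0 <= average f a x.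
  rewrite -[leLHS]Lcst; apply: Lle; [exact: seq_bounded_cst|exact: orb|].
  by move=> n; apply: es_ge0 H _.
split=> //.
- by exists x0; rewrite lt_neqAle eq_sym Hx0 ge0.
- move=> K; have [C HC] := es_bound H K; exists C => c s us sB.
  apply: (@average_sum_le f a C
    (fun s => uniq s /\ exists c, {in s, forall y, box K (y - c)})) => //.
    move=> b; split; first by rewrite map_inj_uniq //; exact: addIr.
    exists (c + b) => _ /mapP[y ys ->].
    have -> : y + b - (c + b) = y - c by rewrite [c + b]addrC addrKA.
    exact: sB.
  by move=> s' [us' [c' sB']]; exact: HC sB'.
- by move=> j x; apply: Lle; [exact: orb|exact: orb|move=> n; exact: es_le H _ _].
- by move=> j x; apply: average_periodicW => y; exact: es_tau H _ _.
- move=> K; have [C HC] := es_line H K; exists C => j c s us sB.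
  apply: (@average_sum_le (W j) a C (fun s => uniq [seq det2 (e j) y | y <- s] /\
    exists c, {in s, forall y, box K (y - c)})) => //.
    move=> b; split.
      rewrite -map_comp (eq_map (g := (fun t => t + det2 (e j) b) \o det2 (e j))).
        by rewrite map_comp map_inj_uniq //; exact: addIr.
      by move=> y; rewrite /= det2Dr.
    exists (c + b) => _ /mapP[y ys ->].
    have -> : y + b - (c + b) = y - c by rewrite [c + b]addrC addrKA.
    exact: sB.
  by move=> s' [us' [c' sB']]; exact: HC sB'.
move=> j x; suff E : average f a (x + tau e j + e j) + average f a x =
    average f a (x + e j) + average f a (x + tau e j) by lra.
rewrite /average -!LD; try exact: orb.
congr L; apply: funext => n; have := es_diff H j (x + a *+ n).
rewrite (_ : x + a *+ n + _ + _ = x + tau e j + e j + a *+ n); last first.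
  by rewrite -!addrA; congr (_ + _); rewrite addrC -!addrA.
by rewrite ![x + a *+ n + _]addrAC; lra.
Qed.

End Averaging.

Section Periods.
Variables (R : realType) (m : nat) (e : 'I_m -> R * R).

(* If the average along [e j] vanishes, then [x |-> f (x + tau j) - f x], which
   is [e j]-periodic and hence equal to its own average, vanishes as well. *)
Lemma edge_system_periods (f : R * R -> R) W : edge_system e f W ->
  exists g W', edge_system e g W' /\
    forall j, (forall x, g (x + e j) = g x) \/ (forall x, g (x + tau e j) = g x).
Proof.
move=> H0; have [L [LD Lle Lc LS]] := banach_limit R.
(* The directions are treated one after the other; periods already obtained survive later averaging
   by [average_periodicW]. *)
suff Hn n : (n <= m)%N -> exists g W', edge_system e g W' /\ forall j : 'I_m, (j < n)%N ->
    (forall x, g (x + e j) = g x) \/ (forall x, g (x + tau e j) = g x).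
  by have [g [W' [H Hp]]] := Hn m (leqnn m); exists g, W'; split=> // j; apply: Hp.
elim: n => [|n IH] nm; first by exists f, W.
have [g [W' [H Hp]]] := IH (ltnW nm); have [bg _] := edge_system_bounded H.
pose k := Ordinal nm.
have [nz|/forallNP z] := pselect (exists x, average L g (e k) x != 0).
  exists (average L g (e k)), (fun j => average L (W' j) (e k)).
  split; first exact: edge_system_average.
  move=> j; rewrite ltnS leq_eqVlt => /predU1P[jn|/Hp].
    have -> : j = k by exact: val_inj.
    by left=> x; apply: average_periodic.
  by case=> ?; [left|right]; apply: average_periodicW.
exists g, W'; split=> // j; rewrite ltnS leq_eqVlt => /predU1P[jn|/Hp//].
have -> : j = k by exact: val_inj.
right=> x; apply/eqP; rewrite -subr_eq0; apply/eqP.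
have z0 y : average L g (e k) y = 0 by apply/eqP/negPn/negP/z.
have D n' : g (x + tau e k + e k *+ n') = g (x + e k *+ n') + (g (x + tau e k) - g x).
  elim: n' => [|n' IHn]; first by rewrite !mulr0n !addr0; lra.
  have := es_diff H k (x + e k *+ n'); move: IHn; rewrite !mulrSr.
  move: (tau e k) => t IHn; rewrite !addrA [x + e k *+ n' + t]addrAC IHn; lra.
have := z0 (x + tau e k); rewrite /average.
have -> : (fun n' => g (x + tau e k + e k *+ n')) =
          (fun n' => g (x + e k *+ n') + (g (x + tau e k) - g x)) by exact: funext.
rewrite LD; [|exact: seq_bounded_orbit|exact: seq_bounded_cst].
by rewrite -/(average L g (e k) x) z0 add0r Lc.
Qed.

End Periods.

(** * Rational structure of a tiling *)

Section RationalSpan.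
Variable R : realType.
Implicit Types (u v x y z w p : R * R).

Definition Qspan u v : set (R * R) :=
  [set x | exists a b : rat, x = scale2 (ratr a) u + scale2 (ratr b) v].

Lemma Qspan0 u v : Qspan u v 0.
Proof. by exists 0, 0; rewrite !raddf0 !scale2_0 addr0. Qed.

Lemma QspanD u v x y : Qspan u v x -> Qspan u v y -> Qspan u v (x + y).
Proof.
move=> [a [b ->]] [c [d ->]]; exists (a + c), (b + d).
by rewrite !rmorphD !scale2D addrACA.
Qed.

Lemma QspanZ u v x (a : rat) : Qspan u v x -> Qspan u v (scale2 (ratr a) x).
Proof.
move=> [b [c ->]]; exists (a * b), (a * c).
by rewrite !rmorphM scale2Dr !scale2A.
Qed.

Lemma QspanN u v x : Qspan u v x -> Qspan u v (- x).
Proof. by move=> /(QspanZ (- 1)); rewrite rmorphN1 scale2N scale2_1. Qed.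

Lemma QspanB u v x y : Qspan u v x -> Qspan u v y -> Qspan u v (x - y).
Proof. by move=> xV /QspanN; exact: QspanD. Qed.

Lemma Qspan_l u v : Qspan u v u.
Proof. by exists 1, 0; rewrite rmorph1 raddf0 scale2_0 scale2_1 addr0. Qed.

Lemma Qspan_r u v : Qspan u v v.
Proof. by exists 0, 1; rewrite rmorph1 raddf0 scale2_0 scale2_1 add0r. Qed.

Lemma Qspan_det u v x y : Qspan u v x -> Qspan u v y ->
  exists q : rat, det2 x y = ratr q * det2 u v.
Proof.
move=> [a [b ->]] [c [d ->]]; exists (a * d - b * c).
rewrite rmorphB !rmorphM !(det2Dl, det2Dr, det2Zl, det2Zr) !det2xx.
by rewrite (det2C v u); ring.
Qed.

(** Determinants of vectors of the span are rational multiples of [det2 u v], which cancels in the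
    quotient. *)
Lemma Qspan_rat u v x y z : Qspan u v x -> Qspan u v y -> Qspan u v z ->
  forall x' y', Qspan u v x' -> Qspan u v y' ->
  Qspan u v (scale2 (det2 x y / det2 x' y') z).
Proof.
move=> xV yV zV x' y' /Qspan_det H /H{H}[q' ->].
have [q ->] := Qspan_det xV yV.
have [->|D] := eqVneq (det2 u v) 0.
  by rewrite !mulr0 mul0r scale2_0; exact: Qspan0.
by rewrite -mulf_div divff // mulr1 -fmorph_div; exact: QspanZ.
Qed.

Lemma Qspan_basis u v x y z : Qspan u v x -> Qspan u v y -> det2 x y != 0 ->
  Qspan u v z -> Qspan x y z.
Proof.
move=> xV yV D zV.
have rat_quo a b : Qspan u v a -> Qspan u v b ->
    exists q : rat, det2 a b / det2 x y = ratr q.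
  move=> /Qspan_det H /H{H}[q ->]; have [q' E] := Qspan_det xV yV.
  exists (q / q'); have D0 : det2 u v != 0 by apply: contraNneq D => D0; rewrite E D0 mulr0.
  by rewrite E -mulf_div divff // mulr1 fmorph_div.
have [a Ha] := rat_quo _ _ zV yV; have [b Hb] := rat_quo _ _ xV zV.
by exists a, b; rewrite {1}(cramer z D) Ha Hb.
Qed.

Lemma Qspan_sub u v x y z : Qspan u v x -> Qspan u v y -> Qspan x y z -> Qspan u v z.
Proof. by move=> xV yV [a [b ->]]; apply: QspanD; apply: QspanZ. Qed.

Lemma periodZ (T : Type) (g : R * R -> T) p (k : int) x :
  (forall y, g (y + p) = g y) -> g (x + scale2 k%:~R p) = g x.
Proof.
move=> gp.
have gn n y : g (y + scale2 n%:R p) = g y.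
  elim: n y => [|n IH] y; first by rewrite scale2_0 addr0.
  by rewrite -natr1 scale2D scale2_1 addrA gp IH.
case: k => n; first exact: gn.
by rewrite NegzE rmorphN scale2N -[in RHS](subrK (scale2 n.+1%:R p) x) gn.
Qed.

Lemma pigeonhole (T : eqType) (F : nat -> T) (c C : R) : 0 < c ->
  (forall N, uniq [seq F n | n <- iota 0 N] -> N%:R * c <= C) ->
  exists n n', (n < n')%N /\ F n = F n'.
Proof.
move=> c0 H.
have [N HN] : exists N, ~~ uniq [seq F n | n <- iota 0 N].
  apply: contrapT => /forallNP nH.
  have := H (Num.trunc (C / c)).+1 (negbNE (introN idP (nH _))).
  rewrite leNgt -ltr_pdivrMr // => /negP H1; apply: H1.
  have [q0|q0] := leP 0 (C / c); first by have /andP[] := truncn_itv q0.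
  exact: lt_trans q0 (ltr0Sn _ _).
have [i [j [iN jN ij E]]] : exists i j, [/\ (i < N)%N, (j < N)%N, i != j & F i = F j].
  apply: contrapT => nE; move: HN; rewrite map_inj_in_uniq ?iota_uniq // => i j.
  rewrite !mem_iota !add0n => iN jN E; apply/eqP; apply: contrapT => /negP ij.
  by apply: nE; exists i, j.
by move: ij; rewrite neq_ltn => /orP[ij|ij]; [exists i, j|exists j, i].
Qed.

(** The representative of [x] modulo the integer span of [u] and [v] in their half-open
    parallelogram, provided [u] and [v] are independent. *)
Definition reduce u v x : R * R :=
  x - (scale2 (Num.floor (det2 x v / det2 u v))%:~R u +
       scale2 (Num.floor (det2 u x / det2 u v))%:~R v).

Lemma reduce_box u v : det2 u v != 0 ->
  exists K, forall x, box K (reduce u v x).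
Proof.
move=> D; exists (`|u.1| + `|v.1| + (`|u.2| + `|v.2|)) => x.
have E : reduce u v x =
    scale2 (det2 x v / det2 u v - (Num.floor (det2 x v / det2 u v))%:~R) u +
    scale2 (det2 u x / det2 u v - (Num.floor (det2 u x / det2 u v))%:~R) v.
  rewrite /reduce {1}(cramer x D) !scale2D !scale2N opprD.
  by rewrite addrACA.
have fr t : `|t - (Num.floor t)%:~R : R| <= 1.
  have /andP[t1 t2] := floor_itv t.
  by rewrite ler_norml; move: t2; rewrite rmorphD /=; lra.
rewrite E; move: (fr (det2 x v / det2 u v)) (fr (det2 u x / det2 u v)).
set s := _ - _; set t := _ - _ => s1 t1.
by split => /=; apply: le_trans (ler_normD _ _) _; rewrite (normrM s) (normrM t);
  have := ler_wpM2r (normr_ge0 u.1) s1; have := ler_wpM2r (normr_ge0 u.2) s1;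
  have := ler_wpM2r (normr_ge0 v.1) t1; have := ler_wpM2r (normr_ge0 v.2) t1;
  have := normr_ge0 u.1; have := normr_ge0 u.2; have := normr_ge0 v.1; have := normr_ge0 v.2; lra.
Qed.

Lemma natmul_scale2 n x : x *+ n = scale2 n%:R x.
Proof. by apply: pairP => /=; rewrite mulr_natl; elim: n => // n IH; rewrite !mulrS /= IH. Qed.

Lemma reduce_eq u v y (n n' : nat) : (n < n')%N -> det2 u v != 0 ->
  reduce u v (scale2 n%:R y) = reduce u v (scale2 n'%:R y) -> Qspan u v y.
Proof.
move=> nn' D; rewrite /reduce; set a := Num.floor _; set b := Num.floor _.
set a' := Num.floor _; set b' := Num.floor _ => E.
have {E} E : scale2 (n'%:R - n%:R) y = scale2 (a' - a)%:~R u + scale2 (b' - b)%:~R v.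
  rewrite !rmorphB /= !scale2D !scale2N; apply/eqP.
  move: E => /eqP; rewrite subr_eq => /eqP ->; apply/eqP.
  move: (scale2 _ y) (scale2 _ u) (scale2 _ v) (scale2 _ u) (scale2 _ v) => p q r s t.
  by apply: pairP => /=; ring.
pose k : rat := (n' - n)%N%:R.
have k0 : k != 0 by rewrite pnatr_eq0 subn_eq0 -ltnNge.
have kE : n'%:R - n%:R = ratr k :> R by rewrite /k ratr_nat natrB // ltnW.
have -> : y = scale2 (ratr k^-1) (scale2 (ratr k) y).
  by rewrite scale2A -rmorphM mulVf // rmorph1 scale2_1.
apply: QspanZ; rewrite -kE E; exists (a' - a)%:~R, (b' - b)%:~R.
by rewrite !ratr_int.
Qed.

End RationalSpan.

(** Each value of [F] costs at least [c] and the total budget is [C]. The [key] is the identity when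
    points are counted and [det2 (e i)] when lines parallel to [e i] are counted. *)
Lemma pigeonhole_sum (R : realType) (T U : eqType) (F : nat -> T) (key : T -> U)
    (f : T -> R) (c C : R) :
  0 < c -> (forall n, c <= f (F n)) ->
  (forall N, let s := [seq F n | n <- iota 0 N] in
     uniq [seq key y | y <- s] -> \sum_(y <- s) f y <= C) ->
  exists n n', (n < n')%N /\ key (F n) = key (F n').
Proof.
move=> c0 cf H; apply: (pigeonhole (F := key \o F) (C := C) c0) => N us.
apply: (le_trans _ (H N _)); last by rewrite -map_comp.
rewrite big_map -{2}(subn0 N) -/(index_iota 0 N) mulr_natl -{1}(subn0 N) -sumr_const_nat.
exact: ler_sum.
Qed.

(** * From periods to the rational span of a tiling *)

Section Structure.
Variables (R : realType) (m : nat) (e : 'I_m -> R * R).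
Hypothesis e_pos : forall i j : 'I_m, (i < j)%N -> 0 < det2 (e i) (e j).
Hypothesis m3 : (2 < m)%N.
Implicit Types (x y z w u v p : R * R) (i j : 'I_m).

Let m2 : (2 <= m)%N := ltnW m3.

(** With [V] the rational span, the existence of [w] says that [tau e j] lies in [V + R e_j]. All
    that the sequel uses of a tiling is contained in this condition, which arbitrary multi-sets and
    lattices satisfy for different reasons. *)
Definition Qtiling u v : Prop :=
  forall j, Qspan u v (tau e j) \/
    (Qspan u v (e j) /\ exists2 w, Qspan u v w & det2 (e j) (tau e j - w) = 0).

Lemma period_reduce (T : Type) (g : R * R -> T) u v x y :
  (forall x, g (x + u) = g x) -> (forall x, g (x + v) = g x) ->
  g (x + reduce u v y) = g (x + y).
Proof.
move=> gu gv; rewrite /reduce opprD !addrA -!scale2N -!rmorphN.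
by rewrite !periodZ.
Qed.

Lemma period_nat (T : Type) (g : R * R -> T) p (n : nat) x :
  (forall y, g (y + p) = g y) -> g (x + scale2 n%:R p) = g x.
Proof. exact: (@periodZ _ _ g p n x). Qed.

(** The points [x0 + n p], brought back into one parallelogram, all carry the mass [g x0 > 0]; the
    local bound makes two of them coincide. *)
Lemma period_Qspan (g : R * R -> R) W u v p : edge_system e g W -> det2 u v != 0 ->
  (forall x, g (x + u) = g x) -> (forall x, g (x + v) = g x) ->
  (forall x, g (x + p) = g x) -> Qspan u v p.
Proof.
move=> H D gu gv gp; have [x0 g0] := es_neq0 H.
have [K HK] := reduce_box D; have [C HC] := es_bound H K.
pose F n := x0 + reduce u v (scale2 n%:R p).
have [n [n' [nn' /addrI E]]] : exists n n', (n < n')%N /\ F n = F n'.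
  apply: (pigeonhole_sum (key := id) (f := g) (C := C) g0) => [n|N /=].
    by rewrite /F period_reduce // period_nat.
  rewrite map_id => us; apply: (HC x0 _ us) => _ /mapP[n _ ->].
  by rewrite /F addrAC subrr add0r.
exact: (reduce_eq nn' D E).
Qed.

(** Only [W i] is known to be periodic under [tau e i], so lines parallel to [e i] are counted
    instead of points. Two of them coincide, which determines [tau e i] rationally modulo [e i]
    only. *)
Lemma period_line (g : R * R -> R) W u i : edge_system e g W ->
  (forall x, g (x + e i) = g x) -> (forall x, g (x + u) = g x) -> det2 (e i) u != 0 ->
  exists a : rat, det2 (e i) (tau e i - scale2 (ratr a) u) = 0.
Proof.
move=> H ge gu D; have [x0 g0] := es_neq0 H.
have [K HK] := reduce_box D; have [C HC] := es_line H K.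
pose r n := reduce (e i) u (scale2 n%:R (tau e i)).
have [n [n' [nn' E]]] : exists n n', (n < n')%N /\
    det2 (e i) (x0 + r n) = det2 (e i) (x0 + r n').
  apply: (pigeonhole_sum (F := fun n => x0 + r n) (key := det2 (e i))
            (f := W i) (C := C) g0) => [n|N /=].
    (* The multiple of [tau e i] is removed by the period of [W i]; the multiples of [e i] and [u]
       are removed after passing from [W i] down to [g], for which they are periods. *)
    rewrite /r /reduce; set a := Num.floor _; set b := Num.floor _.
    rewrite [scale2 n%:R _ - _]addrC addrA period_nat; last exact: (es_tau H i).
    apply: (le_trans _ (es_le H i _)).
    by rewrite opprD addrA -!scale2N -!rmorphN !periodZ.
  move=> us; apply: (HC i x0 _ us) => _ /mapP[n _ ->].
  rewrite addrAC subrr add0r; exact: HK.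
pose k : rat := (n' - n)%N%:R.
have k0 : k != 0 by rewrite pnatr_eq0 subn_eq0 -ltnNge.
have kE : ratr k = n'%:R - n%:R :> R by rewrite /k ratr_nat natrB // ltnW.
move: E; rewrite (det2Dr _ x0 (r n)) (det2Dr _ x0 (r n')) => /addrI; rewrite /r /reduce.
set a := Num.floor _; set b := Num.floor _; set a' := Num.floor _; set b' := Num.floor _.
rewrite !det2Br !det2Dr !det2Zr det2xx !mulr0 !add0r => E.
have qE : ratr (k^-1 * (b' - b)%:~R) = (n'%:R - n%:R)^-1 * (b'%:~R - b%:~R) :> R.
  by rewrite rmorphM /= fmorphV /= ratr_int kE rmorphB.
exists (k^-1 * (b' - b)%:~R); rewrite det2Br det2Zr qE.
have K0 : n'%:R - n%:R != 0 :> R by rewrite -kE fmorph_eq0.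
apply: (mulfI K0); rewrite mulr0 mulrBr !mulrA mulfV // mul1r.
by rewrite !mulrBl; lra.
Qed.

Lemma tiling_Qtiling M : multi_tiles_with (zonotope e) M ->
  exists u v, det2 u v != 0 /\ Qtiling u v.
Proof.
move=> /(tiling_edge_system e_pos m2)/edge_system_periods[g [W [H Hp]]].
pose E j := `[< forall x, g (x + e j) = g x >].
have tauP j : ~~ E j -> forall x, g (x + tau e j) = g x.
  by move=> /asboolPn; have [] := Hp j.
have eP j : E j -> forall x, g (x + e j) = g x by move=> /asboolP.
pose i0 := Ordinal (ltnW (ltnW m3)); pose i1 := Ordinal (ltnW m3); pose i2 := Ordinal m3.
(* Among three edges two are of the same kind. Their periods are independent, because neither two of
   the [e] nor two of the [tau] are collinear. *)
have [i [j [ij Eij]]] : exists i j, i != j /\ E i = E j.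
  case h0: (E i0); case h1: (E i1); case h2: (E i2);
  by [exists i0, i1; rewrite h0 h1|exists i0, i2; rewrite h0 h2|exists i1, i2; rewrite h1 h2].
have [u [v [D gu gv]]] : exists u v, [/\ det2 u v != 0, forall x, g (x + u) = g x &
    forall x, g (x + v) = g x].
  case h: (E i); rewrite h in Eij.
    by exists (e i), (e j); split; [exact: e_noncol|exact: eP|exact: eP].
  exists (tau e i), (tau e j); split; [exact: tau_noncol|apply: tauP|apply: tauP].
    by rewrite h.
  by rewrite -Eij.
have V := fun p => period_Qspan (p := p) H D gu gv.
exists u, v; split=> // k; case h: (E k); last first.
  by left; apply: V; apply: tauP; rewrite h.
right; split; first by apply: V; apply: eP.
have [w [wV gw Dw]] : exists w, [/\ Qspan u v w, forall x, g (x + w) = g x & det2 (e k) w != 0].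
  have [z|z] := eqVneq (det2 (e k) u) 0.
    exists v; split=> //; first exact: Qspan_r.
    apply: contra_neq D => z'.
    have [t ut] := det2_eq0 (e_neq0 e_pos m2 k) z.
    have [t' vt] := det2_eq0 (e_neq0 e_pos m2 k) z'.
    by rewrite ut vt det2Zl det2Zr det2xx !mulr0.
  by exists u; split=> //; exact: Qspan_l.
have [a Ha] := period_line H (eP _ h) gw Dw.
by exists (scale2 (ratr a) w) => //; apply: QspanZ.
Qed.

(** Up to the translation by [- psum m / 2], the vertices along one half of the boundary of [P]. *)
Definition psum (n : nat) : R * R := \sum_(l < m | (l < n)%N) e l.

Lemma psum0 : psum 0 = 0.
Proof. by rewrite /psum big_pred0. Qed.

Lemma psumS i : psum i.+1 = psum i + e i.
Proof.
rewrite /psum (bigD1 i) //= addrC; congr (_ + _); apply: eq_bigl => l.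
by rewrite ltnS [(l <= i)%N]leq_eqVlt -val_eqE /=; case: (ltngtP l i).
Qed.

(** [tau e i] carries the midpoint of an edge to the opposite midpoint, and [psum i], [psum i.+1]
    are the ends of that edge up to translation by [- psum m / 2]. *)
Lemma tau_psum i : tau e i = psum m - psum i - psum i.+1.
Proof.
have -> : psum m = psum i + e i + \sum_(l < m | (i < l)%N) e l.
  rewrite {1}/psum (bigID (fun l : 'I_m => (l < i)%N)) /= -addrA; congr (_ + _).
    by apply: eq_bigl => l; rewrite ltn_ord.
  rewrite (bigD1 i) ?ltnn ?ltn_ord //=; congr (_ + _); apply: eq_bigl => l.
  by rewrite ltn_ord -val_eqE /=; case: (ltngtP l i).
rewrite psumS /tau -/(psum i).
by move: (\sum_(l < m | (i < l)%N) e l) (psum i) (e i) => a b c; apply: pairP => /=; ring.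
Qed.

(* By [tau_psum], modulo the span the partial sums [p] stay fixed at the [i] with
   [e i] in the span and are replaced by [E - p] at the others. *)
Lemma Qtiling_parity u v : det2 u v != 0 -> Qtiling u v ->
  (forall j, Qspan u v (tau e j)) \/
  (~~ odd m /\ exists j0, [/\ forall i, i != j0 -> Qspan u v (tau e i),
     Qspan u v (e j0) & exists2 w, Qspan u v w & det2 (e j0) (tau e j0 - w) = 0]).
Proof.
move=> D H; set V := Qspan u v.
pose p := psum; pose E := psum m.
pose T i := ~~ `[< V (e i) >].
pose t n := (\sum_(l < m | (l < n)%N) T l)%N.
have pS i : p i.+1 = p i + e i := psumS i.
have tS i : t i.+1 = (t i + T i)%N.
  rewrite /t (bigD1 i) //= addnC; congr (_ + _)%N; apply: eq_bigl => l.
  by rewrite ltnS [(l <= i)%N]leq_eqVlt -val_eqE /=; case: (ltngtP l i).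
have pm : p m = E by [].
have tauE i : tau e i = E - p i - p i.+1 := tau_psum i.
have key n : (n <= m)%N -> V (p n - (if odd (t n) then E else 0)).
  elim: n => [|n IH] nm.
    rewrite /p psum0 /t big_pred0 // subr0; exact: Qspan0.
  have {IH} := IH (ltnW nm); pose i := Ordinal nm.
  have := pS i; have := tS i; rewrite /= => -> pE; rewrite oddD.
  case Ti : (T i); last first.
    rewrite addbF pE => Vp; move/negbFE/asboolP: Ti => Ve.
    by rewrite addrAC; apply: QspanD.
  move/asboolPn: Ti => nVe; have [Vt|[]//] := H i.
  have -> : p n.+1 = E - p n - tau e i.
    by rewrite tauE /=; move: (p n) (p n.+1) (E) => a b c; apply: pairP => /=; ring.
  case: (odd (t n)) => /= Vp.
    have -> : E - p n - tau e i - 0 = - (p n - E) - tau e i by rewrite subr0 [- (p n - E)]opprB.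
    by apply: QspanB => //; apply: QspanN.
  have -> : E - p n - tau e i - E = - (p n - 0) - tau e i.
    by rewrite subr0; apply: pairP => /=; ring.
  by apply: QspanB => //; apply: QspanN.
have all_in : V E -> forall i, V (e i) /\ V (tau e i).
  move=> VE; have Vp n : (n <= m)%N -> V (p n).
    move=> /key Vp; rewrite -[p n](subrK (if odd (t n) then E else 0)).
    by apply: QspanD => //; case: ifP => // _; exact: Qspan0.
  move=> i; split.
    have -> : e i = p i.+1 - p i by rewrite pS addrC addKr.
    by apply: QspanB; apply: Vp => //; apply: ltnW.
  by rewrite tauE; apply: QspanB; [apply: QspanB => //|]; apply: Vp => //; apply: ltnW.
have [VE|nVE] := pselect (V E); first by left=> j; have [] := all_in VE j.
(* At [n = m] the invariant says that [E] is congruent to [E] or to [0], according to the parity of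
   the number of [e i] outside [V]. *)
have tm : odd (t m).
  by have := key m (leqnn m); rewrite pm; case: (odd (t m)) => //; rewrite subr0.
have tmE : (t m + #|[pred i | ~~ T i]| = m)%N.
  have -> : t m = (\sum_(l < m) T l)%N by apply: eq_bigl => l; rewrite ltn_ord.
  rewrite -sum1_card [X in (_ + X)%N]big_mkcond -big_split /= -[RHS]card_ord -sum1_card.
  by apply: eq_bigr => i _; rewrite inE; case: (T i).
(* Where [e i] lies in [V], twice a partial sum is [0] or [2 E] modulo [V], so [tau e i] is [E] or
   [- E]; [s] is this sign. *)
have tau_mod i : ~~ T i -> exists2 s : rat, s != 0 & V (tau e i - scale2 (ratr s) E).
  move=> /negPn/asboolP Ve; have := key i (ltnW (ltn_ord i)).
  have E2 : tau e i = E - (p i + p i) - e i.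
    by rewrite tauE pS; move: (E) (p i) (e i) => a b c; apply: pairP => /=; ring.
  case: (odd (t i)) => Vp; last first.
    exists 1; rewrite ?oner_eq0 // rmorph1 scale2_1.
    have -> : tau e i - E = - ((p i - 0) + (p i - 0)) - e i.
      by rewrite E2; move: (E) (p i) (e i) => a b c; apply: pairP => /=; ring.
    by apply: QspanB => //; apply: QspanN; apply: QspanD.
  exists (- 1); rewrite ?oppr_eq0 ?oner_eq0 //.
  rewrite rmorphN1 scale2N scale2_1 opprK.
  have -> : tau e i + E = - ((p i - E) + (p i - E)) - e i.
    by rewrite E2; move: (E) (p i) (e i) => a b c; apply: pairP => /=; ring.
  by apply: QspanB => //; apply: QspanN; apply: QspanD.
have line i : ~~ T i -> exists2 w, V w & det2 (e i) E = det2 (e i) w.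
  move=> nT; have [s s0 Vs] := tau_mod i nT.
  have R0 : ratr s != 0 :> R by rewrite fmorph_eq0.
  have [Vt|[_ [w Vw Dw]]] := H i.
    case: nVE; rewrite -[E]scale2_1 -(mulVf R0) -scale2A -fmorphV; apply: QspanZ.
    have -> : scale2 (ratr s) E = tau e i - (tau e i - scale2 (ratr s) E).
      by rewrite subKr.
    exact: QspanB.
  exists (scale2 (ratr s^-1) (w - (tau e i - scale2 (ratr s) E))).
    by apply: QspanZ; apply: QspanB.
  rewrite det2Zr fmorphV; apply: (mulfI R0); rewrite mulVKf // -det2Zr.
  by move: Dw; rewrite !det2Br; lra.
(* Two such indices would place [E] on two lines of different directions [e i], [e j] in [V], each
   through a point of [V]; by Cramer's rule with rational ratios their intersection is in [V]. So at
   most one [e i] lies in [V], and if one does then [m] is even. *)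
have uniqT i j : ~~ T i -> ~~ T j -> i = j.
  move=> Ti Tj; apply/eqP/negPn/negP => ij; apply: nVE.
  have [w Vw Ew] := line _ Ti; have [w' Vw' Ew'] := line _ Tj.
  have De := e_noncol e_pos ij.
  move/negPn/asboolP: (Ti) => Vi; move/negPn/asboolP: (Tj) => Vj.
  rewrite (cramer E De) Ew (det2C E) Ew' -det2C.
  by apply: QspanD; apply: Qspan_rat.
have TV i : T i -> V (tau e i).
  by move=> /asboolPn nV; have [|[]] := H i.
have [allT|] := pselect (forall i, T i); first by left=> j; exact: TV.
move=> /existsNP[j0 /negP Tj0]; right; split.
  rewrite -tmE oddD tm (_ : #|_| = 1%N) // -(card1 j0); apply: eq_card => i.
  by rewrite !inE; apply/idP/eqP => [Ti|->//]; exact: uniqT.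
exists j0; split.
- by move=> i ij; apply: TV; apply: contraNT ij => Ti; apply/eqP/uniqT.
- exact/asboolP/negPn.
have [Vt|[]//] := H j0.
by exists (tau e j0) => //; rewrite subrr det20r.
Qed.

End Structure.

(** * Lattices *)

Section Lattice.
Variable R : realType.
Implicit Types (u v x y z w : R * R) (L H : set (R * R)) (a b c k : int).

Definition zlat u v : set (R * R) :=
  [set x | exists a b : int, x = scale2 a%:~R u + scale2 b%:~R v].

Lemma intmul_scale2 x k : x *~ k = scale2 k%:~R x.
Proof.
case: k => n.
  by rewrite -pmulrn natmul_scale2.
by rewrite NegzE mulrNz -pmulrn natmul_scale2 rmorphN scale2N.
Qed.

Lemma zlatB u v x y : zlat u v x -> zlat u v y -> zlat u v (x - y).
Proof.
move=> [a [b ->]] [c [d ->]]; exists (a - c), (b - d).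
by rewrite !rmorphB !scale2D !scale2N opprD addrACA.
Qed.

Lemma zmod_closedP L : L 0 -> (forall x y, L x -> L y -> L (x - y)) -> zmod_closed [in L].
Proof.
move=> L0 LB; split; first by rewrite !inE.
by move=> x y; rewrite !inE; exact: LB.
Qed.

Lemma zlat0 u v : zlat u v 0.
Proof. by exists 0, 0; rewrite !scale2_0 addr0. Qed.

Definition zlat_map u v (p : int * int) : R * R :=
  scale2 p.1%:~R u + scale2 p.2%:~R v.

Lemma zlat_map_is_zmod_morphism u v : GRing.zmod_morphism (zlat_map u v).
Proof.
by move=> p q; rewrite /zlat_map !rmorphB !scale2D !scale2N opprD addrACA.
Qed.

HB.instance Definition _ u v :=
  GRing.isZmodMorphism.Build (int * int)%type (R * R)%type (zlat_map u v)
    (zlat_map_is_zmod_morphism u v).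

Lemma zlat_inj u v a b c d : det2 u v != 0 ->
  scale2 a%:~R u + scale2 b%:~R v = scale2 c%:~R u + scale2 d%:~R v ->
  a = c /\ b = d.
Proof.
move=> D E; split.
  have := congr1 (fun x => det2 x v) E; rewrite !det2Dl !det2Zl det2xx !mulr0 !addr0.
  by move/(mulIf D)/eqP; rewrite eqr_int => /eqP.
have := congr1 (det2 u) E; rewrite !det2Dr !det2Zr det2xx !mulr0 !add0r.
by move/(mulIf D)/eqP; rewrite eqr_int => /eqP.
Qed.

Lemma nbhs_box (V : set (R * R)) x : nbhs x V ->
  exists2 r, 0 < r & forall y, box r y -> V (x + y).
Proof.
move=> [[A B] /= [/nbhs_ballP[r r0 rA] /nbhs_ballP[s s0 sB]] AB].
exists (Num.min r s / 2); first by rewrite divr_gt0 // lt_min r0.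
have tm : Num.min r s / 2 < Num.min r s.
  by rewrite ltr_pdivrMr // ltr_pMr ?lt_min ?r0 // ltr1n.
move: tm; rewrite lt_min => /andP[tr ts] [y1 y2] [h1 h2].
apply: (AB (x.1 + y1, x.2 + y2)); split.
  by apply: rA; rewrite /ball /= opprD addrA subrr sub0r normrN; apply: le_lt_trans h1 tr.
by apply: sB; rewrite /ball /= opprD addrA subrr sub0r normrN; apply: le_lt_trans h2 ts.
Qed.

Lemma box_nbhs x (r : R) : 0 < r -> nbhs x [set y | `|y.1 - x.1| < r /\ `|y.2 - x.2| < r].
Proof.
move=> r0; exists (ball x.1 r, ball x.2 r); first by split; apply: nbhsx_ballx.
by move=> [y1 y2] [/=]; rewrite /ball /= => ? ?; split; rewrite distrC.
Qed.

Lemma lattice_zlat u v : det2 u v != 0 -> lattice (zlat u v).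
Proof.
move=> D; split.
- by apply: zmod_closedP; [exact: zlat0|exact: zlatB].
- move=> x Lx; rewrite /isolated; split; first exact/mem_set.
  (* within distance [r] of [x] both coordinates change by less than one *)
  pose K := `|u.1| + `|u.2| + (`|v.1| + `|v.2|) + 1.
  have K0 : 0 < K by rewrite ltr_wpDl ?addr_ge0 ?normr_ge0.
  pose r := `|det2 u v| / K.
  have r0 : 0 < r by rewrite divr_gt0 ?normr_gt0.
  exists [set y | `|y.1 - x.1| < r /\ `|y.2 - x.2| < r]; first exact: box_nbhs.
  apply/seteqP; split=> [y [[y1 y2] Ly]|y /= ->]; last by rewrite !subrr normr0.
  have [a [b E]] := zlatB Ly Lx.
  have small z : `|z.1| + `|z.2| <= K -> `|det2 z (y - x)| < `|det2 u v|.
    move=> zK; have -> : `|det2 u v| = K * r by rewrite /r mulrC divfK ?gt_eqF.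
    have [z0|z0] := eqVneq (`|z.1| + `|z.2|) 0.
      move/eqP: z0; rewrite paddr_eq0 ?normr_ge0 // !normr_eq0 => /andP[/eqP z1 /eqP z2].
      by rewrite /det2 z1 z2 !mul0r subrr normr0 mulr_gt0.
    have z1 : 0 < `|z.1| + `|z.2| by rewrite lt_neqAle eq_sym z0 addr_ge0 ?normr_ge0.
    apply: (@lt_le_trans _ _ ((`|z.1| + `|z.2|) * r)); last by rewrite ler_pM2r.
    pose q := Num.max `|y.1 - x.1| `|y.2 - x.2|.
    have : `|det2 z (y - x)| <= (`|z.1| + `|z.2|) * q.
      apply: le_trans (ler_normB _ _) _; rewrite !normrM mulrDl.
      by apply: lerD; rewrite ler_wpM2l ?normr_ge0 // le_max lexx ?orbT.
    move/le_lt_trans; apply; rewrite ltr_pM2l // /q gt_max y1; exact: y2.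
  have int0 k : `|k%:~R * det2 u v| < `|det2 u v| -> k = 0.
    rewrite normrM -[X in _ < X]mul1r ltr_pM2r ?normr_gt0 // -intr_norm.
    rewrite (_ : 1 = 1%:~R) // ltr_int => h; apply/eqP; rewrite -normr_eq0.
    by rewrite eq_le normr_ge0 andbT -ltzD1.
  have a0 : a = 0.
    apply: int0; have := small v; rewrite E det2Dr !det2Zr det2xx mulr0 addr0.
    rewrite (det2C v u) mulrN normrN; apply.
    by rewrite /K; have := normr_ge0 u.1; have := normr_ge0 u.2; lra.
  have b0 : b = 0.
    apply: int0; have := small u; rewrite E det2Dr !det2Zr det2xx mulr0 add0r.
    apply; by rewrite /K; have := normr_ge0 v.1; have := normr_ge0 v.2; lra.
  by apply/eqP; rewrite -subr_eq0 E a0 b0 !scale2_0 addr0.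
exists (zlat_map u v); split.
  by move=> [a b] [c d] /(zlat_inj D)[/= -> ->].
apply/seteqP; split=> [_ [[a b] _ <-]|x [a [b ->]]]; first by exists a, b.
by exists (a, b).
Qed.

(** The images of the unit vectors generate [L]. They are independent over the reals because, by
    Dirichlet's approximation argument, a rank two subgroup of a line has nonzero elements
    arbitrarily close to [0]. *)
Lemma lattice_basis L : lattice L -> exists u v, det2 u v != 0 /\ L = zlat u v.
Proof.
move=> [zL dL [f [injf rf]]]; pose u := f (1, 0); pose v := f (0, 1).
have fE a b : f (a, b) = scale2 a%:~R u + scale2 b%:~R v.
  rewrite /u /v -!intmul_scale2 -(raddfMz f a) -(raddfMz f b) -raddfD; congr (f _).
  have := raddfMz (@fst int int) a (1, 0); have := raddfMz (@snd int int) a (1, 0).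
  have := raddfMz (@fst int int) b (0, 1); have := raddfMz (@snd int int) b (0, 1).
  case: (_ *~ a) => a1 a2; case: (_ *~ b) => b1 b2 /= -> -> -> ->.
  by rewrite !mul0rz !intz; congr (_, _); rewrite ?addr0 ?add0r.
have LE : L = zlat u v.
  rewrite -rf; apply/seteqP; split=> [_ [[a b] _ <-]|x [a [b ->]]]; first by exists a, b.
  by exists (a, b).
exists u, v; split=> //; apply/eqP => D.
have u0 : u != 0.
  by apply/eqP => u0; have /injf : f (1, 0) = f 0 by rewrite raddf0; exact: u0.
have [t vE] := det2_eq0 u0 D.
have L0 : L 0 by rewrite LE; exact: zlat0.
have [_ [V V0 VL]] := dL _ L0.
have [r r0 rV] := nbhs_box V0.
pose K := `|u.1| + `|u.2|.
have K0 : 0 < K.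
  rewrite lt_neqAle addr_ge0 ?normr_ge0 // andbT eq_sym /K paddr_eq0 ?normr_ge0 //.
  by rewrite !normr_eq0; apply: contra u0 => /andP[/eqP u1 /eqP u2]; apply/eqP/pairP.
(* two multiples of [v] agree modulo [u] up to [1 / N] *)
pose N := (Num.trunc (K / r)).+1.
have NK : K / N%:R < r.
  rewrite ltr_pdivrMr ?ltr0n // mulrC -ltr_pdivrMr //.
  by have /andP[] := truncn_itv (ltW (divr_gt0 K0 r0)).
pose fr n := n%:R * t - (Num.floor (n%:R * t : R))%:~R.
have fr01 n : 0 <= fr n < 1.
  by have /andP[] := floor_itv (n%:R * t); rewrite rmorphD /= /fr; lra.
have [n [n' [nn' E]]] : exists n n', (n < n')%N /\
    Num.trunc (N%:R * fr n) = Num.trunc (N%:R * fr n').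
  apply: (@pigeonhole R _ (fun n => Num.trunc (N%:R * fr n)) 1 N%:R) => // M uM.
  have MN : {subset [seq Num.trunc (N%:R * fr n) | n <- iota 0 M] <= iota 0 N}.
    move=> _ /mapP[n _ ->]; rewrite mem_iota add0n.
    have /andP[f0 f1] := fr01 n; rewrite truncn_lt_nat ?mulr_ge0 ?ler0n //.
    by rewrite -[X in _ < X]mulr1 ltr_pM2l ?ltr0n.
  by have := uniq_leq_size uM MN; rewrite size_map !size_iota mulr1 ler_nat.
have close : `|fr n' - fr n| <= N%:R^-1.
  have N0 : 0 < N%:R :> R by rewrite ltr0n.
  have nn0 i : 0 <= N%:R * fr i by have /andP[f0 _] := fr01 i; rewrite mulr_ge0.
  have /andP[l1 l2] := truncn_itv (nn0 n); have /andP[l3 l4] := truncn_itv (nn0 n').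
  rewrite E in l1 l2; rewrite -natr1 in l2 l4.
  rewrite -(ler_pM2l N0) mulfV ?gt_eqF // -{1}(gtr0_norm N0) -normrM mulrBr ler_norml.
  by lra.
pose a := Num.floor (n%:R * t) - Num.floor (n'%:R * t).
have small : f (a, n'%:Z - n%:Z) = scale2 (fr n' - fr n) u.
  rewrite fE vE scale2A -scale2D; congr scale2.
  by rewrite !rmorphB /= /fr !mulrBl; ring.
have : (V `&` L) (f (a, n'%:Z - n%:Z)).
  split; last by rewrite -rf; exists (a, n'%:Z - n%:Z).
  rewrite -[f _]add0r; apply: rV; rewrite small.
  have KN : K * N%:R^-1 < r by [].
  by split; rewrite /= normrM; apply: le_trans (ltW KN); rewrite mulrC;
    apply: ler_pM; rewrite ?normr_ge0 // /K ?lerDl ?lerDr ?normr_ge0.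
rewrite VL /= => /eqP; rewrite -(raddf0 f) => /eqP/injf [_ /eqP].
by rewrite subr_eq0 => /eqP[] nE; rewrite nE ltnn in nn'.
Qed.

Lemma zmod_closed0 L : zmod_closed [in L] -> L 0.
Proof. by case=> + _; rewrite !inE. Qed.

Lemma zmod_closedB L x y : zmod_closed [in L] -> L x -> L y -> L (x - y).
Proof.
by case=> _ H Lx Ly; have := H x y; rewrite !inE; exact.
Qed.

Lemma zmod_closedZ L x k : zmod_closed [in L] -> L x -> L (scale2 k%:~R x).
Proof.
move=> zL Lx; have L0 := zmod_closed0 zL.
have LN y : L y -> L (- y) by rewrite -[- y]sub0r; exact: zmod_closedB.
have LD y z : L y -> L z -> L (y + z).
  by move=> Ly /LN Lz; rewrite -[z]opprK; exact: zmod_closedB.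
have Ln n : L (scale2 n%:R x).
  elim: n => [|n IH]; first by rewrite scale2_0.
  by rewrite -natr1 scale2D scale2_1; exact: LD.
case: k => n; first exact: Ln.
by rewrite NegzE rmorphN scale2N; apply/LN/Ln.
Qed.

(** Hermite normal form: one basis vector has the least positive [u]-coordinate occurring in [H],
    the other is the least positive multiple of [v] in [H]. Independence of [x] and [y] ensures that
    both minima exist. *)
Lemma sublattice_basis H u v x y : det2 u v != 0 -> zmod_closed [in H] ->
  H `<=` zlat u v -> H x -> H y -> det2 x y != 0 ->
  exists w z, det2 w z != 0 /\ H = zlat w z.
Proof.
move=> D zH HL Hx Hy Dxy.
have HB := fun p q => @zmod_closedB H p q zH.
have HZ := fun p k => @zmod_closedZ H p k zH.
pose A (n : nat) := `[< (0 < n)%N /\ exists b, H (scale2 n%:R u + scale2 b%:~R v) >].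
pose B (n : nat) := `[< (0 < n)%N /\ H (scale2 n%:R v) >].
have posA a b : a != 0 -> H (scale2 a%:~R u + scale2 b%:~R v) -> A `|a|%N.
  move=> a0 Hab; apply/asboolP; split; first by rewrite absz_gt0.
  case: (ltP a 0) => [an|ap].
    exists (- b); have := HZ _ (- 1) Hab.
    rewrite scale2Dr !scale2A -[_ * a%:~R]rmorphM -[_ * b%:~R]rmorphM !mulN1r.
    by rewrite -(ltz0_abs an).
  by exists b; rewrite -[(`|a|%N)%:R]/((`|a|%N : int)%:~R) gez0_abs.
have posB b : b != 0 -> H (scale2 b%:~R v) -> B `|b|%N.
  move=> b0 Hb; apply/asboolP; split; first by rewrite absz_gt0.
  rewrite -[(`|b|%N)%:R]/((`|b|%N : int)%:~R).
  case: (ltP b 0) => [bn|bp]; last by rewrite gez0_abs.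
  by rewrite ltz0_abs // -mulN1r rmorphM -scale2A; apply: (HZ _ (- 1)).
have [a [b xE]] := HL _ Hx; have [c [d yE]] := HL _ Hy.
have Dab : a * d - b * c != 0.
  apply: contra_neq Dxy => E.
  have -> : det2 x y = (a * d - b * c)%:~R * det2 u v.
    rewrite xE yE !(det2Dl, det2Dr, det2Zl, det2Zr) !det2xx (det2C v u).
    by rewrite rmorphB !rmorphM /=; ring.
  by rewrite E mul0r.
have exA : exists n, A n.
  have [a0|a0] := eqVneq a 0; last by exists `|a|%N; apply: (posA a b) => //; rewrite -xE.
  have c0 : c != 0 by apply: contra_neq Dab => ->; rewrite a0 mul0r mulr0 subr0.
  by exists `|c|%N; apply: (posA c d) => //; rewrite -yE.
have exB : exists n, B n.
  exists `|(a * d - b * c)%R|%N; apply: posB => //.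
  have -> : scale2 (a * d - b * c)%:~R v = scale2 a%:~R y - scale2 c%:~R x.
    by rewrite xE yE rmorphB !rmorphM /=; apply: pairP => /=; ring.
  by apply: HB; apply: HZ.
case: (ex_minnP exA) => a0 /asboolP[a0_gt0 [b0 Hab0]] mina.
case: (ex_minnP exB) => d0 /asboolP[d0_gt0 Hd0] mind.
have a0r : a0%:R != 0 :> R by rewrite pnatr_eq0 -lt0n.
have d0r : d0%:R != 0 :> R by rewrite pnatr_eq0 -lt0n.
exists (scale2 a0%:R u + scale2 b0%:~R v), (scale2 d0%:R v); split.
  by rewrite det2Dl !det2Zl !det2Zr det2xx !mulr0 addr0 !mulf_neq0.
apply/seteqP; split=> [p Hp|_ [p [q ->]]]; last first.
  by rewrite -[X in H (_ + X)]opprK; apply: HB; [exact: HZ|rewrite -scale2N -rmorphN; exact: HZ].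
have [p1 [p2 pE]] := HL _ Hp.
have modlt k (n : nat) : (0 < n)%N -> 0 <= (k %% n)%Z /\ (`|(k %% n)%Z| < n)%N.
  move=> n0; have ge0 : 0 <= (k %% n)%Z by apply: modz_ge0; rewrite -lt0n.
  by split=> //; rewrite -ltz_nat gez0_abs // ltz_pmod.
pose q := (p1 %/ a0)%Z; pose p' := p - scale2 q%:~R (scale2 a0%:R u + scale2 b0%:~R v).
have Hp' : H p' by apply: HB => //; exact: HZ.
have p'E : p' = scale2 (p1 %% a0)%Z%:~R u + scale2 (p2 - q * b0)%:~R v.
  rewrite /p' pE {1}(divz_eq p1 a0) -/q rmorphB !rmorphD !rmorphM /=.
  by apply: pairP => /=; ring.
have r0 : (p1 %% a0)%Z = 0.
  apply/eqP; apply: contraT => r0; have [_] := modlt p1 a0 a0_gt0.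
  by rewrite ltnNge mina //; apply: (posA _ (p2 - q * b0)) => //; rewrite -p'E.
rewrite r0 scale2_0 add0r in p'E.
pose s := ((p2 - q * b0) %/ d0)%Z; pose p'' := p' - scale2 s%:~R (scale2 d0%:R v).
have Hp'' : H p'' by apply: HB => //; exact: HZ.
have p''E : p'' = scale2 ((p2 - q * b0) %% d0)%Z%:~R v.
  rewrite /p'' p'E {1}(divz_eq (p2 - q * b0) d0) -/s rmorphD !rmorphM /=.
  by apply: pairP => /=; ring.
have s0 : ((p2 - q * b0) %% d0)%Z = 0.
  apply/eqP; apply: contraT => s0; have [_] := modlt (p2 - q * b0) d0 d0_gt0.
  by rewrite ltnNge mind //; apply: posB => //; rewrite -p''E.
exists q, s; move/eqP: p''E; rewrite s0 scale2_0 /p'' subr_eq0 => /eqP <-.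
by rewrite /p' addrC subrK.
Qed.

Lemma sublattice L H x y : lattice L -> zmod_closed [in H] -> H `<=` L ->
  H x -> H y -> det2 x y != 0 -> lattice H.
Proof.
move=> /lattice_basis[u [v [D ->]]] zH HL Hx Hy Dxy.
by have [w [z [Dw ->]]] := sublattice_basis D zH HL Hx Hy Dxy; exact: lattice_zlat.
Qed.

Lemma common_denominator (I : finType) (q : I -> rat) :
  exists2 n : nat, (0 < n)%N & forall i, exists k, q i * n%:R = k%:~R.
Proof.
exists (\prod_i `|denq (q i)|)%N.
  by rewrite prodn_gt0 // => i; rewrite absz_gt0 denq_neq0.
move=> i; rewrite (bigD1 i) //= natrM mulrA.
have -> : (`|denq (q i)|%N)%:R = (denq (q i))%:~R :> rat.
  by rewrite -[RHS](congr1 intr (gez0_abs (denq_ge0 (q i)))).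
rewrite -{1}(divq_num_den (q i)) divfK ?intr_eq0 ?denq_neq0 //.
set N := (\prod_(_ | _) _)%N; exists (numq (q i) * N%:Z).
by rewrite rmorphM.
Qed.

Lemma Qspan_lattice (I : finType) (t : I -> R * R) u v :
  (forall i, Qspan u v (t i)) ->
  exists2 n : nat, (0 < n)%N & forall i, zlat u v (scale2 n%:R (t i)).
Proof.
move=> /(_ _)/cid-/all_sig[p Hp].
have {Hp} /all_sig[q Hq] i := cid (Hp i).
have [n n0 np] := common_denominator p; have [n' n'0 nq] := common_denominator q.
exists (n * n')%N; first by rewrite muln_gt0 n0.
move=> i; have [k Hk] := np i; have [k' Hk'] := nq i.
exists (k * n'%:Z), (k' * n%:Z); rewrite Hq scale2Dr !scale2A natrM.
have kE : n%:R * ratr (p i) = k%:~R :> R.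
  by rewrite -(ratr_int R k) -Hk rmorphM /= ratr_nat mulrC.
have kE' : n'%:R * ratr (q i) = k'%:~R :> R.
  by rewrite -(ratr_int R k') -Hk' rmorphM /= ratr_nat mulrC.
congr (scale2 _ _ + scale2 _ _).
  by rewrite rmorphM /= -kE; ring.
by rewrite rmorphM /= -kE'; ring.
Qed.

Lemma zlat_scale u v (n : nat) x : (0 < n)%N -> zlat u v (scale2 n%:R x) ->
  zlat (scale2 n%:R^-1 u) (scale2 n%:R^-1 v) x.
Proof.
move=> n0 [a [b E]]; exists a, b.
have nn : n%:R != 0 :> R by rewrite pnatr_eq0 -lt0n.
transitivity (scale2 (n%:R^-1 * n%:R) x); first by rewrite mulVf // scale2_1.
by rewrite -scale2A E scale2Dr !scale2A ![n%:R^-1 * _]mulrC.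
Qed.

Lemma zlat_l u v : zlat u v u.
Proof. by exists 1, 0; rewrite scale2_1 scale2_0 addr0. Qed.

Lemma zlat_r u v : zlat u v v.
Proof. by exists 0, 1; rewrite scale2_1 scale2_0 add0r. Qed.

Lemma Qspan_zmod_closed u v : zmod_closed [in Qspan u v].
Proof. by apply: zmod_closedP; [exact: Qspan0|exact: QspanB]. Qed.

Lemma zlat_Qspan u v : zlat u v `<=` Qspan u v.
Proof. by move=> x [a [b ->]]; exists a%:~R, b%:~R; rewrite !ratr_int. Qed.

Lemma zspan_zmod_closed m (I : pred 'I_m) (t : 'I_m -> R * R) : zmod_closed [in zspan I t].
Proof.
apply: zmod_closedP; first by exists (fun=> 0); rewrite big1.
move=> _ _ [c ->] [d ->]; exists (fun i => c i - d i).
by rewrite -sumrB; apply: eq_bigr => i _; rewrite mulrzBr.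
Qed.

Lemma zspan_gen m (I : pred 'I_m) (t : 'I_m -> R * R) i : I i -> zspan I t (t i).
Proof.
move=> Ii; exists (fun j => (j == i)%:Z); rewrite (bigD1 i) //= eqxx mulr1z.
by rewrite big1 ?addr0 // => j /andP[_ /negbTE ->].
Qed.

Lemma zspan_sub m (I : pred 'I_m) (t : 'I_m -> R * R) L : zmod_closed [in L] ->
  (forall i, I i -> L (t i)) -> zspan I t `<=` L.
Proof.
move=> zL HI _ [c ->]; apply: (big_ind L).
- exact: zmod_closed0.
- move=> x y Lx Ly; have -> : x + y = x - scale2 (- 1)%:~R y.
    by rewrite rmorphN1 scale2N scale2_1 opprK.
  by apply: zmod_closedB => //; apply: zmod_closedZ.
- by move=> i Ii; rewrite intmul_scale2; apply: zmod_closedZ => //; exact: HI.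
Qed.

Lemma zspan_lattice m (I : pred 'I_m) (t : 'I_m -> R * R) u v i j :
  det2 u v != 0 -> (forall i, I i -> Qspan u v (t i)) -> I i -> I j ->
  det2 (t i) (t j) != 0 -> lattice (zspan I t).
Proof.
move=> D HI Ii Ij Dij.
(* Vectors outside [I] are replaced by [0], so that a common denominator can be taken over the whole
   index type. *)
pose t' i := if I i then t i else 0.
have [|n n0 Hn] := @Qspan_lattice 'I_m t' u v.
  by move=> k; rewrite /t'; case: ifP => [/HI//|_]; exact: Qspan0.
have nn : n%:R^-1 != 0 :> R by rewrite invr_eq0 pnatr_eq0 -lt0n.
apply: (@sublattice (zlat (scale2 n%:R^-1 u) (scale2 n%:R^-1 v)) _ (t i) (t j)) => //.
- by apply: lattice_zlat; rewrite det2Zl det2Zr !mulf_neq0.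
- exact: zspan_zmod_closed.
- apply: zspan_sub; first by apply: zmod_closedP; [exact: zlat0|exact: zlatB].
  by move=> k Ik; apply: zlat_scale => //; have := Hn k; rewrite /t' Ik.
- exact: zspan_gen.
- exact: zspan_gen.
Qed.

(** The last hypothesis is commensurability: a common multiple [N] puts [N u] and [N v] into every
    [L i], so the intersection has full rank in [L i0]. *)
Lemma lattice_bigcap (I : finType) (J : pred I) (L : I -> set (R * R)) i0 : J i0 ->
  (forall i, J i -> lattice (L i)) ->
  (forall u v i, J i -> L i0 = zlat u v -> forall a b : R * R, L i = zlat a b ->
     Qspan a b u /\ Qspan a b v) ->
  lattice (\bigcap_(i in [set i | J i]) L i).
Proof.
move=> Ji0 HL comm; have [u [v [D E]]] := lattice_basis (HL _ Ji0).
have zL i : J i -> zmod_closed [in L i] by move=> /HL[].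
have HN i : exists n : nat, (0 < n)%N /\ (J i -> L i (scale2 n%:R u) /\ L i (scale2 n%:R v)).
  case Ji : (J i); last by exists 1%N.
  have [a [b [Dab Ei]]] := lattice_basis (HL _ Ji).
  have [ua va] := comm u v i Ji E a b Ei.
  have [|n n0 Hn] := @Qspan_lattice bool (fun s => if s then u else v) a b.
    by case.
  by exists n; split=> // _; rewrite Ei; split; [exact: (Hn true)|exact: (Hn false)].
have /all_sig[n Hn] i := cid (HN i).
pose N := (\prod_i n i)%N.
have N0 : (0 < N)%N by apply: prodn_gt0 => i; case: (Hn i).
have NL i z : J i -> L i (scale2 (n i)%:R z) -> L i (scale2 N%:R z).
  move=> Ji; rewrite /N (bigD1 i) //= mulnC natrM -scale2A => Lz.
  exact: (zmod_closedZ (\prod_(j | j != i) n j)%N (zL _ Ji) Lz).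
apply: (@sublattice (L i0) _ (scale2 N%:R u) (scale2 N%:R v)).
- exact: HL.
- apply: zmod_closedP => [i /zL/zmod_closed0//|x y Lx Ly i Ji].
  by apply: zmod_closedB; [exact: zL|exact: Lx|exact: Ly].
- by move=> x; apply.
- by move=> i Ji; apply: NL => //; have [_ /(_ Ji)[]] := Hn i.
- by move=> i Ji; apply: NL => //; have [_ /(_ Ji)[]] := Hn i.
by rewrite det2Zl det2Zr !mulf_neq0 // pnatr_eq0 -lt0n.
Qed.

Lemma latticeI L H u v (a b : R * R) : lattice H -> lattice L -> H = zlat u v -> L = zlat a b ->
  Qspan a b u -> Qspan a b v -> lattice (H `&` L).
Proof.
move=> lH lL HE LE ua va.
have [w [z [D HE']]] := lattice_basis lH.
have HA : Qspan a b w /\ Qspan a b z.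
  have sub x : H x -> Qspan a b x.
    by rewrite HE => /zlat_Qspan; apply: Qspan_sub.
  by split; apply: sub; rewrite HE'; [exact: zlat_l|exact: zlat_r].
have [|n n0 Hn] := @Qspan_lattice bool (fun s => if s then w else z) a b.
  by case; case: HA.
have zH : zmod_closed [in H] by case: lH.
have zL : zmod_closed [in L] by case: lL.
have [Hw Hz] : H w /\ H z.
  by rewrite HE'; split; [exact: zlat_l|exact: zlat_r].
apply: (@sublattice H _ (scale2 n%:R w) (scale2 n%:R z)) => //.
- apply: zmod_closedP => [|x y [Hx Lx] [Hy Ly]].
    by split; exact: zmod_closed0.
  by split; apply: zmod_closedB.
- by split; [exact: (zmod_closedZ n zH Hw)|rewrite LE; exact: (Hn true)].
- by split; [exact: (zmod_closedZ n zH Hz)|rewrite LE; exact: (Hn false)].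
by rewrite det2Zl det2Zr !mulf_neq0 // pnatr_eq0 -lt0n.
Qed.

End Lattice.

(** * The area of a fundamental domain *)

Section Area.
Variable R : realType.
Local Notation mu := (@lebesgue_measure R).
Local Notation RM := (measurableTypeR R).
Implicit Types (u v x y z w l : R * R).

Lemma measurable_shift (t : R) : measurable_fun [set: RM] (fun x : RM => x + t : RM).
Proof. by apply: measurable_funD => //; exact: measurable_cst. Qed.

Lemma lebesgue_measure_shift (t : R) (A : set RM) : measurable A ->
  mu ((fun x : RM => x + t : RM) @^-1` A) = mu A.
Proof.
move=> mA; rewrite -[LHS]/(pushforward mu (fun x : RM => x + t : RM) A).
apply/esym/lebesgue_measure_unique => //; first exact: measurable_shift.
move=> mS _ [[a b]] _ <-; rewrite /= /pushforward.
rewrite (_ : _ @^-1` _ = `](a - t), (b - t)]%classic); last first.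
  by apply/seteqP; split=> x; rewrite /= !in_itv /= ltrBlDr lerBrDr.
by rewrite !lebesgue_measure_itv /= !lte_fin ltrD2r -!EFinB opprB addrA subrK.
Qed.

Lemma measurable_shift2 l :
  measurable_fun [set: (RM * RM)%type] (fun x : (RM * RM)%type => x + l : (RM * RM)%type).
Proof.
apply/measurable_fun_pairP; split.
  exact: (measurableT_comp (measurable_shift l.1) measurable_fst).
exact: (measurableT_comp (measurable_shift l.2) measurable_snd).
Qed.

Lemma area_shift l (A : set (RM * RM)) : measurable A ->
  area R ((fun x : (RM * RM)%type => x + l : (RM * RM)%type) @^-1` A) = area R A.
Proof.
move=> mA; rewrite -[LHS]/(pushforward (area R) (fun x : (RM * RM)%type => x + l : (RM * RM)%type) A).
apply/esym/product_measure_unique => //; first exact: measurable_shift2.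
move=> mS X Y mX mY; rewrite /= /pushforward.
have -> : (fun x : (RM * RM)%type => x + l : (RM * RM)%type) @^-1` (X `*` Y) =
  ((fun x : RM => x + l.1 : RM) @^-1` X) `*` ((fun x : RM => x + l.2 : RM) @^-1` Y).
  by apply/seteqP; split.
have mSB t (B : set RM) : measurable B -> measurable ((fun x : RM => x + t : RM) @^-1` B).
  by move=> mB; rewrite -[X in measurable X]setTI; apply: measurable_shift.
by rewrite areaX ?lebesgue_measure_shift //; apply: mSB.
Qed.

(** Cut [D] by the lattice translates of [D'] and [D'] by those of [D]. Corresponding pieces are
    translates of each other, and there are countably many. *)
Lemma fundamental_domain_area u v (D D' : set (R * R)) : det2 u v != 0 ->
  fundamental_domain (zlat u v) D -> fundamental_domain (zlat u v) D' ->
  area R D = area R D'.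
Proof.
move=> Duv [mD HD] [mD' HD'].
(* An enumeration of the lattice through codes of pairs of integers; a number that is no code
   contributes an empty piece. *)
pose l n : option (R * R) := omap (zlat_map u v) (@pickle_inv (int * int)%type n).
pose F n : set (RM * RM) := if l n is Some z then D `&` (fun x => x + - z) @^-1` D' else set0.
pose F' n : set (RM * RM) := if l n is Some z then D' `&` (fun x => x + z) @^-1` D else set0.
have mshift z (A : set (RM * RM)) : measurable A ->
    measurable ((fun x : (RM * RM)%type => x + z : (RM * RM)%type) @^-1` A).
  by move=> mA; rewrite -[X in measurable X]setTI; apply: measurable_shift2.
have mF n : measurable (F n).
  by rewrite /F; case: (l n) => [z|//]; apply: measurableI => //; apply: mshift.
have mF' n : measurable (F' n).
  by rewrite /F'; case: (l n) => [z|//]; apply: measurableI => //; apply: mshift.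
have lP z : zlat u v z -> exists n, l n = Some z.
  move=> [a [b zE]]; exists (pickle (a, b)).
  by rewrite /l pickleK_inv /= zE.
have lL n z : l n = Some z -> zlat u v z.
  by rewrite /l; case: pickle_inv => //= -[a b] [<-]; exists a, b.
have linj n n' z : l n = Some z -> l n' = Some z -> n = n'.
  rewrite /l; case pn: (@pickle_inv (int * int)%type n) => [p|] //=.
  case pn': (@pickle_inv (int * int)%type n') => [p'|] //= /Some_inj <- /Some_inj E.
  have pp : p' = p.
    by case: p p' E {pn pn'} => [a b] [c d]; rewrite /zlat_map /= => /(zlat_inj Duv)[-> ->].
  have := @pickle_invK (int * int)%type n; have := @pickle_invK (int * int)%type n'.
  by rewrite pn pn' /= pp => <- <-.
have trivF : trivIset setT F.
  apply/trivIsetP => i j _ _ ij; apply/seteqP; split=> // x; rewrite /F.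
  case li: (l i) => [y|]; case lj: (l j) => [z|] //=; [|by case|by case|by case].
  move=> [[_ Hy] [_ Hz]].
  have [w [_ wU]] := HD' x.
  have yz : y = z by rewrite -(wU y) ?(wU z) //; split => //; [exact: lL lj|exact: lL li].
  by move/eqP: ij; apply; apply: (linj _ _ y li); rewrite yz.
have trivF' : trivIset setT F'.
  apply/trivIsetP => i j _ _ ij; apply/seteqP; split=> // x; rewrite /F'.
  case li: (l i) => [y|]; case lj: (l j) => [z|] //=; [|by case|by case|by case].
  move=> [[_ Hy] [_ Hz]].
  have [w [_ wU]] := HD x.
  have LN t : zlat u v t -> zlat u v (- t).
    by move=> Lt; rewrite -[- t]sub0r; apply: zlatB => //; exact: zlat0.
  have yz : - y = - z.
    by rewrite -(wU (- y)) ?(wU (- z)) ?opprK //; split; rewrite ?opprK //; apply: LN; [exact: lL lj|exact: lL li].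
  by move/eqP: ij; apply; apply: (linj _ _ y li); rewrite lj -[z]opprK -yz opprK.
have UF : D = \bigcup_n F n.
  apply/seteqP; split=> [x Dx|x [n _]]; last by rewrite /F; case: (l n) => // z [].
  have [z [[Lz Hz] _]] := HD' x; have [n ln] := lP z Lz.
  by exists n => //; rewrite /F ln.
have UF' : D' = \bigcup_n F' n.
  apply/seteqP; split=> [x Dx|x [n _]]; last by rewrite /F'; case: (l n) => // z [].
  have [z [[Lz Hz] _]] := HD x.
  have [|n ln] := lP (- z); first by rewrite -[- z]sub0r; apply: zlatB => //; exact: zlat0.
  by exists n => //; rewrite /F' ln.
have sum_area (A : nat -> set (RM * RM)) : (forall n, measurable (A n)) -> trivIset setT A ->
    area R (\bigcup_n A n) = (\sum_(0 <= n <oo | n \in [set: nat]) area R (A n))%E.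
  by move=> mA tA; exact: measure_bigcup.
transitivity (area R (\bigcup_n F n)); first by rewrite -UF.
transitivity (area R (\bigcup_n F' n)); last by rewrite -UF'.
rewrite (sum_area F mF trivF) (sum_area F' mF' trivF').
apply: eq_eseriesr => n _; rewrite /F /F'; case: (l n) => [z|//].
rewrite -(area_shift z); last by apply: measurableI => //; apply: mshift.
congr (area R _); apply/seteqP; split=> x /= [H1 H2]; split=> //; move: H2 H1; rewrite ?addrK //.
Qed.

(** A half-open parallelogram with two vertical sides and two sides parallel to [u], for [u.1 != 0]:
    its vertical sections are intervals of constant length, which suits the product measure. *)
Definition strip_domain u v : set (R * R) :=
  [set x | 0 <= x.1 < `|u.1| /\ 0 <= det2 u x / det2 u v < 1].

Lemma measurable_det2 u : measurable_fun [set: (RM * RM)%type] (det2 u : (RM * RM)%type -> RM).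
Proof.
have m1 : measurable_fun setT (fun x : (RM * RM)%type => x.1 : RM) by exact: measurable_fst.
have m2 : measurable_fun setT (fun x : (RM * RM)%type => x.2 : RM) by exact: measurable_snd.
apply: (@measurable_realfun.measurable_funB _ _ _ _ (fun x => u.1 * x.2) (fun x => u.2 * x.1)).
  by apply: measurable_funM => //; exact: measurable_cst.
by apply: measurable_funM => //; exact: measurable_cst.
Qed.

Lemma line_negligible u (c : R) : u != 0 -> (area R).-negligible [set x | det2 u x = c].
Proof.
move=> u0; pose A : set (RM * RM) := [set x | det2 u x = c].
have mA : measurable A.
  rewrite (_ : A = (det2 u : (RM * RM)%type -> RM) @^-1` [set c]) //.
  by rewrite -[X in measurable X]setTI; apply: measurable_det2 => //; exact: measurable_set1.
exists A; split=> //; have [u1|u1] := eqVneq u.1 0.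
  have u2 : u.2 != 0 by apply: contra u0 => /eqP u2; apply/eqP/pairP.
  rewrite (_ : A = [set - c / u.2] `*` setT); last first.
    apply/seteqP; split=> x; rewrite /A /det2 /= u1 mul0r sub0r => E; last first.
      by rewrite E.1; field.
    by split=> //; rewrite -E opprK [u.2 * _]mulrC mulfK.
  by rewrite areaX ?lebesgue_measure_set1 ?mul0e //; exact: measurable_set1.
rewrite -[LHS]/(\int[mu]_x (mu \o xsection A) x)%E; apply: integral0_eq => x _ /=.
rewrite (_ : xsection A x = [set (c + u.2 * x) / u.1]) ?lebesgue_measure_set1 //.
apply/seteqP; split=> y; rewrite /xsection /= in_setE /A /det2 /=.
  by move=> <-; field.
by move=> ->; field.
Qed.

Lemma measurable_strip_domain u v :
  @measurable _ (RM * RM)%type (strip_domain u v).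
Proof.
pose g (x : (RM * RM)%type) : RM := det2 u x / det2 u v.
have mg : measurable_fun setT g.
  by apply: measurable_funM; [exact: measurable_det2|exact: measurable_cst].
rewrite (_ : strip_domain u v = (fst @^-1` `[0, `|u.1|[) `&` (g @^-1` `[0, 1[)); last first.
  by apply/seteqP; split=> x /=; rewrite !in_itv /=.
apply: measurableI.
  rewrite -[X in measurable X]setTI; apply: measurable_fst => //; exact: measurable_itv.
by rewrite -[X in measurable X]setTI; apply: mg => //; exact: measurable_itv.
Qed.

Lemma strip_domain_fundamental u v : det2 u v != 0 -> u.1 != 0 ->
  fundamental_domain (zlat u v) (strip_domain u v).
Proof.
move=> D u1; split; first exact: measurable_strip_domain.
have u1' : 0 < `|u.1| by rewrite normr_gt0.
move=> x.
have frac (t : R) : 0 <= t - (Num.floor t)%:~R < 1.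
  by have /andP[] := floor_itv t; rewrite rmorphD /=; lra.
pose b := Num.floor (det2 u x / det2 u v).
pose c := Num.floor ((x.1 - b%:~R * v.1) / `|u.1|).
(* [c] counts steps of length [|u.1|]; [a] restores the sign of [u.1]. *)
pose a : int := (if u.1 < 0 then - c else c)%R.
have au : a%:~R * u.1 = c%:~R * `|u.1|.
  rewrite /a; case: ltP => u1s; first by rewrite ltr0_norm // rmorphN mulNr mulrN.
  by rewrite ger0_norm.
exists (scale2 a%:~R u + scale2 b%:~R v); split.
  split; first by exists a, b.
  split.
    rewrite /= au; have := frac ((x.1 - b%:~R * v.1) / `|u.1|); rewrite -/c.
    set q := (x.1 - _) / _.
    have -> : x.1 - (c%:~R * `|u.1| + b%:~R * v.1) = (q - c%:~R) * `|u.1|.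
      by rewrite mulrBl /q divfK ?gt_eqF //; ring.
    by move=> /andP[q0 q1]; rewrite mulr_ge0 // ?ltW // -[X in _ < X]mul1r ltr_pM2r.
  rewrite det2Br det2Dr !det2Zr det2xx mulr0 add0r mulrBl mulfK //; exact: frac.
move=> _ [[a' [b' ->]] [H1 H2]].
have bE : b' = b.
  move: H2; rewrite det2Br det2Dr !det2Zr det2xx mulr0 add0r mulrBl mulfK // => H2.
  have := frac (det2 u x / det2 u v); rewrite -/b.
  move: H2; set q := _ / _ => H2 H3.
  have : `|(b' - b)%:~R| < 1 :> R by rewrite rmorphB ltr_norml /=; lra.
  by rewrite -intr_norm (_ : 1 = 1%:~R) // ltr_int -[1]add0r ltzD1 normr_le0 subr_eq0 => /eqP.
have aE : a' = a.
  have H3 := frac ((x.1 - b%:~R * v.1) / `|u.1|).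
  have : `|(a' - a)%:~R| < 1 :> R.
    rewrite -(ltr_pM2r u1') mul1r -normrM rmorphB mulrBl au ltr_norml.
    move: H1; rewrite bE /=; move: H3; rewrite -/c; set q := (x.1 - _) / _ => H3.
    have -> : x.1 - (a'%:~R * u.1 + b%:~R * v.1) = q * `|u.1| - a'%:~R * u.1.
      by rewrite /q divfK ?gt_eqF //; ring.
    move: H3 => /andP[q0 q1].
    have h1 : 0 <= (q - c%:~R) * `|u.1| by rewrite mulr_ge0 // ltW.
    have h2 : (q - c%:~R) * `|u.1| < `|u.1| by rewrite -[X in _ < X]mul1r ltr_pM2r.
    by rewrite mulrBl in h1 h2; lra.
  by rewrite -intr_norm (_ : 1 = 1%:~R) // ltr_int -[1]add0r ltzD1 normr_le0 subr_eq0 => /eqP.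
by rewrite aE bE.
Qed.

Lemma strip_domain_area u v : det2 u v != 0 -> u.1 != 0 ->
  area R (strip_domain u v) = `|det2 u v|%:E.
Proof.
move=> D u1; have mS := measurable_strip_domain u v.
have u1' : 0 < `|u.1| by rewrite normr_gt0.
pose len := `|det2 u v| / `|u.1|.
have sec (x : R) : mu (xsection (strip_domain u v) x) = if x \in `[0, `|u.1|[ then len%:E else 0%E.
  rewrite in_itv /=; case: ifP => hx; last first.
    rewrite (_ : xsection _ _ = set0) ?measure0 //.
    by apply/seteqP; split=> // y; rewrite /xsection /= inE => -[]; rewrite /= hx.
  have k0 : u.1 / det2 u v != 0 by rewrite mulf_neq0 // invr_eq0.
  pose k := u.1 / det2 u v; pose c := u.2 * x / det2 u v.
  have lenE : len = `|k|^-1 by rewrite /len /k normrM normfV invfM invrK mulrC.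
  have kE (y : R) : det2 u (x, y) / det2 u v = k * y - c.
    by rewrite /k /c {1}/det2 /=; move: D; set d := det2 u v => D; field.
  have [kp|kn] := ltP 0 k.
    rewrite (_ : xsection _ _ = `[c / k, (c + 1) / k[%classic).
      rewrite lebesgue_measure_itv /= lte_fin ltr_pM2r ?invr_gt0 // ltrDl ltr01 -EFinB.
      by rewrite -mulrBl addrAC subrr add0r mul1r lenE gtr0_norm.
    apply/seteqP; split=> y; rewrite /xsection /= in_itv /= in_setE /strip_domain /= kE.
      by rewrite ler_pdivrMr // ltr_pdivlMr // => -[_]; lra.
    by rewrite ler_pdivrMr // ltr_pdivlMr // => h; split=> //; lra.
  have {}kn : k < 0 by rewrite lt_neqAle k0.
  rewrite (_ : xsection _ _ = `](c + 1) / k, c / k]%classic).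
    rewrite lebesgue_measure_itv /= lte_fin ltr_nM2r ?invr_lt0 // ltrDl ltr01 -EFinB.
    by rewrite -mulrBl opprD addrA subrr add0r mulN1r lenE ltr0_norm // invrN.
  apply/seteqP; split=> y; rewrite /xsection /= in_itv /= in_setE /strip_domain /= kE.
    by rewrite ltr_ndivrMr // ler_ndivlMr // => -[_]; lra.
  by rewrite ltr_ndivrMr // ler_ndivlMr // => h; split=> //; lra.
pose I : set RM := `[0, `|u.1|[%classic.
transitivity (\int[mu]_(x in I) len%:E)%E.
  rewrite [RHS]integral_mkcond; apply: eq_integral => x _; rewrite /= sec /patch.
  by rewrite mem_setE.
have -> : (\int[mu]_(x in I) len%:E = len%:E * mu I)%E.
  by apply: integral_cst; exact: measurable_itv.
have -> : mu I = `|u.1|%:E.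
  by rewrite /I lebesgue_measure_itv /= lte_fin u1' -EFinB subr0.
by rewrite -EFinM /len divfK ?gt_eqF.
Qed.

Lemma zlatC u v : zlat u v = zlat v u.
Proof. by apply/seteqP; split=> x [a [b ->]]; exists b, a; rewrite addrC. Qed.

Lemma lattice_det_zlat u v : det2 u v != 0 -> lattice_det (zlat u v) = `|det2 u v|.
Proof.
move=> D; wlog u1 : u v D / u.1 != 0.
  move=> H; have [u1|u1] := eqVneq u.1 0; last exact: H.
  have v1 : v.1 != 0 by apply: contra_neq D => v1; rewrite /det2 u1 v1 mul0r mulr0 subrr.
  by rewrite zlatC det2C normrN H // det2C oppr_eq0.
have F := strip_domain_fundamental D u1.
have Fx : fundamental_domain (zlat u v) (xget set0 (fundamental_domain (zlat u v))).
  by apply: xgetPex; exists (strip_domain u v).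
by rewrite /lattice_det (fundamental_domain_area D Fx F) strip_domain_area.
Qed.

End Area.

(** * Lattice tilings *)

Section Segments.
Variables (R : realType) (u : R * R).
Hypothesis u0 : u != 0.
Implicit Types (x y z l p : R * R) (M : R * R -> nat) (a b c s t : R).

Definition segment a b : set (R * R) := [set z | exists2 t, a <= t < b & z = scale2 t u].

Lemma segment_shift a b s z : segment a b (z + scale2 s u) <-> segment (a - s) (b - s) z.
Proof.
split=> [[t ht E]|[t ht ->]].
  exists (t - s); first lra.
  by rewrite scale2D scale2N -E addrK.
by exists (t + s); rewrite ?scale2D //; lra.
Qed.

Lemma segment_split a c b z : a <= c <= b ->
  \1_(segment a b) z = \1_(segment a c) z + \1_(segment c b) z :> R.
Proof.
move=> /andP[ac cb].
have [[s ->]|H] := pselect (exists s, z = scale2 s u); last first.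
  have N a' b' : \1_(segment a' b') z = 0 :> R.
    by rewrite indicE memNset // => -[t _ E]; apply: H; exists t.
  by rewrite !N addr0.
have S a' b' : (scale2 s u \in segment a' b') = (a' <= s < b').
  by apply/idP/idP => [/set_mem[t ?] /(scale2_inj u0) ->//|?]; apply/mem_set; exists s.
rewrite !indicE !S.
by do !(case: (boolP (_ && _)) => ? //=); lra.
Qed.

Lemma tile_count_split M x a c b : a <= c <= b ->
  tile_count M (segment a b) x = (tile_count M (segment a c) x + tile_count M (segment c b) x)%E.
Proof.
move=> acb; rewrite /tile_count -esumD; try by move=> *; apply: weight_ge0.
by apply: eq_esum => l _; rewrite -EFinD -mulrDr -(@segment_split a c b).
Qed.

Lemma tile_count_segment_shift M x a b s :
  tile_count M (segment a b) (x + scale2 s u) = tile_count M (segment (a - s) (b - s)) x.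
Proof. by apply: eq_tile_count => l _; rewrite addrAC; exact: segment_shift. Qed.

(** Sliding a segment of exactly one period drops a piece at one end and picks up its translate by
    [u] at the other. *)
Lemma tile_count_segment_const M a b x r :
  (forall A x, tile_count M A (x + u) = tile_count M A x) -> b = a + 1 ->
  tile_count M (segment a b) (x + scale2 r u) = tile_count M (segment a b) x.
Proof.
move=> Mu ->.
have Mk A k y : tile_count M A (y + scale2 k%:~R u) = tile_count M A y.
  exact: (periodZ (g := tile_count M A)).
have small s y : 0 <= s < 1 ->
    tile_count M (segment a (a + 1)) (y + scale2 s u) = tile_count M (segment a (a + 1)) y.
  move=> /andP[s0 s1]; rewrite tile_count_segment_shift.
  rewrite (@tile_count_split _ _ _ a); last lra.
  rewrite [RHS](@tile_count_split _ _ _ (a + 1 - s)); last lra.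
  rewrite addeC; congr (_ + _)%E.
  have <- : tile_count M (segment (a + 1 - s) (a + 1)) (y + scale2 1 u) =
            tile_count M (segment (a + 1 - s) (a + 1)) y by rewrite scale2_1 Mu.
  rewrite (tile_count_segment_shift M y (a + 1 - s) (a + 1) 1).
  have -> : a + 1 - s - 1 = a - s by ring.
  by have -> : a + 1 - 1 = a by ring.
have -> : r = (r - (Num.floor r)%:~R) + (Num.floor r)%:~R by rewrite subrK.
rewrite scale2D addrA Mk small //.
by have /andP[] := floor_itv r; rewrite rmorphD /=; lra.
Qed.

End Segments.

Section LatticeTiling.
Variables (R : realType) (m : nat) (e : 'I_m -> R * R).
Hypothesis e_pos : forall i j : 'I_m, (i < j)%N -> 0 < det2 (e i) (e j).
Hypothesis m2 : (2 <= m)%N.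
Implicit Types (x y z w l p : R * R) (i j : 'I_m) (L : set (R * R)).

Local Notation P := (zonotope e).

Lemma set_mult_gt0 L x : (0 < set_mult L x)%N <-> L x.
Proof.
rewrite /set_mult lt0b; split=> [/set_mem//|Lx]; exact/mem_set.
Qed.

Lemma tile_count_lattice_shift L A x p : zmod_closed [in L] -> L p ->
  tile_count (set_mult L) A (x + p) = tile_count (set_mult L) A x.
Proof.
move=> zL Lp; rewrite /tile_count.
have Ladd l : L l -> L (l + p).
  move=> Ll; rewrite -[p]opprK; apply: zmod_closedB => //.
  by rewrite -[- p]sub0r; apply: zmod_closedB => //; exact: zmod_closed0.
rewrite (reindex_esum (msupport (set_mult L)) (msupport (set_mult L)) (fun l => l + p)).
  apply: eq_esum => l /set_mult_gt0 Ll; congr (_ %:E).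
  rewrite opprD addrACA subrr addr0; congr (_%:R * _).
  by rewrite /set_mult !mem_set //; exact: Ladd.
split.
- by move=> l /set_mult_gt0 Ll; apply/set_mult_gt0/Ladd.
- by move=> l l' _ _; exact: addIr.
- move=> l /set_mult_gt0 Ll; exists (l - p); last by rewrite subrK.
  by apply/set_mult_gt0; exact: zmod_closedB.
Qed.

(** Two lattice points in a common box of half-side [r / 2] differ by a lattice vector of the
    neighbourhood that isolates [0], so they are equal. *)
Lemma lattice_box L : lattice L ->
  forall K, exists C : nat, forall x, (tile_count (set_mult L) (box K) x <= C%:R%:E)%E.
Proof.
move=> lL; have [zL dL _] := lL.
have [_ [V V0 VL]] := dL _ (zmod_closed0 zL); have [r r0 rV] := nbhs_box V0.
apply: (@tile_count_box _ _ (r / 2) 1); first by rewrite divr_gt0.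
move=> x; have [[l0 Ll0 Bl0]|H] := pselect (exists2 l, L l & box (r / 2) (x - l)); last first.
  rewrite /tile_count esum1 ?lee_fin // => l /set_mult_gt0 Ll; rewrite indicE memNset ?mulr0 //.
  by move=> Bl; apply: H; exists l.
rewrite /tile_count (esumID [set l0]); last by move=> *; apply: weight_ge0.
rewrite [X in (_ + X)%E]esum1 ?adde0; last first.
  move=> l [/set_mult_gt0 Ll ll0]; rewrite indicE memNset ?mulr0 // => Bl.
  apply: ll0; apply/eqP; rewrite -subr_eq0; apply/eqP.
  suff : (V `&` L) (l - l0) by rewrite VL.
  split; last exact: zmod_closedB.
  rewrite -[l - l0]add0r; apply: rV.
  have -> : l - l0 = (x - l0) - (x - l) by apply: pairP => /=; ring.
  case: Bl => b1 b2; case: Bl0 => b3 b4.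
  by split; rewrite /=; apply: le_trans (ler_normB _ _) _; rewrite [r in _ <= r]splitr; apply: lerD.
rewrite (_ : _ `&` _ = [set l0]); last first.
  apply/seteqP; split=> [y [//]|y /= ->]; split=> //; exact/set_mult_gt0.
rewrite esum_set1 ?weight_ge0 // lee_fin /set_mult mem_set // mul1r indicE.
by case: (_ \in _).
Qed.

Lemma tile_count_nat M A x (C : nat) : (tile_count M A x <= C%:R%:E)%E ->
  exists k : nat, tile_count M A x = k%:R%:E :> \bar R.
Proof.
move=> /tile_count_finite; set S := [set l | _] => finS.
exists (\sum_(l <- finmap.enum_fset (fset_set S)) M l)%N.
have -> : tile_count M A x = \esum_(l in S) ((M l)%:R%:E : \bar R).
  rewrite /tile_count esum_mkcond [RHS]esum_mkcond; apply: eq_esum => l _.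
  case: (pselect (0 < M l)%N) => Ml; last first.
    by rewrite !memNset // => -[].
  rewrite mem_set //; case: (pselect (A (x - l))) => Al.
    by rewrite indicE !mem_set ?mulr1.
  by rewrite indicE memNset // mulr0 memNset // => -[].
rewrite esum_fset // fsbig_finite //= natr_sum -sumEFin.
by [].
Qed.

(** Along the line [G] is locally constant, so its derivative vanishes everywhere. *)
Lemma constant_along (G : R * R -> R) x y :
  (forall z, exists2 r : R, 0 < r & forall t, 0 < t -> t < r ->
     G (z + scale2 t y) = G z /\ G (z - scale2 t y) = G z) ->
  forall t, G (x + scale2 t y) = G x.
Proof.
move=> HG t; rewrite -[in RHS](addr0 x) -(scale2_0 y).
apply: (@is_derive_0_is_cst _ (fun s => G (x + scale2 s y))) => s.
have [r r0 Hr] := HG (x + scale2 s y).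
apply: (@near_eq_is_derive _ _ _ (cst (G (x + scale2 s y)))) => //.
  near=> s'; rewrite /cst.
  have [->//|ss'] := eqVneq s' s.
  have sr : `|s' - s| < r.
    by rewrite distrC; near: s'; apply: nbhsx_ballx.
  have -> : x + scale2 s' y = x + scale2 s y + scale2 (s' - s) y.
    by rewrite -addrA -scale2D addrCA subrr addr0.
  have [lt|] := ltP s s'.
    by have [] := Hr (s' - s) _ _ => //; rewrite ?subr_gt0 // -(gtr0_norm (x := s' - s)) ?subr_gt0.
  rewrite le_eqVlt (negbTE ss') /= => lt.
  have [||_] := Hr (s - s'); rewrite ?subr_gt0 //.
    by rewrite -[s - s']opprB -(ltr0_norm (x := s' - s)) ?subr_lt0.
  by rewrite -scale2N opprB.
Unshelve. all: by end_near.
Qed.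

End LatticeTiling.

Section LatticeTilingCriterion.
Variables (R : realType) (m : nat) (e : 'I_m -> R * R).
Hypothesis e_pos : forall i j : 'I_m, (i < j)%N -> 0 < det2 (e i) (e j).
Hypothesis m2 : (2 <= m)%N.
Implicit Types (x y z w l p : R * R) (i j : 'I_m) (L : set (R * R)).

Local Notation P := (zonotope e).

(** In the second case [tau e j] is a lattice vector plus a multiple of [e j], and an edge is one
    full period of [e j], so sliding along it changes nothing. *)
Lemma lattice_edge_periodic L : lattice L ->
  (forall j, L (tau e j) \/ (L (e j) /\ exists r : R, L (tau e j - scale2 r (e j)))) ->
  forall j x, tile_count (set_mult L) (edge e j) (x + tau e j) =
              tile_count (set_mult L) (edge e j) x.
Proof.
move=> [zL _ _] HL j x; have [Lt|[Le [r Lr]]] := HL j.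
  exact: tile_count_lattice_shift.
rewrite -[tau e j](subrK (scale2 r (e j))) addrA addrAC tile_count_lattice_shift //.
apply: (tile_count_segment_const (e_neq0 e_pos m2 j)); last by lra.
by move=> A y; apply: tile_count_lattice_shift.
Qed.

Lemma lattice_window_step L : lattice L ->
  (forall j x, tile_count (set_mult L) (edge e j) (x + tau e j) =
              tile_count (set_mult L) (edge e j) x) ->
  forall n x, (n <= m)%N ->
    tile_count (set_mult L) (window e n) x = tile_count (set_mult L) (window e 0) x.
Proof.
move=> lL HW n x; elim: n => // n IH nm; rewrite -IH 1?ltnW //.
pose j := Ordinal nm; have HB := lattice_box lL.
have fin := @tile_count_edge R m e (set_mult L) _ j HB.
have := tile_count_step e_pos m2 (set_mult L) x j.
have -> : x + scale2 (1 / 2) (tau e j) = x - scale2 (1 / 2) (tau e j) + tau e j.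
  by apply: pairP => /=; field.
rewrite HW; set E1 := tile_count _ (edge e j) _.
by move=> /(congr1 (fun a => a - E1)%E); rewrite /= !addeK //; exact: fin.
Qed.

Lemma window_bounded L n : lattice L ->
  exists C : nat, forall x, (tile_count (set_mult L) (window e n) x <= C%:R%:E)%E.
Proof.
move=> lL; have [K HK] := box_of_widths e_pos m2 (halfwidth e).
have [C HC] := lattice_box lL K; exists C => x; apply: le_trans (HC x).
apply: le_tile_count => l _ /(window_zonotope e_pos m2)/zonotope_le Hl.
exact: HK.
Qed.

(** The count for [window m] is stable under small moves in the sector [m], that for [window 0]
    under moves in the opposite sector [0]. As the two counts agree, the common count is locally
    constant both ways along every line with a direction in the sector. *)
Lemma lattice_window_const L : lattice L ->
  (forall j x, tile_count (set_mult L) (edge e j) (x + tau e j) =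
              tile_count (set_mult L) (edge e j) x) ->
  exists2 k : nat, (0 < k)%N & forall x, tile_count (set_mult L) (window e m) x = k%:R%:E.
Proof.
move=> lL HW; pose M := set_mult L.
have HB := lattice_box lL.
have fin x := finite_nearby e_pos m2 HB x.
have [C HC] := window_bounded m lL.
pose G x := fine (tile_count M (window e m) x).
have GE x : tile_count M (window e m) x = (G x)%:E.
  rewrite /G fineK // ge0_fin_numE; last by apply: esum_ge0 => l _; apply: weight_ge0.
  by apply: le_lt_trans (HC x) _; exact: ltry.
pose first := e (i_first m2); pose last := e (i_last m2).
have along s t : 0 < s -> 0 < t -> forall x r,
    G (x + scale2 r (scale2 s last - scale2 t first)) = G x.
  move=> s0 t0 x r; apply: constant_along => z.
  set w := _ - _.
  have Hw i : 0 < det2 (e i) w by apply: det2_wrap.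
  have [r1 r10 H1] := in_sector_count e_pos m2 m (fin z).
  have [r2 r20 H2] := in_sector_count e_pos m2 0 (fin z).
  have [q q0 Hq] : exists2 q, 0 < q & forall i t, 0 < t -> t < q ->
      t * det2 (e i) w < Num.min r1 r2.
    apply: uniform_eps => i; exists (Num.min r1 r2 / det2 (e i) w).
      by rewrite divr_gt0 // lt_min r10.
    by move=> t' _; rewrite ltr_pdivlMr.
  exists q => // t' t'0 t'q.
  have w1 : in_sector e m r1 (scale2 t' w).
    move=> i; rewrite /sector_sign ltn_ord mul1r det2Zr mulr_gt0 //=.
    by apply: lt_le_trans (Hq i t' t'0 t'q) _; rewrite ge_min lexx.
  have w2 : in_sector e 0 r2 (scale2 (- t') w).
    move=> i; rewrite /sector_sign ltn0 det2Zr mulN1r mulNr opprK mulr_gt0 //=.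
    by apply: lt_le_trans (Hq i t' t'0 t'q) _; rewrite ge_min lexx orbT.
  rewrite /G; split; first by have [_ ->] := H1 _ w1.
  rewrite -scale2N !(lattice_window_step lL HW _ (leqnn m)).
  by have [_ ->] := H2 _ w2.
have Gconst x : G x = G 0.
  (* Two independent directions of the sector [m], so that constancy along lines reaches the whole
     plane. *)
  pose w1 := scale2 1 last - scale2 1 first; pose w2 := scale2 2 last - scale2 1 first.
  have D : det2 w1 w2 != 0.
    have -> : det2 w1 w2 = - det2 first last by rewrite /w1 /w2 /det2 /=; ring.
    have ne : i_first m2 != i_last m2.
      by rewrite -val_eqE /= eq_sym -lt0n -ltnS prednK // ltnW.
    by rewrite oppr_eq0; exact: e_noncol e_pos _ _ ne.
  rewrite (cramer x D) -[_ + _]add0r addrA.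
  by rewrite along ?ltr0n // along.
have [k Hk] := tile_count_nat (HC 0).
exists k; last by move=> x; rewrite -Hk !GE Gconst.
(* Positivity: the origin is interior to the translate by the lattice point [0]. *)
rewrite -(ltr0n R) -lte_fin -Hk.
have H0 l : l \in [:: (0 : R * R)] -> window e m (0 - l).
  rewrite inE => /eqP ->; rewrite subrr; apply: zonotope_window => i.
  by rewrite det20r normr0 halfwidth_gt0.
have := @tile_count_ge_sum _ M (window e m) 0 [:: 0] isT H0.
rewrite big_seq1 => /(lt_le_trans _); apply; rewrite lte_fin ltr0n.
by apply/set_mult_gt0; case: lL => /zmod_closed0.
Qed.

Lemma lattice_multi_tiles L : lattice L ->
  (forall j, L (tau e j) \/ (L (e j) /\ exists r : R, L (tau e j - scale2 r (e j)))) ->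
  multi_tiles P.
Proof.
move=> lL HL; have [k k0 Hk] := lattice_window_const lL (lattice_edge_periodic lL HL).
have [zL dL _] := lL.
have [u [v [D LE]]] := lattice_basis lL.
exists (set_mult L).
have sE : msupport (set_mult L) = L by apply/seteqP; split=> l /set_mult_gt0.
split; first by rewrite sE.
exists k => //.
(* The countably many lines carrying an edge of some translate; off them the zonotope and its window
   give the same count. *)
pose N (n : nat) : set (R * R) :=
  if @pickle_inv (int * int * 'I_m * bool)%type n is Some (a, b, i, s) then
    [set x | det2 (e i) x = det2 (e i) (zlat_map u v (a, b)) + (-1) ^+ s * halfwidth e i]
  else set0.
have : (area R).-negligible (\bigcup_n N n).
  apply: negligible_bigcup => n; rewrite /N.
  case: pickle_inv => [[[[a b] i] s]|]; last exact: negligible_set0.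
  by apply: line_negligible; apply: e_neq0 e_pos m2 i.
apply: negligibleS => x /= nx; apply: contrapT => xN; apply: nx.
have out i s l : L l -> det2 (e i) (x - l) <> (-1) ^+ (s : bool) * halfwidth e i.
  rewrite LE => -[a [b lE]] E; apply: xN; exists (pickle (a, b, i, s)); first exact: I.
  rewrite /N pickleK_inv /= /zlat_map /= -lE -E det2Br addrC.
  by apply/esym; exact: subrK.
rewrite -(Hk x); apply: (eq_tile_count (x := x) (y := x)) => l /set_mult_gt0 Ll.
split; last exact: window_zonotope.
move=> /zonotope_le Pl; apply: zonotope_window => i; rewrite lt_neqAle Pl andbT.
apply/eqP => E; have h0 := halfwidth_gt0 e_pos m2 i.
case: (ltP (det2 (e i) (x - l)) 0) => s0.
  by apply: (out i true l Ll); rewrite expr1 mulN1r -E ltr0_norm // opprK.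
by apply: (out i false l Ll); rewrite expr0 mul1r -E ger0_norm.
Qed.

End LatticeTilingCriterion.

(** * The tiling criterion *)

Section Arguments.
Variables (R : realType) (m : nat) (e : 'I_m -> R * R).
Implicit Types (x y z w u v : R * R) (i j l : 'I_m).

Lemma increasing_arguments_det2 : increasing_arguments e ->
  forall i j, (i < j)%N -> 0 < det2 (e i) (e j).
Proof.
move=> [r [th [r0 eE thlt thpi]]] i j ij; rewrite !eE det2Zl det2Zr.
do 2!apply: mulr_gt0 => //.
have -> : det2 (cos (th i), sin (th i)) (cos (th j), sin (th j)) = sin (th j - th i).
  by rewrite sinB /det2 /=; ring.
by apply: sin_gt0_pi; rewrite subr_gt0 thlt //= ltrBlDl thpi.
Qed.

(** Modulo [Lambda_ e j], walk along the partial sums from [0] up to [psum j] and from [E] down to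
    [psum j.+1], avoiding only the step that needs [tau e j]. For even [m] the two ends are
    congruent, and their difference is [e j]. *)
Lemma e_in_Lambda j : ~~ odd m -> Lambda_ e j (e j).
Proof.
move=> em; set H := Lambda_ e j.
have zH : zmod_closed [in H] by exact: zspan_zmod_closed.
have H0 := zmod_closed0 zH.
have HB x y : H x -> H y -> H (x - y) by exact: zmod_closedB.
have HN x : H x -> H (- x) by rewrite -[- x]sub0r; exact: HB.
have Ht i : i != j -> H (tau e i) by move=> ij; exact: zspan_gen.
pose E := psum e m; pose c (b : bool) : R * R := if b then E else 0.
have cN b : c (~~ b) = E - c b by case: b; rewrite /c /= ?subrr ?subr0.
have fwd n : (n <= j)%N -> H (psum e n - c (odd n)).
  elim: n => [|n IH] nj; first by rewrite psum0 subr0.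
  have {}IH := IH (ltnW nj); pose i : 'I_m := Ordinal (ltn_trans nj (ltn_ord j)).
  have ij : i != j by rewrite -val_eqE /= ltn_eqF.
  have -> : psum e n.+1 - c (odd n.+1) = - (psum e n - c (odd n)) - tau e i.
    rewrite (tau_psum e i) /= cN -/E; move: (psum e n) (psum e n.+1) (E) (c _) => a b d f.
    by apply: pairP => /=; ring.
  by apply: HB; [exact: HN|exact: Ht].
have bwd n : (n < m - j)%N -> H (psum e (m - n) - c (~~ odd n)).
  elim: n => [|n IH] nj; first by rewrite subn0 subrr.
  have {}IH := IH (ltnW nj).
  have nm : (m - n.+1 < m)%N by rewrite ltn_subrL (leq_ltn_trans _ (ltn_ord j)).
  pose i : 'I_m := Ordinal nm.
  have iS : (m - n)%N = i.+1 by rewrite /= subnSK // (leq_trans (ltnW nj)) ?leq_subr.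
  have ij : i != j.
    rewrite -val_eqE /= gtn_eqF // ltn_subRL addnC -ltn_subRL; exact: nj.
  have -> : psum e (m - n.+1) - c (~~ odd n.+1) = - (psum e (m - n) - c (~~ odd n)) - tau e i.
    rewrite iS (tau_psum e i) /= cN -/E.
    move: (psum e (m - n.+1)) (psum e (m - n.+1).+1) (E) (c _) => a b d f.
    by apply: pairP => /=; ring.
  by apply: HB; [exact: HN|exact: Ht].
have jm := ltn_ord j.
have jS : (m - (m - j.+1))%N = j.+1 by rewrite subKn.
have := bwd (m - j.+1)%N (ltac:(rewrite ltn_sub2l //)); rewrite jS.
rewrite oddB // (negbTE em) /= negbK => Hb.
have -> : e j = psum e j.+1 - c (odd j) - (psum e j - c (odd j)).
  rewrite psumS; move: (psum e j) (e j) (c _) => a b d; apply: pairP => /=; ring.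
by apply: HB => //; apply: fwd.
Qed.

Lemma parallelogram_zonotope2 : m = 2 -> (forall i j, (i < j)%N -> 0 < det2 (e i) (e j)) ->
  parallelogram (zonotope e).
Proof.
move=> m2 e_pos; have h0 : (0 < m)%N by rewrite m2.
have h1 : (1 < m)%N by rewrite m2.
pose i0 := Ordinal h0; pose i1 := Ordinal h1.
have sum2 (F : 'I_m -> R * R) : \sum_j F j = F i0 + F i1.
  rewrite (bigD1 i0) //= (bigD1 i1) //= big1 ?addr0 // => i /andP[].
  rewrite -!val_eqE /=; have := ltn_ord i; rewrite {2}m2.
  by case: (val i) => [|[|]].
exists (scale2 (- (1 / 2)) (e i0 + e i1)), (e i0), (e i1); split.
  by rewrite gt_eqF // e_pos.
apply/seteqP; split=> [_ [a [ha ->]]|_ [s [t [hs ht ->]]]].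
  exists (a i0 + 1 / 2), (a i1 + 1 / 2); split; [have := ha i0; lra|have := ha i1; lra|].
  by rewrite sum2; apply: pairP => /=; field.
exists (fun i => if i == i0 then s - 1 / 2 else t - 1 / 2); split.
  by move=> i; case: eqP => _; lra.
by rewrite sum2 /=; apply: pairP => /=; field.
Qed.

End Arguments.

Section TilingCriterion.
Variables (R : realType) (m : nat) (e : 'I_m -> R * R).
Hypothesis e_pos : forall i j : 'I_m, (i < j)%N -> 0 < det2 (e i) (e j).
Hypothesis m3 : (2 < m)%N.
Implicit Types (x y z w u v : R * R) (i j l : 'I_m) (L : set (R * R)).

Let m2 : (2 <= m)%N := ltnW m3.
Local Notation P := (zonotope e).

Lemma two_others i j : (3 < m)%N -> exists k l, [/\ k != i, k != j, l != i, l != j & k != l].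
Proof.
move=> m4; have : (1 < #|(~: [set i; j])%SET|)%N.
  have := cardsC [set i; j]%SET; rewrite card_ord => mE.
  have : (#|[set i; j]%SET| <= 2)%N by rewrite cards2; case: (_ != _).
  by rewrite -mE in m4; case: (#|[set i; j]%SET|) m4 => [|[|[|]]] //= + _; case: (#|_|) => [|[|]].
move=> /card_gt1P[k [l [+ + kl]]]; rewrite !inE !negb_or.
by move=> /andP[ki kj] /andP[li lj]; exists k, l.
Qed.

Lemma third_pair i : exists k l, [/\ k != i, l != i & k != l].
Proof.
have : (1 < #|(~: [set i])%SET|)%N by rewrite cardsC1 card_ord -ltnS prednK // ltnW // ltnW.
by move=> /card_gt1P[k [l [+ + kl]]]; rewrite !inE => ki li; exists k, l.
Qed.

Lemma Lambda_lattice u v j : det2 u v != 0 ->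
  (forall i, i != j -> Qspan u v (tau e i)) -> lattice (Lambda_ e j).
Proof.
move=> D H; have [k [l [kj lj kl]]] := third_pair j.
exact: (zspan_lattice D H kj lj (tau_noncol e_pos kl)).
Qed.

Lemma Lambda_tau_lattice u v : det2 u v != 0 ->
  (forall i, Qspan u v (tau e i)) -> lattice (Lambda_tau e).
Proof.
move=> D H; have [k [l [_ _ kl]]] := third_pair (i_first m2).
exact: (zspan_lattice D (fun i _ => H i) (i := k) (j := l) isT isT (tau_noncol e_pos kl)).
Qed.

Lemma Qtiling_even u v : ~~ odd m -> det2 u v != 0 -> Qtiling e u v ->
  exists j, [/\ forall i, i != j -> Qspan u v (tau e i), lattice (Lambda_ e j),
     Lambda_ e j `<=` Qspan u v &
     exists2 w, Qspan u v w & det2 (e j) (tau e j - w) = 0].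
Proof.
move=> em D H.
have sub j : (forall i, i != j -> Qspan u v (tau e i)) -> Lambda_ e j `<=` Qspan u v.
  by move=> Hj; apply: zspan_sub; first exact: Qspan_zmod_closed.
have [Ht|[_ [j [Hj _ Hw]]]] := Qtiling_parity e_pos D H.
  exists (i_first m2); split=> //; [exact: (Lambda_lattice D (fun i _ => Ht i))|exact: sub|].
  by exists (tau e (i_first m2)) => //; rewrite subrr det20r.
by exists j; split=> //; [exact: (Lambda_lattice D Hj)|exact: sub].
Qed.

Lemma tiling_criterion_fwd : multi_tiles P ->
  (odd m /\ lattice (Lambda_tau e)) \/
  (~~ odd m /\ exists j, lattice (Lambda_ e j) /\
     exists q : rat, det2 (e j) (tau e j) = ratr q * lattice_det (Lambda_ e j)).
Proof.
move=> [M [_ /(tiling_Qtiling e_pos m3)[u [v [D H]]]]].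
case om: (odd m); [left|right]; split=> //.
  have [Ht|[]] := Qtiling_parity e_pos D H; last by rewrite om.
  exact: (Lambda_tau_lattice D Ht).
have em : ~~ odd m by rewrite om.
have [j [Hj lL sub [w Vw Dw]]] := Qtiling_even em D H.
exists j; split=> //; have [a [b [Dab LE]]] := lattice_basis lL.
have Va : Qspan u v a by apply: sub; rewrite LE; exact: zlat_l.
have Vb : Qspan u v b by apply: sub; rewrite LE; exact: zlat_r.
have Ve : Qspan u v (e j) by apply: sub; exact: e_in_Lambda.
have [q Hq] := Qspan_det Va Vb; have [q' Hq'] := Qspan_det Ve Vw.
have q0 : ratr q != 0 :> R by apply: contra_neq Dab => q0; rewrite Hq q0 mul0r.
(* [tau e j] may lie outside the rational span, but its determinant with [e j] is that of a vector
   [w] inside it. *)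
have -> : det2 (e j) (tau e j) = det2 (e j) w.
  by move: Dw; rewrite det2Br => /eqP; rewrite subr_eq0 => /eqP.
rewrite LE lattice_det_zlat // Hq'.
(* The sign compensates for [lattice_det] being the absolute value of [det2 a b]. *)
exists (q' / q * (if 0 <= det2 a b then 1 else -1)).
rewrite !rmorphM fmorphV /=.
case: ifP => s.
  by rewrite (ger0_norm s) Hq rmorph1 mulr1 mulrA divfK.
by rewrite ltr0_norm ?ltNge ?s // Hq rmorphN1 mulrN1 mulrNN mulrA divfK.
Qed.

Lemma tiling_criterion_bwd :
  (odd m /\ lattice (Lambda_tau e)) \/
  (~~ odd m /\ exists j, lattice (Lambda_ e j) /\
     exists q : rat, det2 (e j) (tau e j) = ratr q * lattice_det (Lambda_ e j)) ->
  multi_tiles P.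
Proof.
move=> [[_ lL]|[em [j0 [lL [q Hq]]]]].
  by apply: (lattice_multi_tiles e_pos m2 lL) => j; left; exact: zspan_gen.
have [a [b [D LE]]] := lattice_basis lL.
have [k [l eE]] : zlat a b (e j0) by rewrite -LE; exact: e_in_Lambda.
rewrite LE lattice_det_zlat // in Hq.
(* A rational point of the line [tau j0 + R e_j0]: a multiple of whichever of [a], [b] is not
   parallel to [e j0], the factor being rational by condition (b). *)
have [w [Vw Dw]] : exists w, Qspan a b w /\ det2 (e j0) w = det2 (e j0) (tau e j0).
  have rat_det z : Qspan a b z -> det2 (e j0) z != 0 ->
      exists w, Qspan a b w /\ det2 (e j0) w = det2 (e j0) (tau e j0).
    move=> Vz Dz; have Ve : Qspan a b (e j0) by apply: zlat_Qspan; exists k, l.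
    exists (scale2 (det2 (e j0) (tau e j0) / det2 (e j0) z) z); split; last first.
      by rewrite det2Zr divfK.
    have [s sE] : exists s : rat, `|det2 a b| = det2 (scale2 (ratr s) a) b.
      exists (if 0 <= det2 a b then 1 else -1); rewrite det2Zl.
      case: ifP => s; first by rewrite rmorph1 mul1r ger0_norm.
      by rewrite rmorphN1 mulN1r ltr0_norm // ltNge s.
    rewrite Hq sE -det2Zl scale2A -rmorphM.
    apply: Qspan_rat => //; [by apply: QspanZ; exact: Qspan_l|exact: Qspan_r].
  have [z|z] := eqVneq (det2 (e j0) a) 0.
    apply: (rat_det b (Qspan_r a b)); apply/eqP => z'.
    have := e_neq0 e_pos m2 j0; rewrite (cramer (e j0) D) z'.
    by rewrite (det2C a (e j0)) z oppr0 !mul0r !scale2_0 addr0 eqxx.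
  exact: (rat_det a (Qspan_l a b)).
have [|n n0 Hn] := @Qspan_lattice R unit (fun=> w) a b; first by [].
have nn : n%:R != 0 :> R by rewrite pnatr_eq0 -lt0n.
(* Refining by a denominator of [w] adds [w] and keeps [e j0] and all the other [tau e i]. *)
pose L := zlat (scale2 n%:R^-1 a) (scale2 n%:R^-1 b).
have LL : zlat a b `<=` L.
  move=> _ [c [d ->]]; apply: (zlat_scale n0).
  exists (n%:Z * c), (n%:Z * d).
  by rewrite scale2Dr !scale2A !rmorphM.
apply: (@lattice_multi_tiles _ _ e e_pos m2 L).
  by apply: lattice_zlat; rewrite det2Zl det2Zr !mulf_neq0 // invr_eq0.
move=> j; have [->|jj0] := eqVneq j j0; last first.
  by left; apply: LL; rewrite -LE; exact: zspan_gen.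
right; split; first by apply: LL; exists k, l.
have [|r Hr] := @det2_eq0 _ (e j0) (tau e j0 - w) (e_neq0 e_pos m2 j0).
  by rewrite det2Br Dw subrr.
exists r; rewrite -Hr subKr; exact: zlat_scale (Hn tt).
Qed.

(** If [tau e j] is not in [L], the multiplicities at [0] and [tau e j] are [1] and [0]; [es_diff],
    with all values [0] or [1], then forces [e j] into [L]. The edge around [0] has positive count,
    hence so has the edge around [tau e j], which gives a lattice point on the line
    [tau j + R e_j]. *)
Lemma lattice_Qtiling a b : multi_tiles_with P (set_mult (zlat a b)) ->
  Qtiling e a b.
Proof.
move=> HL j; set L := zlat a b in HL.
have zL : zmod_closed [in L] by apply: zmod_closedP; [exact: zlat0|exact: zlatB].
have L0 := zmod_closed0 zL.
have [Lt|nLt] := pselect (L (tau e j)); first by left; exact: zlat_Qspan.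
right; split.
  apply: zlat_Qspan; have := es_diff (tiling_edge_system e_pos m2 HL) j 0.
  rewrite !add0r /set_mult (mem_set L0) (memNset nLt).
  by case: (boolP (e j \in L)) => [/set_mem//|_] /=; case: (_ \in _) => /=; lra.
apply: contrapT => H.
have := tiling_edge_periodic e_pos m2 HL j 0; rewrite add0r.
have -> : tile_count (set_mult L) (edge e j) (tau e j) = 0%E.
  apply: esum1 => l /set_mult_gt0 Ll; rewrite indicE memNset ?mulr0 // => -[t _ E].
  apply: H; exists l; first exact: zlat_Qspan.
  by rewrite E det2Zr det2xx mulr0.
have H0 (l : R * R) : l \in [:: (0 : R * R)] -> edge e j (0 - l).
  by rewrite inE => /eqP ->; rewrite subrr; exists 0; rewrite ?scale2_0 //; lra.
have := @tile_count_ge_sum _ (set_mult L) (edge e j) 0 [:: 0] isT H0.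
by rewrite big_seq1 /set_mult (mem_set L0) => /[swap] <-; rewrite lee_fin ler10.
Qed.

Lemma L_P_lattice : multi_tiles P -> lattice (L_P e).
Proof.
move=> /tiling_criterion_fwd; rewrite /L_P; case: ifP => [om [[]//|[]//]|om [[]//|[_ [j0 [lj0 _]]]]].
have m4 : (3 < m)%N.
  by rewrite ltn_neqAle m3 andbT; apply/eqP => m3'; rewrite -m3' in om.
have -> : [set j | lattice (Lambda_ e j)] = [set j | (fun j => `[< lattice (Lambda_ e j) >]) j].
  by apply/seteqP; split=> j /asboolP.
apply: (lattice_bigcap (i0 := j0)); first exact/asboolP.
  by move=> j /asboolP.
move=> u v i _ E a b E'.
(* As [m >= 4], two independent [tau] belong to both lattices, which makes them commensurable. *)
have [k [l [ki kj li lj kl]]] := two_others i j0 m4.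
have in_span p q j n : n != j -> Lambda_ e j = zlat p q -> Qspan p q (tau e n).
  by move=> nj EL; apply: zlat_Qspan; rewrite -EL; exact: zspan_gen.
have D := tau_noncol e_pos kl.
have sub z : Qspan u v z -> Qspan a b z.
  move=> Vz; apply: (Qspan_sub (in_span _ _ _ _ ki E') (in_span _ _ _ _ li E')).
  exact: (Qspan_basis (in_span _ _ _ _ kj E) (in_span _ _ _ _ lj E) D).
by split; apply: sub; [exact: Qspan_l|exact: Qspan_r].
Qed.

Lemma L_P_lattice_tiling L : lattice (L_P e) -> lattice L ->
  multi_tiles_with P (set_mult L) -> lattice (L_P e `&` L).
Proof.
move=> lP lL HL; have [a [b [D LE]]] := lattice_basis lL.
rewrite LE in HL; have H := lattice_Qtiling HL.
have sub : L_P e `<=` Qspan a b.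
  rewrite /L_P; case: ifP => om.
    have [Ht|[]] := Qtiling_parity e_pos D H; last by rewrite om.
    by apply: zspan_sub; [exact: Qspan_zmod_closed|].
  (* The index [j] is one of those over which the intersection is taken, so [L_P] is contained in
     [Lambda_ e j]. *)
  have [j [_ lj subj _]] := Qtiling_even (negbT om) D H.
  by move=> x /(_ j lj) /subj.
have [u [v [Duv PE]]] := lattice_basis lP.
apply: (latticeI lP lL PE LE); apply: sub; rewrite PE; [exact: zlat_l|exact: zlat_r].
Qed.

End TilingCriterion.

Theorem theorem1p8 (R : realType) (m : nat) (e : 'I_m -> R * R)
    (m_ge2 : (2 <= m)%N)
    (e_noncol : pairwise_non_collinear e)
    (e_incr : increasing_arguments e)
    (P_not_par : ~ parallelogram (zonotope e)) :
  (multi_tiles (zonotope e) <->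
     (odd m /\ lattice (Lambda_tau e)) \/
     (~~ odd m /\
      exists j0 : 'I_m,
        lattice (Lambda_ e j0) /\
        exists q : rat,
          det2 (e j0) (tau e j0) = ratr q * lattice_det (Lambda_ e j0))) /\
  (multi_tiles (zonotope e) ->
     lattice (L_P e) /\
     forall L : set (R * R),
       lattice L -> multi_tiles_with (zonotope e) (set_mult L) ->
       lattice (L_P e `&` L)).
Proof.
have e_pos := increasing_arguments_det2 e_incr.
have m3 : (2 < m)%N.
  rewrite ltn_neqAle m_ge2 andbT; apply/eqP => m2; apply: P_not_par.
  exact: parallelogram_zonotope2.
split.
  by split; [exact: tiling_criterion_fwd|exact: tiling_criterion_bwd].
move=> HP; have lP := L_P_lattice e_pos m3 HP; split=> // L lL HL.
exact: L_P_lattice_tiling.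
Qed.
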